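(* For every integer $r \geq 2$: if $C$ is a general complete intersection curve of type $(3,r)$ in $\mathbb{P}^3$, or a general complete intersection curve of type $(2,2,r)$ in $\mathbb{P}^4$, then the kernel bundle $$M_C := \ker\bigl(ev : H^0(\mathcal{O}_{\mathbb{P}^n}(1)) \otimes \mathcal{O}_C \to \mathcal{O}_C(1)\bigr)$$ (with $n = 3$ and $n = 4$ respectively) is a semistable vector bundle on $C$.
   Context: We work over an algebraically closed field of characteristic zero. A complete intersection curve of type $(d_1,\dots,d_{n-1})$ in $\mathbb{P}^n$ is a curve which is the scheme-theoretic intersection of hypersurfaces of degrees $d_1,\dots,d_{n-1}$; ''general'' means for a general choice of these hypersurfaces. Semistability is slope-semistability. *)

(* Defs.v *)
From mathcomp Require Import all_boot all_order all_algebra.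
From mathcomp Require Import boolp classical_sets.
From mathcomp Require Import mpoly.

Set Implicit Arguments.
Unset Strict Implicit.
Unset Printing Implicit Defensive.

Import GRing.Theory.

Local Open Scope classical_set_scope.
Local Open Scope ring_scope.

(* Coherent sheaves on a projective scheme, following Serre.

   Let R = k[x_0, ..., x_n], I = (f_1, ..., f_c) with the f_i homogeneous, and
   S = R / I, so that C = Proj S is the scheme-theoretic intersection of the
   hypersurfaces f_i = 0 in P^n.  A graded S-module M has an associated
   quasi-coherent sheaf M~ on C; the functor M |-> M~ is exact, every coherent
   subsheaf of (S^N)~ = O_C^N is A~ for some graded submodule A of S^N, and A
   is unique up to its components of low degree.  None of the notions below
   depends on these components.

   In order to avoid quotient types, a graded submodule of S^N is represented by
   its preimage in R^N, i.e. by a graded R-submodule of R^N containing I R^N. *)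

Section ProjectiveScheme.

Variables (k : fieldType) (n c : nat) (f : 'I_c -> {mpoly k[n.+1]}).

Local Notation R := {mpoly k[n.+1]}.

Definition equation_ideal : set R :=
  [set p | exists a : 'I_c -> R, p = \sum_i a i * f i].

(* I R^N, the zero submodule of S^N. *)
Definition zero_sheaf N : set 'rV[R]_N :=
  [set v | forall j, equation_ideal (v 0 j)].

(* R^N, i.e. the sheaf O_C^N. *)
Definition free_sheaf N : set 'rV[R]_N := setT.
Arguments free_sheaf : clear implicits.

(* A is an R-submodule of R^N, contains I R^N, and is graded.  As S is
   Noetherian, A is finitely generated, so that A~ is coherent. *)
Definition coherent_sheaf N (A : set 'rV[R]_N) : Prop :=
  [/\ zero_sheaf (N := N) `<=` A,
      forall (p : R) u v, A u -> A v -> A (p *: u + v)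
    & forall d v, A v -> A (map_mx (pihomog mdeg d) v)].

Definition graded_part N (A : set 'rV[R]_N) (m : nat) : set 'rV[R]_N :=
  [set v | A v /\ forall j, v 0 j \is m.-homog].

(* The k-vector space A_m / (I R^N)_m has dimension D: it has a basis with D
   elements. *)
Definition graded_dim N (A : set 'rV[R]_N) (m D : nat) : Prop :=
  exists b : 'I_D -> 'rV[R]_N,
    (forall i, graded_part A m (b i)) /\
    forall v, graded_part A m v ->
      exists! t : 'rV[k]_D,
        zero_sheaf (v - \sum_i (t 0 i)%:MP_[n.+1] *: b i).

(* The Hilbert polynomial of E = A~: the polynomial P with
   P(m) = dim (A / I R^N)_m for all large m; it is also the polynomial
   m |-> chi (E(m)).  It exists by the Hilbert-Serre theorem, so that the
   default value 0 is irrelevant. *)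
Definition hilbert_poly N (A : set 'rV[R]_N) : {poly rat} :=
  xget 0 [set P : {poly rat} |
    exists m0, forall m, (m0 <= m)%N ->
      exists2 D : nat, graded_dim A m D & P.[m%:R] = D%:R].

(* The dimension of C is the degree of its Hilbert polynomial. *)
Definition complete_intersection_curve : Prop :=
  c.+1 = n /\ size (hilbert_poly (free_sheaf 1)) = 2%N.

(* Rank and degree on the projective curve C (Huybrechts-Lehn, The Geometry of
   Moduli Spaces of Sheaves, 1.2.2 and 1.2.11).  As chi (E(m)) = deg(E(m)) +
   rk(E) chi(O_C), the coefficient of m is rk(E) deg(C), and
   deg(E) = chi(E) - rk(E) chi(O_C). *)
Definition sheaf_rank N (A : set 'rV[R]_N) : rat :=
  (hilbert_poly A)`_1 / (hilbert_poly (free_sheaf 1))`_1.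

Definition sheaf_degree N (A : set 'rV[R]_N) : rat :=
  (hilbert_poly A)`_0 - sheaf_rank A * (hilbert_poly (free_sheaf 1))`_0.

Definition slope N (A : set 'rV[R]_N) : rat := sheaf_degree A / sheaf_rank A.

(* Closed points of C, in homogeneous coordinates; they are all k-rational when
   k is algebraically closed. *)
Definition closed_point (x : 'I_n.+1 -> k) : Prop :=
  (exists i, x i != 0) /\ forall i, (f i).@[x] = 0.

(* Every closed point of C has a neighbourhood D_+(g) over which A~ is free of
   rank r, in the form: the localized module A_g is free over S_g, with a basis
   of r homogeneous elements.  Some x_i is invertible at the point, so bases in
   arbitrary degrees are allowed. *)
Definition locally_free N (A : set 'rV[R]_N) (r : nat) : Prop :=
  forall x, closed_point x ->
    exists (e : nat) (g : R) (d : 'I_r -> nat) (b : 'I_r -> 'rV[R]_N),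
    [/\ g \is e.-homog /\ g.@[x] != 0,
        forall j, graded_part A (d j) (b j),
        forall v, A v -> exists (l : nat) (a : 'I_r -> R),
          zero_sheaf (g ^+ l *: v - \sum_j a j *: b j)
      & forall a : 'I_r -> R, zero_sheaf (\sum_j a j *: b j) ->
          exists l : nat, forall j, equation_ideal (g ^+ l * a j)].

Definition vector_bundle N (A : set 'rV[R]_N) : Prop :=
  coherent_sheaf A /\ exists r, locally_free A r.

Definition semistable_vector_bundle N (A : set 'rV[R]_N) : Prop :=
  vector_bundle A /\
  forall B : set 'rV[R]_N,
    coherent_sheaf B -> B `<=` A -> 0 < sheaf_rank B -> slope B <= slope A.

(* H^0(O_{P^n}(1)) has basis x_0, ..., x_n, so that the evaluation map
   H^0(O_{P^n}(1)) (x) O_C -> O_C(1) is induced by S^(n+1) -> S(1),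
   v |-> sum_i v_i x_i. *)
Definition evaluation (v : 'rV[R]_n.+1) : R := \sum_i v 0 i * 'X_i.

Definition kernel_bundle : set 'rV[R]_n.+1 :=
  [set v | equation_ideal (evaluation v)].

End ProjectiveScheme.

Section General.

Variables (k : fieldType) (n c : nat) (d : c.-tuple nat).

Definition hypersurfaces (f : 'I_c -> {mpoly k[n.+1]}) : Prop :=
  forall i, f i \is (tnth d i).-homog.

(* Indices of the coefficients of c polynomials of degrees at most d_i. *)
Definition coef_index : finType :=
  {i : 'I_c & 'X_{1..n.+1 < (tnth d i).+1}}.

Definition coefs (f : 'I_c -> {mpoly k[n.+1]}) (j : 'I_#|coef_index|) : k :=
  let t : coef_index := enum_val j in (f (tag t))@_(tagged t).

(* P holds for a general choice of hypersurfaces of degrees d_1, ..., d_c: it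
   holds on a nonempty principal open subset Phi <> 0 of the affine space of
   tuples of forms of these degrees.  Every nonempty Zariski open subset
   contains such a subset. *)
Definition for_general_hypersurfaces
    (P : ('I_c -> {mpoly k[n.+1]}) -> Prop) : Prop :=
  exists Phi : {mpoly k[#|coef_index|]},
    (exists2 f, hypersurfaces f & Phi.@[coefs f] != 0) /\
    forall f, hypersurfaces f -> Phi.@[coefs f] != 0 -> P f.

End General.

(* Main.v *)
Require Import Defs.
From HB Require Import structures.
From mathcomp Require Import all_boot all_order all_fingroup all_algebra.
From mathcomp Require Import boolp classical_sets.
From mathcomp Require Import mpoly zify ring lra.

(* Let M be the kernel bundle of C, and let F be the kernel of a map from O_C^q to a twist of
   O_D, where the divisor D is cut out on C by a form h in x_0, x_1.  If M(a) (x) F has no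
   sections, then neither has B(a) (x) F for any subsheaf B of M; counting dimensions, this
   bounds the degree of B, and the bound is the slope of M for suitable a, q and deg h.  The
   vanishing of H^0(M(a) (x) F) is an open condition on the equations of C, so that it is
   enough to check it on one degenerate curve.  All its equations are products of linear forms,
   and it is a union of lines: r copies of a triangle (in P^3) or of a quadrilateral (in P^4),
   in which corresponding lines of different copies meet.

   The lines are treated in some order.  A section restricted to a line vanishes at the points
   of D assigned to the line and at its nodes on the lines already treated; this leaves a
   fixed form times a constant vector w with sum_i w_i x_i = 0 on the line.  Lines treated
   simultaneously form a connected chain, along which w is constant up to a factor; comparing
   the equation on two lines that differ in the coordinate x_j gives w_j = 0, and the chain
   contains such lines for all j.

   For general equations the monomials with x_(j+2)-degree < d_j form a basis of the coordinate
   ring, which is therefore free over k[x_0, x_1]; this replaces all cohomology. *)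

(** The constants arise as follows. Let delta be the degree of C, the number of lines. Since h is a
    form in x_0, x_1, D has equally many points on every line, while the induction wants [a] minus
    the number of nodes with treated lines, which varies. So the lines are indexed by a finite
    abelian group, q is its order delta, and the i-th component of a section is studied with the
    order of treatment translated by the i-th element: over all translations, every line asks for
    the same total. Let E be the number of nodes and b the number of nodes between lines treated at
    different stages. Then deg h = delta a - b, and the bound reads slope(B) <= E - b - delta. As
    M_C in P^n has slope - delta / n, at most delta - delta / n nodes may lie inside stages. Stages
    that are trees of n lines, degenerate rational normal curves, meet this exactly: there are delta
    / n of them, with n - 1 nodes each. They are available because the equations other than the last
    cut out a surface of degree n in P^n, whose hyperplane sections are elliptic normal curves and
    degenerate to cycles of n lines. *)

Set Implicit Arguments.
Unset Strict Implicit.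
Unset Printing Implicit Defensive.

Import Order.TTheory GRing.Theory Num.Theory.
Local Open Scope ring_scope.

(** * Linear algebra modulo a subspace *)

Section LinearAlgebra.

Variable K : fieldType.

(** The left kernel of [C] has dimension at least #|T| - #|S|. Exactly that many rows of a basis are
    kept, so that the index type depends on the two cardinals only; the subtraction is truncated. *)
Lemma left_kernel_family (T S : finType) (C : T -> S -> K) :
  exists X : 'I_(#|T| - #|S|) -> T -> K,
    (forall i s, \sum_t X i t * C t s = 0) /\
    forall y : 'I_(#|T| - #|S|) -> K,
      (forall t, \sum_i y i * X i t = 0) -> forall i, y i = 0.
Proof.
pose M := \matrix_(i < #|T|, j < #|S|) C (enum_val i) (enum_val j).
have le_r : (#|T| - #|S| <= \rank (kermx M))%N.
  by rewrite mxrank_ker leq_sub2l // rank_leq_col.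
pose B := row_base (kermx M).
have BM : B *m M = 0.
  by apply/sub_kermxP; rewrite eq_row_base.
have Bfree : row_free B by apply: row_base_free.
move: B BM Bfree => B BM Bfree.
exists (fun i t => B (widen_ord le_r i) (enum_rank t)); split.
  move=> i s; have := congr1 (fun A : 'M_(_, _) => A (widen_ord le_r i) (enum_rank s)) BM.
  rewrite !mxE => H; rewrite -[RHS]H [RHS](reindex (@enum_rank T)) /=; last first.
    by apply: onW_bij; apply: enum_rank_bij.
  by apply: eq_bigr => t _; rewrite !mxE !enum_rankK.
move=> y y0 i.
pose Y := \row_(j < \rank (kermx M))
  (if insub (val j) is Some j' then y j' else 0).
have YB : Y *m B = 0.
  apply/rowP => l; rewrite !mxE.
  have := y0 (enum_val l); rewrite enum_valK => H; rewrite -[RHS]H.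
  rewrite (bigID (fun j : 'I__ => (val j < #|T| - #|S|)%N)) /=.
  rewrite [X in _ + X]big1 ?addr0; last first.
    by move=> j /negbTE jlt; rewrite !mxE insubF ?mul0r.
  rewrite [LHS](reindex (widen_ord le_r)) /=.
    apply: eq_big => [j | j _]; first by rewrite ltn_ord.
    by rewrite !mxE /= valK.
  exists (fun j => odflt i (insub (val j))) => j; rewrite ?inE /= => jlt.
    by rewrite /= valK.
  by apply: val_inj; rewrite /= insubT.
have Y0 : Y = 0.
  by apply/eqP; rewrite -(mulmx_free_eq0 _ Bfree) YB.
have := congr1 (fun A : 'rV_(_) => A 0 (widen_ord le_r i)) Y0.
by rewrite !mxE /= valK.
Qed.

Lemma left_kernel_nontrivial (T S : finType) (C : T -> S -> K) :
  (#|S| < #|T|)%N ->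
  exists x : T -> K, (exists t, x t != 0) /\ forall s, \sum_t x t * C t s = 0.
Proof.
move=> ltST; have [X [XC Xfree]] := left_kernel_family C.
have lt0 : (0 < #|T| - #|S|)%N by rewrite subn_gt0.
exists (X (Ordinal lt0)); split; last exact: XC.
apply: contrapT => /forallNP X0.
suff H t : \sum_i (i == Ordinal lt0)%:R * X i t = 0.
  by have /eqP := Xfree (fun i => (i == Ordinal lt0)%:R) H (Ordinal lt0); rewrite (eqxx (Ordinal lt0)) oner_eq0.
rewrite (bigD1 (Ordinal lt0)) //= mul1r big1 ?addr0.
  by have /negP/negPn/eqP := X0 t.
by move=> i /negbTE->; rewrite mul0r.
Qed.

Lemma big_option (W : nmodType) (T : finType) (F : option T -> W) :
  \sum_o F o = F None + \sum_t F (Some t).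
Proof.
rewrite (bigD1 None) //=; congr (_ + _).
rewrite (reindex_omap Some id) /=; last by case.
by apply: eq_bigl => t; rewrite eqxx.
Qed.

Variable V : lmodType K.

Definition subspace (Z : V -> Prop) :=
  Z 0 /\ forall c u v, Z u -> Z v -> Z (c *: u + v).

(** Linear algebra in V / Z, carried out on representatives: Z will be an ideal, the zero submodule
    or the multiples of x_0, and several such Z are used on the same V. *)
Definition independent (Z : V -> Prop) (T : finType) (b : T -> V) :=
  forall c : T -> K, Z (\sum_t c t *: b t) -> forall t, c t = 0.

Definition spanned (Z : V -> Prop) (T : finType) (b : T -> V) (v : V) :=
  exists c : T -> K, Z (v - \sum_t c t *: b t).

(** An upper bound for the dimension of the image of U in V / Z; [spanning_family] turns it into a
    maximal independent family. *)
Definition bounded_dim (Z U : V -> Prop) (D : nat) :=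
  forall (T : finType) (b : T -> V),
    (forall t, U (b t)) -> independent Z b -> (#|T| <= D)%N.

Lemma subspaceD Z : subspace Z -> forall u v, Z u -> Z v -> Z (u + v).
Proof. by case=> _ ZD u v Zu Zv; rewrite -[u]scale1r; apply: ZD. Qed.

Lemma subspaceZ Z : subspace Z -> forall c u, Z u -> Z (c *: u).
Proof. by case=> Z0 ZD c u Zu; rewrite -[_ *: u]addr0; apply: ZD. Qed.

Lemma subspaceN Z : subspace Z -> forall u, Z u -> Z (- u).
Proof. by move=> sZ u Zu; rewrite -scaleN1r; apply: subspaceZ. Qed.

Lemma subspaceB Z : subspace Z -> forall u v, Z u -> Z v -> Z (u - v).
Proof. by move=> sZ u v Zu Zv; apply: subspaceD => //; apply: subspaceN. Qed.

Lemma subspace_sum Z : subspace Z -> forall (T : Type) (s : seq T) (P : pred T) (F : T -> V),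
  (forall t, P t -> Z (F t)) -> Z (\sum_(t <- s | P t) F t).
Proof. by move=> sZ T s P F ZF; apply: big_ind => //; [case: sZ | apply: subspaceD]. Qed.

Lemma subspace_lincomb Z : subspace Z -> forall (T : finType) (c : T -> K) (b : T -> V),
  (forall t, Z (b t)) -> Z (\sum_t c t *: b t).
Proof. by move=> sZ T c b Zb; apply: subspace_sum => // t _; apply: subspaceZ. Qed.

Lemma spanned_matrix Z (T S : finType) (b : T -> V) (b' : S -> V) :
  (forall t, spanned Z b' (b t)) ->
  exists C : T -> S -> K, forall t, Z (b t - \sum_s C t s *: b' s).
Proof. by move=> /choice[C HC]; exists C. Qed.

Lemma lincomb_spanned Z (T S : finType) (b : T -> V) (b' : S -> V) C :
  subspace Z -> (forall t, Z (b t - \sum_s C t s *: b' s)) ->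
  forall x : T -> K,
    Z (\sum_t x t *: b t - \sum_s (\sum_t x t * C t s) *: b' s).
Proof.
move=> sZ HC x.
have -> : \sum_s (\sum_t x t * C t s) *: b' s = \sum_t x t *: \sum_s C t s *: b' s.
  rewrite (eq_bigr (fun s => \sum_t (x t * C t s) *: b' s)); last first.
    by move=> s _; rewrite scaler_suml.
  rewrite exchange_big /=; apply: eq_bigr => t _; rewrite scaler_sumr.
  by apply: eq_bigr => s _; rewrite scalerA.
rewrite -sumrB; apply: subspace_sum => // t _; rewrite -scalerBr.
exact: subspaceZ.
Qed.

Lemma spanned_mem Z (T : finType) (b : T -> V) t : subspace Z -> spanned Z b (b t).
Proof.
move=> [Z0 _]; exists (fun t' => (t' == t)%:R).
rewrite (bigD1 t) //= eqxx scale1r big1 ?addr0 ?subrr // => i /negbTE->.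
by rewrite scale0r.
Qed.

Lemma spanned_subspace Z (T : finType) (b : T -> V) :
  subspace Z -> subspace (spanned Z b).
Proof.
move=> sZ; split.
  exists (fun=> 0); rewrite big1 ?subr0; first by case: sZ.
  by move=> t _; rewrite scale0r.
move=> c u v [x Hx] [y Hy]; exists (fun t => c * x t + y t).
have -> : \sum_t (c * x t + y t) *: b t
  = c *: (\sum_t x t *: b t) + \sum_t y t *: b t.
  by rewrite scaler_sumr -big_split; apply: eq_bigr => t _; rewrite scalerDl scalerA.
rewrite opprD addrACA -scalerBr.
by case: sZ => _; apply.
Qed.

Lemma independent_card Z (T S : finType) (b : T -> V) (b' : S -> V) :
  subspace Z -> independent Z b -> (forall t, spanned Z b' (b t)) ->
  (#|T| <= #|S|)%N.
Proof.
move=> sZ ib /spanned_matrix[C HC]; rewrite leqNgt; apply/negP.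
move=> /(left_kernel_nontrivial C)[x [[t xt] xC]].
have := lincomb_spanned sZ HC x; rewrite [X in _ - X]big1; last first.
  by move=> s _; rewrite xC scale0r.
by rewrite subr0 => /ib/(_ t) x0; rewrite x0 eqxx in xt.
Qed.

Lemma independent_of_card Z (T S : finType) (b : T -> V) (b' : S -> V) :
  subspace Z -> independent Z b -> (forall t, spanned Z b' (b t)) ->
  #|T| = #|S| -> independent Z b'.
Proof.
move=> sZ ib /spanned_matrix[C HC] eqTS c Zc.
(* A relation [c] among the [b'] is added to the coordinate rows of the [b] as one more row. These
   #|S| + 1 rows are dependent; independence of [b] kills the coefficients of the old rows, so that
   the coefficient of the new row is nonzero and [c] vanishes. *)
pose C' (o : option T) s := if o is Some t then C t s else c s.
have [|x [[t0 xt0] xC]] := @left_kernel_nontrivial (option T) S C'.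
  by rewrite card_option eqTS.
have {}xC s : \sum_t x (Some t) * C t s = - (x None * c s).
  by apply/eqP; rewrite -addr_eq0; apply/eqP; rewrite -[RHS](xC s) big_option /= addrC.
have x0 t : x (Some t) = 0.
  apply: (ib (fun t => x (Some t))).
  have := lincomb_spanned sZ HC (fun t => x (Some t)).
  have -> : \sum_s (\sum_t x (Some t) * C t s) *: b' s
    = - (x None *: \sum_s c s *: b' s).
    rewrite scaler_sumr -sumrN; apply: eq_bigr => s _.
    by rewrite xC scaleNr scalerA.
  rewrite opprK => H.
  have := subspaceB sZ H (subspaceZ sZ (x None) Zc).
  by rewrite addrK.
have xN : x None != 0 by case: t0 xt0 => // t; rewrite x0 eqxx.
move=> s; have := xC s; rewrite big1; last by move=> t _; rewrite x0 mul0r.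
by move/eqP; rewrite eq_sym oppr_eq0 mulf_eq0 (negbTE xN) => /eqP.
Qed.

Lemma spanned_of_card Z (T S : finType) (b : T -> V) (b' : S -> V) v :
  subspace Z -> independent Z b -> (forall t, spanned Z b' (b t)) ->
  spanned Z b' v -> (#|S| <= #|T|)%N -> spanned Z b v.
Proof.
move=> sZ ib bb' vb' leST; apply: contrapT => nv.
pose bv (o : option T) := if o is Some t then b t else v.
suff : independent Z bv.
  move/(independent_card sZ) => /(_ S b') H.
  suff : (#|{: option T}| <= #|S|)%N by rewrite card_option ltnNge leST.
  by apply: H => -[t|]; [exact: bb'|exact: vb'].  
move=> x; rewrite big_option /= => Zx.
have xN : x None = 0.
  apply: contrapT => /eqP xN; apply: nv.
  exists (fun t => - ((x None)^-1 * x (Some t))).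
  have := subspaceZ sZ (x None)^-1 Zx.
  rewrite scalerDr scalerA mulVf // scale1r scaler_sumr => H.
  rewrite -sumrN (eq_bigr (fun t => (x None)^-1 *: (x (Some t) *: b t))) // => t _.
  by rewrite scaleNr opprK scalerA.
move: Zx; rewrite xN scale0r add0r => /ib x0.
by case=> [t|] //; exact: x0.
Qed.

Lemma independent_zero Z (T : finType) (b : T -> V) :
  (forall t, Z (b t)) -> independent Z b -> #|T| = 0%N.
Proof.
move=> Zb ib; apply: eq_card0 => s; apply/negP => _.
have : Z (\sum_t ((t == s)%:R : K) *: b t).
  rewrite (bigD1 s) //= eqxx scale1r big1 ?addr0 // => t /negbTE->.
  by rewrite scale0r.
by move/(ib (fun t => (t == s)%:R))/(_ s)/eqP; rewrite eqxx oner_eq0.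
Qed.

Lemma spanning_family Z U D : subspace Z -> bounded_dim Z U D ->
  exists s (b : 'I_s -> V), [/\ (s <= D)%N, forall i, U (b i), independent Z b
    & forall v, U v -> spanned Z b v].
Proof.
move=> sZ bU.
pose P s := `[< exists b : 'I_s -> V, (forall i, U (b i)) /\ independent Z b >].
have P0 : exists s, P s.
  exists 0; apply/asboolP; exists (fun=> 0); split=> [[]//|c _ []//].
have PD s : P s -> (s <= D)%N.
  by move/asboolP=> [b [Ub ib]]; have := bU _ b Ub ib; rewrite card_ord.
have [s /asboolP[b [Ub ib]] smax] := ex_maxnP P0 PD.
exists s, b; split=> //; first by apply: PD; apply/asboolP; exists b.
move=> v Uv; apply: contrapT => nv.
suff /smax : P s.+1 by rewrite ltnn.
apply/asboolP; exists (fun i => if unlift ord0 i is Some j then b j else v); split.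
  by move=> i; case: unliftP.
move=> x; rewrite big_ord_recl unlift_none => Zx.
have xN : x ord0 = 0.
  apply: contrapT => /eqP xN; apply: nv.
  exists (fun t => - ((x ord0)^-1 * x (lift ord0 t))).
  have := subspaceZ sZ (x ord0)^-1 Zx.
  rewrite scalerDr scalerA mulVf // scale1r scaler_sumr => H.
  rewrite -sumrN (eq_bigr (fun t => (x ord0)^-1 *: (x (lift ord0 t) *:
    (if unlift ord0 (lift ord0 t) is Some j then b j else v)))) // => t _.
  by rewrite liftK scaleNr opprK scalerA.
move: Zx; rewrite xN scale0r add0r.
under eq_bigr => i _ do rewrite liftK.
move/ib=> x0 i; case: (unliftP ord0 i) => [j ->|->] //; exact: x0.
Qed.

End LinearAlgebra.

Section LinearMaps.

Variables (K : fieldType) (V W : lmodType K).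

(** Rank and nullity for the map [b t] |-> [w t] from V / Z to W / Y, which is given on the family
    only: the image has dimension at most #|S|. *)
Lemma kernel_family (Z : V -> Prop) (Y : W -> Prop) (T S : finType)
    (b : T -> V) (w : T -> W) (w' : S -> W) :
  subspace Y -> independent Z b -> (forall t, spanned Y w' (w t)) ->
  exists X : 'I_(#|T| - #|S|) -> T -> K,
    independent Z (fun i => \sum_t X i t *: b t) /\
    forall i, Y (\sum_t X i t *: w t).
Proof.
move=> sY ib /spanned_matrix[C HC].
have [X [XC Xfree]] := left_kernel_family C.
exists X; split=> [c Zc | i]; last first.
  have := lincomb_spanned sY HC (X i); rewrite [X in _ - X]big1 ?subr0 //.
  by move=> s _; rewrite XC scale0r.
apply: Xfree => t; apply: (ib (fun t => \sum_i c i * X i t)).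
suff <- : \sum_i c i *: \sum_t X i t *: b t = \sum_t (\sum_i c i * X i t) *: b t by [].
under eq_bigr => i _ do rewrite scaler_sumr.
rewrite exchange_big /=; apply: eq_bigr => t' _; rewrite scaler_suml.
by apply: eq_bigr => i _; rewrite scalerA.
Qed.

(** The [b'] lie in the kernel of V / Z -> V / Z'. Joined to a family of U which is independent
    modulo Z', they remain independent modulo Z. *)
Lemma bounded_dim_quotient (Z Z' U : V -> Prop) (S T : finType) (b : S -> V) (b' : T -> V) :
  subspace Z -> subspace Z' -> (forall v, Z v -> Z' v) ->
  (forall u, U u -> spanned Z b u) ->
  (forall t, U (b' t)) -> (forall t, Z' (b' t)) -> independent Z b' ->
  bounded_dim Z' U (#|S| - #|T|).
Proof.
move=> sZ sZ' ZZ' Ub Ub' Zb' ib' R c Uc ic.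
pose bc (x : R + T) := match x with inl i => c i | inr t => b' t end.
have /(independent_card sZ) : independent Z bc.
  move=> x; rewrite big_sumType /= => Zx.
  have xl i : x (inl i) = 0.
    apply: (ic (fun i => x (inl i))).
    have := subspaceB sZ' (ZZ' _ Zx) (subspace_lincomb sZ' (fun t => x (inr t)) Zb').
    by rewrite addrK.
  move: Zx; rewrite big1 ?add0r; last by move=> i _; rewrite xl scale0r.
  by move/ib' => xr [i|t]; [exact: xl | exact: xr].
move=> /(_ S b) H.
have le : (#|{: R + T}| <= #|S|)%N.
  by apply: H => -[i|t]; apply: Ub; [apply: Uc | apply: Ub'].
rewrite card_sum in le.
by have := leq_sub2r #|T| le; rewrite addnK.
Qed.

End LinearMaps.

(* An alias of the matrix type on which scalars are restricted to k. *)
Definition kmatrix (k : fieldType) (n p q : nat) := 'M[{mpoly k[n]}]_(p, q).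

Section RestrictionOfScalars.

Variables (k : fieldType) (n p q : nat).

HB.instance Definition _ := GRing.Zmodule.on (kmatrix k n p q).

Definition kmatrix_scale (c : k) (v : kmatrix k n p q) : kmatrix k n p q :=
  c%:MP_[n] *: (v : 'M_(p, q)).

Fact kmatrix_scaleA a b v : kmatrix_scale a (kmatrix_scale b v) = kmatrix_scale (a * b) v.
Proof. by rewrite /kmatrix_scale scalerA mpolyCM. Qed.

Fact kmatrix_scale1 : left_id 1 kmatrix_scale.
Proof. by move=> v; rewrite /kmatrix_scale mpolyC1 scale1r. Qed.

Fact kmatrix_scaleDr : right_distributive kmatrix_scale +%R.
Proof. by move=> a u v; rewrite /kmatrix_scale scalerDr. Qed.

Fact kmatrix_scaleDl v : {morph kmatrix_scale^~ v : a b / a + b}.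
Proof. by move=> a b; rewrite /kmatrix_scale mpolyCD scalerDl. Qed.

HB.instance Definition _ := GRing.Zmodule_isLmodule.Build k (kmatrix k n p q)
  kmatrix_scaleA kmatrix_scale1 kmatrix_scaleDr kmatrix_scaleDl.

Lemma kmatrix_scaleE (c : k) (v : kmatrix k n p q) : c *: v = c%:MP_[n] *: (v : 'M_(p, q)).
Proof. by []. Qed.

Lemma kmatrix_mxE (c : k) (v : kmatrix k n p q) i j : (c *: v) i j = c *: (v i j).
Proof. by rewrite kmatrix_scaleE mxE mul_mpolyC. Qed.

End RestrictionOfScalars.

(** * Complete intersection ideals and normal forms *)

Section EquationIdeal.

Variables (k : fieldType) (n c : nat) (f : 'I_c -> {mpoly k[n.+1]}).
Local Notation R := {mpoly k[n.+1]}.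
Local Notation I := (equation_ideal f).

Lemma equation_ideal0 : I 0.
Proof. by exists (fun=> 0); rewrite big1 // => i _; rewrite mul0r. Qed.

Lemma equation_idealD p q : I p -> I q -> I (p + q).
Proof.
move=> [a ->] [b ->]; exists (fun i => a i + b i).
by rewrite -big_split; apply: eq_bigr => i _; rewrite mulrDl.
Qed.

Lemma equation_idealM p q : I q -> I (p * q).
Proof.
move=> [a ->]; exists (fun i => p * a i).
by rewrite mulr_sumr; apply: eq_bigr => i _; rewrite mulrA.
Qed.

Lemma equation_idealZ (e : k) q : I q -> I (e *: q).
Proof. by move=> Iq; rewrite -mul_mpolyC; apply: equation_idealM. Qed.

Lemma equation_idealN p : I p -> I (- p).
Proof. by move=> Ip; rewrite -mulN1r; apply: equation_idealM. Qed.

Lemma equation_idealB p q : I p -> I q -> I (p - q).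
Proof. by move=> Ip Iq; apply: equation_idealD => //; apply: equation_idealN. Qed.

Lemma equation_ideal_subspace : subspace I.
Proof.
split; first exact: equation_ideal0.
by move=> e u v Iu Iv; apply: equation_idealD => //; apply: equation_idealZ.
Qed.

Lemma equation_ideal_sum (T : Type) (s : seq T) (P : pred T) (F : T -> R) :
  (forall t, P t -> I (F t)) -> I (\sum_(t <- s | P t) F t).
Proof. exact: subspace_sum equation_ideal_subspace _ _ _ _. Qed.

Lemma equation_ideal_gen i : I (f i).
Proof.
exists (fun j => (j == i)%:R); rewrite (bigD1 i) //= eqxx mul1r big1 ?addr0 //.
by move=> j /negbTE->; rewrite mul0r.
Qed.

Lemma equation_ideal_congr p q r : I (p - q) -> I (q - r) -> I (p - r).
Proof. by move=> H1 H2; rewrite -(subrK q p) -addrA; apply: equation_idealD. Qed.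

Variable d : 'I_c -> nat.
Hypothesis f_homog : forall j, f j \is (d j).-homog.

Lemma pihomog_mul m e (a g : R) : g \is e.-homog ->
  pihomog mdeg m (a * g) = if (e <= m)%N then pihomog mdeg (m - e) a * g else 0.
Proof.
move=> hg; rewrite {1}(pihomog_partitionE (leqnn (msize a))).
rewrite mulr_suml linear_sum /=.
have E i : pihomog mdeg m (pihomog mdeg i a * g) =
   if (i + e == m)%N then pihomog mdeg i a * g else 0.
  have hi : pihomog mdeg i a * g \is (i + e)%N.-homog.
    by apply: dhomogM => //; apply: pihomogP.
  by case: eqP => [<-|/eqP ne]; [apply: pihomog_dE | apply: pihomog_ne0 ne hi].
under eq_bigr => i _ do rewrite E.
case: leqP => em; last first.
  by rewrite big1 // => i _; case: eqP => // Ei; rewrite -Ei ltnNge leq_addl in em.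
rewrite -big_mkcond /=.
case: (ltnP (m - e) (msize a)) => lt.
  rewrite (big_pred1 (Ordinal lt)) // => i; rewrite inE -val_eqE /=.
  by rewrite -(eqn_add2r e i) subnK.
rewrite big1; last first.
  move=> i /eqP Ei; rewrite -Ei addnK in lt.
  by have := ltn_ord i; rewrite ltnNge lt.
rewrite pihomogE big_seq_cond big1 ?mul0r // => i /andP[Hi /eqP Ei].
by have := msize_mdeg_lt Hi; rewrite ltnNge Ei lt.
Qed.

Lemma equation_ideal_pihomog m p : I p -> I (pihomog mdeg m p).
Proof.
move=> [a ->]; rewrite linear_sum; apply: equation_ideal_sum => j _ /=.
rewrite (pihomog_mul _ _ (f_homog j)); case: leqP => _; last exact: equation_ideal0.
by apply: equation_idealM; apply: equation_ideal_gen.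
Qed.

End EquationIdeal.

Section NormalForms.

Variables (k : fieldType) (c : nat) (d : 'I_c -> nat).
Local Notation R := {mpoly k[c.+2]}.

Definition fibre_var (j : 'I_c) : 'I_c.+2 := lift ord0 (lift ord0 j).

(** The index [i] keeps the first i equations only: uniqueness of normal forms is proved by adding
    the equations one at a time. *)
Definition reduced (i : nat) (mu : 'X_{1..c.+2}) :=
  [forall j : 'I_c, (j < i)%N ==> (mu (fibre_var j) < d j)%N].

Lemma reducedP i (mu : 'X_{1..c.+2}) :
  reflect (forall j : 'I_c, (j < i)%N -> (mu (fibre_var j) < d j)%N) (reduced i mu).
Proof.
by apply: (iffP forallP) => H j; [move=> ji; have := H j; rewrite ji | apply/implyP; apply: H].
Qed.

Definition normal (i : nat) (p : R) := forall mu, p@_mu != 0 -> reduced i mu.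

Definition truncate (i : nat) (f : 'I_c -> R) (j : 'I_c) : R :=
  if (j < i)%N then f j else 0.

Lemma normal_subspace i : subspace (normal i).
Proof.
split=> [mu|e u v nu nv mu]; first by rewrite mcoeff0 eqxx.
rewrite mcoeffD mcoeffZ; have [/nu //|] := boolP (u@_mu != 0).
by rewrite negbK => /eqP->; rewrite mulr0 add0r; apply: nv.
Qed.

Lemma normalX i mu : reduced i mu -> normal i 'X_[mu].
Proof. by move=> rmu nu; rewrite mcoeffX; case: (mu =P nu) => [<-|]; rewrite ?eqxx. Qed.

Lemma normal0_all p : normal 0 p.
Proof. by move=> mu _; apply/reducedP. Qed.

Lemma dhomog_monomial mu m : mdeg mu = m -> ('X_[mu] : R) \is m.-homog.
Proof. by move=> H; rewrite dhomogX; apply/eqP. Qed.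

Lemma variable_homog v : ('X_v : R) \is 1.-homog.
Proof. by apply: dhomog_monomial; rewrite mdeg1. Qed.

Lemma mcoeff_pihomog m (p : R) mu :
  (pihomog mdeg m p)@_mu = if mdeg mu == m then p@_mu else 0.
Proof.
rewrite pihomogE raddf_sum /= big_mkcond /=.
have [mus|mus] := boolP (mu \in msupp p); last first.
  rewrite (memN_msupp_eq0 mus) if_same big_seq big1 // => nu nus.
  case: ifP => // _; rewrite mcoeffZ mcoeffX; case: eqP => [E|]; rewrite ?mulr0 //.
  by rewrite -E nus in mus.
rewrite (bigD1_seq mu) ?msupp_uniq //= mcoeffZ mcoeffX eqxx mulr1 big1 ?addr0 //.
move=> nu /negbTE nmu; case: ifP => // _.
by rewrite mcoeffZ mcoeffX nmu mulr0.
Qed.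

Lemma normal_pihomog i m p : normal i p -> normal i (pihomog mdeg m p).
Proof.
by move=> np mu; rewrite mcoeff_pihomog; case: (mdeg mu =P m) => _; [apply: np | rewrite eqxx].
Qed.

Lemma subspace_mpoly (P : R -> Prop) (p : R) : subspace P ->
  (forall mu, p@_mu != 0 -> P 'X_[mu]) -> P p.
Proof.
move=> sP PX; rewrite (mpolyE p) big_seq; apply: subspace_sum => // mu.
by rewrite mcoeff_msupp => /PX; apply: subspaceZ.
Qed.

Lemma normalM_monomial i (mu : 'X_{1..c.+2}) p :
  (forall j : 'I_c, (j < i)%N -> mu (fibre_var j) = 0%N) ->
  normal i p -> normal i ('X_[mu] * p).
Proof.
move=> mu0 np; apply: (subspace_mpoly (P := fun p => normal i ('X_[mu] * p))).
  split; first by rewrite mulr0; case: (normal_subspace i).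
  move=> e u v nu nv; rewrite mulrDr -scalerAr.
  by case: (normal_subspace i) => _; apply.
move=> nu /np /reducedP nu_red; rewrite -mpolyXD; apply: normalX; apply/reducedP.
by move=> j ji; rewrite mnmDE mu0 // add0n; apply: nu_red.
Qed.

Definition reduces i f p := exists b, normal i b /\ equation_ideal (n := c.+1) (truncate i f) (p - b).

Lemma reduces_subspace i f : subspace (reduces i f).
Proof.
split.
  exists 0; split; first by case: (normal_subspace i).
  by rewrite subr0; apply: equation_ideal0.
move=> e u v [b [nb Ib]] [b' [nb' Ib']]; exists (e *: b + b'); split.
  by case: (normal_subspace i) => _; apply.
rewrite opprD addrACA -scalerBr.
by case: (equation_ideal_subspace (n := c.+1) (truncate i f)) => _; apply.
Qed.

Definition other_var i (v : 'I_c.+2) := forall j : 'I_c, (j < i)%N -> fibre_var j != v.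

Lemma reduces_mulX i f v p : other_var i v -> reduces i f p -> reduces i f ('X_v * p).
Proof.
move=> ov [b [nb Ib]]; exists ('X_v * b); split.
  by apply: normalM_monomial => // j ji; rewrite mnm1E eq_sym (negbTE (ov j ji)).
by rewrite -mulrBr; apply: equation_idealM.
Qed.

Lemma reduces_homog i f m p : (forall j, f j \is (d j).-homog) ->
  p \is m.-homog -> reduces i f p ->
  exists b, [/\ normal i b, b \is m.-homog
     & equation_ideal (n := c.+1) (truncate i f) (p - b)].
Proof.
move=> hf hp [b [nb Ib]]; exists (pihomog mdeg m b); split.
- exact: normal_pihomog.
- exact: pihomogP.
rewrite -{1}(pihomog_dE hp) -linearB /=.
apply: (@equation_ideal_pihomog _ _ _ _ d) => // j.
by rewrite /truncate; case: ifP => // _; apply: dhomog0.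
Qed.

Definition degree_bound := (\sum_j d j)%N.

Lemma mdeg_fibre_var (mu : 'X_{1..c.+2}) :
  mdeg mu = (mu ord0 + (mu (lift ord0 ord0) + \sum_j mu (fibre_var j)))%N.
Proof. by rewrite mdegE big_ord_recl big_ord_recl. Qed.

Lemma reduced_other_var i mu : reduced i mu -> (degree_bound < mdeg mu)%N ->
  exists2 v, other_var i v & mu v != 0%N.
Proof.
move=> /reducedP rmu lt; apply: contrapT => nv.
suff : (mdeg mu <= degree_bound)%N by rewrite leqNgt lt.
have mu0 v : other_var i v -> mu v = 0%N.
  by move=> ov; apply/eqP; apply: contrapT => /negP muv; apply: nv; exists v.
rewrite mdeg_fibre_var (mu0 ord0) ?(mu0 (lift ord0 ord0)) // !add0n.
apply: leq_sum => j _; case: (ltnP j i) => ji; first by apply: ltnW; apply: rmu.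
rewrite mu0 // => j' j'i; apply/negP => /eqP /lift_inj /lift_inj E.
by rewrite E ltnNge ji in j'i.
Qed.

(* Reduction in low degrees propagates to all degrees: a reduced monomial of large degree
   is divisible by a variable which stays free. *)
Lemma reduces_all i f : (forall j, f j \is (d j).-homog) ->
  (forall m, (m <= degree_bound.+1)%N -> forall p, p \is m.-homog -> reduces i f p) ->
  forall p, reduces i f p.
Proof.
move=> hf low p; apply: subspace_mpoly; first exact: reduces_subspace.
move=> mu _; have [m] : exists m, mdeg mu = m by exists (mdeg mu).
elim: m mu => [|m IHm] mu Hmu.
  by apply: (low 0%N) => //; apply: dhomog_monomial.
case: (leqP m degree_bound) => lem.
  by apply: (low m.+1) => //; apply: dhomog_monomial.
have divX v (nu : 'X_{1..c.+2}) : nu v != 0%N -> 'X_[nu] = 'X_v * 'X_[nu - U_(v)] :> R.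
  by move=> nuv; rewrite -mpolyXD addmC submK // lep1mP.
have degX v (nu : 'X_{1..c.+2}) e : mdeg nu = e.+1 -> nu v != 0%N -> mdeg (nu - U_(v))%MM = e.
  move=> Hnu nuv; apply/eqP; rewrite -eqSS -Hnu -[in X in _ == X](submK (m := U_(v)) (m' := nu)).
    by rewrite mdegD mdeg1 addn1.
  by rewrite lep1mP.
have free v (nu : 'X_{1..c.+2}) : mdeg nu = m.+1 -> other_var i v -> nu v != 0%N ->
    reduces i f 'X_[nu].
  move=> Hnu ov nuv; rewrite (divX v) //; apply: reduces_mulX => //.
  by apply: IHm; apply: degX.
have [v muv] : exists v, mu v != 0%N.
  apply: contrapT => /forallNP mu0; move: Hmu; rewrite mdegE big1 // => v _.
  by apply/eqP; apply/negPn/negP; apply: mu0.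
have [ov|nov] := pselect (other_var i v); first exact: free ov muv.
rewrite (divX v) //.
(* Here x_v is one of the bounded variables. The cofactor is put in normal form first; its monomials
   have degree above [degree_bound], hence contain a free variable w, and x_v times such a monomial
   is covered by [free w]. *)
have [b [nb hb Ib]] : exists b, [/\ normal i b, b \is m.-homog
     & equation_ideal (n := c.+1) (truncate i f) ('X_[mu - U_(v)] - b)].
  apply: reduces_homog => //; first by apply: dhomog_monomial; apply: degX.
  by apply: IHm; apply: degX.
have [b' [nb' Ib']] : reduces i f ('X_v * b).
  apply: (subspace_mpoly (P := fun p => reduces i f ('X_v * p))).
    split; first by rewrite mulr0; case: (reduces_subspace i f).
    move=> e u w ru rw; rewrite mulrDr -scalerAr.
    by case: (reduces_subspace i f) => _; apply.
  move=> nu nub; have rnu := nb _ nub.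
  have Hnu : mdeg nu = m by apply: (dhomog_mf hb); rewrite mcoeff_msupp.
  have [|w ow nuw] := reduced_other_var rnu; first by rewrite Hnu.
  rewrite -mpolyXD; apply: (free w) => //; first by rewrite mdegD mdeg1 Hnu.
  by rewrite mnmDE addn_eq0 negb_and nuw orbT.
exists b'; split=> //; apply: equation_ideal_congr Ib'.
by rewrite -mulrBr; apply: equation_idealM.
Qed.

End NormalForms.

(** * Uniqueness of normal forms *)

Section Uniqueness.

Variables (k : fieldType) (c : nat) (d : 'I_c -> nat).
Local Notation R := {mpoly k[c.+2]}.
Local Notation fibre_var := (@fibre_var c).

Definition normal_monomial (i m : nat) : finType :=
  {mu : 'X_{1..c.+2 < m.+1} | (mdeg mu == m) && reduced d i mu}.

Definition monomial_of i m (t : normal_monomial i m) : 'X_{1..c.+2} := bmnm (val t).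

Lemma monomial_of_mdeg i m (t : normal_monomial i m) : mdeg (monomial_of t) = m.
Proof. by case/andP: (valP t) => /eqP. Qed.

Lemma monomial_of_reduced i m (t : normal_monomial i m) : reduced d i (monomial_of t).
Proof. by case/andP: (valP t). Qed.

Lemma monomial_of_inj i m : injective (@monomial_of i m).
Proof. by move=> t t' /val_inj /val_inj. Qed.

Lemma monomial_of_exists i m mu : mdeg mu = m -> reduced d i mu ->
  exists t : normal_monomial i m, monomial_of t = mu.
Proof.
move=> Hm rmu; have lt : (mdeg mu < m.+1)%N by rewrite Hm.
have Pmu : (mdeg (BMultinom lt) == m) && reduced d i (BMultinom lt) by rewrite /= Hm eqxx.
by exists (@exist _ (fun mu : 'X_{1..c.+2 < m.+1} => (mdeg mu == m) && reduced d i mu) _ Pmu).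
Qed.

Lemma homog_msize m (p : R) : p \is m.-homog -> (msize p <= m.+1)%N.
Proof.
move=> hp; rewrite msizeE; apply/bigmax_leqP_seq => mu mus _.
by rewrite (dhomog_mf hp mus).
Qed.

Lemma normal_homog_sum i m (p : R) : normal d i p -> p \is m.-homog ->
  p = \sum_(t : normal_monomial i m) p@_(monomial_of t) *: 'X_[monomial_of t].
Proof.
move=> np hp; rewrite {1}(mpolywE (homog_msize hp)).
rewrite (bigID (fun mu : 'X_{1..c.+2 < m.+1} => (mdeg mu == m) && reduced d i mu)) /=.
rewrite [X in _ + X]big1 ?addr0; last first.
  move=> mu H; have [->|pmu] := eqVneq p@_mu 0; first by rewrite scale0r.
  move: H; rewrite (np _ pmu) andbT (dhomog_mf hp) ?eqxx //.
  by rewrite mcoeff_msupp.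
by rewrite -(big_sub (fun mu : 'X_{1..c.+2 < m.+1} => (mdeg mu == m) && reduced d i mu) (fun mu => p@_mu *: 'X_[mu])).
Qed.

Definition normal_unique i (f : 'I_c -> R) :=
  forall b, normal d i b -> equation_ideal (n := c.+1) (truncate i f) b -> b = 0.

Lemma normal_unique0 f : normal_unique 0 f.
Proof. by move=> b _ [a ->]; rewrite big1 // => j _; rewrite /truncate ltn0 mulr0. Qed.

Lemma truncate_homog i f : (forall j, f j \is (d j).-homog) ->
  forall j, (truncate i f j : R) \is (d j).-homog.
Proof. by move=> hf j; rewrite /truncate; case: ifP => _ //; apply: dhomog0. Qed.

Lemma truncateS (i : 'I_c) (f : 'I_c -> R) p : equation_ideal (n := c.+1) (truncate i.+1 f) p <->
  exists a, equation_ideal (n := c.+1) (truncate i f) (p - a * f i).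
Proof.
split=> [[a ->]|[a [b pE]]].
  exists (a i), a; rewrite (bigD1 i) //= /truncate ltnSn addrAC subrr add0r.
  rewrite [RHS](bigD1 i) //= ltnn mulr0 add0r; apply: eq_bigr => j ji.
  by rewrite ltnS leq_eqVlt (inj_eq val_inj) (negbTE ji).
exists (fun j => if j == i then a else b j).
rewrite -[LHS](subrK (a * f i)) pE (bigD1 i) //= [RHS](bigD1 i) //= eqxx.
rewrite /truncate ltnn ltnSn mulr0 add0r addrC; congr (_ + _).
apply: eq_bigr => j ji; rewrite (negbTE ji).
by rewrite ltnS [in RHS]leq_eqVlt (inj_eq val_inj) (negbTE ji).
Qed.

Lemma normal_unique_homog i f : (forall j, f j \is (d j).-homog) ->
  (forall m b, normal d i b -> b \is m.-homog ->
     equation_ideal (n := c.+1) (truncate i f) b -> b = 0) -> normal_unique i f.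
Proof.
move=> hf H b nb Ib; rewrite (pihomog_partitionE (mf := mdeg) (leqnn (msize b))).
rewrite big1 // => m _; apply: (H m).
- exact: normal_pihomog.
- exact: pihomogP.
- exact: (@equation_ideal_pihomog k c.+1 c _ d (truncate_homog i hf)).
Qed.

(* The elements [x^mu] with mu_i < d_i and [x^(mu - d_i e_i) f_i] span R_m modulo
   (f_0, ..., f_(i-1)), and they are as many as the monomials x^mu, which form a basis;
   so they are independent. *)
Lemma normal_uniqueS (i : 'I_c) f : (forall j, f j \is (d j).-homog) ->
  (forall p, reduces d i f p) -> normal_unique i f ->
  (forall p, reduces d i.+1 f p) -> normal_unique i.+1 f.
Proof.
move=> hf red_i uniq_i red_Si; apply: normal_unique_homog => // m p np hp.
pose Z := equation_ideal (n := c.+1) (truncate i f).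
have sZ : subspace Z := equation_ideal_subspace _.
pose T := normal_monomial i m.
pose b (t : T) : R := 'X_[monomial_of t].
pose F (t : T) : R := if (monomial_of t (fibre_var i) < d i)%N then 'X_[monomial_of t]
  else 'X_[monomial_of t - U_(fibre_var i) *+ d i] * f i.
have ib : independent Z b.
  move=> x Zx t; have /eqP : \sum_t x t *: b t = 0.
    apply: uniq_i => //; apply: (subspace_lincomb (normal_subspace k d i)) => t'.
    by apply: normalX; apply: monomial_of_reduced.
  move/eqP/(congr1 (mcoeff (monomial_of t))); rewrite mcoeff0 raddf_sum /= (bigD1 t) //=.
  rewrite mcoeffZ mcoeffX eqxx mulr1 big1 ?addr0 // => t' tt'.
  by rewrite mcoeffZ mcoeffX (inj_eq (@monomial_of_inj _ _)) (negbTE tt') mulr0.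
have FE b1 a1 : normal d i.+1 b1 -> b1 \is m.-homog -> normal d i a1 ->
    ((d i <= m)%N -> a1 \is (m - d i).-homog) -> ((m < d i)%N -> a1 = 0) ->
    exists2 x : T -> k, b1 + a1 * f i = \sum_t x t *: F t &
    forall t, (monomial_of t (fibre_var i) < d i)%N -> x t = b1@_(monomial_of t).
  move=> nb1 hb1 na1 ha1 a10.
  pose x (t : T) := if (monomial_of t (fibre_var i) < d i)%N then b1@_(monomial_of t)
    else a1@_(monomial_of t - U_(fibre_var i) *+ d i).
  exists x; last by move=> t; rewrite /x => ->.
  rewrite (bigID (fun t : T => (monomial_of t (fibre_var i) < d i)%N)) /=; congr (_ + _).
    have nb1i : normal d i b1.
      move=> mu /nb1 /reducedP H; apply/reducedP => j ji; apply: H; exact: ltnW.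
    rewrite {1}(normal_homog_sum nb1i hb1).
    rewrite (bigID (fun t : T => (monomial_of t (fibre_var i) < d i)%N)) /=.
    rewrite [X in _ + X]big1 ?addr0; last first.
      move=> t Ht; have [->|/nb1 /reducedP/(_ i (ltnSn i)) H] := eqVneq b1@_(monomial_of t) 0.
        by rewrite scale0r.
      by rewrite H in Ht.
    by apply: eq_bigr => t Ht; rewrite /x /F Ht.
  have shift (t : T) : ~~ (monomial_of t (fibre_var i) < d i)%N ->
      (U_(fibre_var i) *+ d i <= monomial_of t)%MM.
    rewrite -leqNgt => H; apply/mnm_lepP => v; rewrite mulmnE mnm1E.
    by case: eqP => [<-|]; rewrite ?mul1n.
  case: (leqP (d i) m) => dim; last first.
    rewrite a10 // mul0r big1 // => t /[dup] /shift /mnm_lepP H /negbTE H'.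
    by rewrite /x H' a10 // mcoeff0 scale0r.
  have {1}-> := normal_homog_sum na1 (ha1 dim).
  have up (s : normal_monomial i (m - d i)) : exists t : T,
      monomial_of t = (monomial_of s + U_(fibre_var i) *+ d i)%MM.
    apply: monomial_of_exists.
      by rewrite mdegD monomial_of_mdeg mdegMn mdeg1 mul1n subnK.
    apply/reducedP => j ji; rewrite mnmDE mulmnE mnm1E.
    rewrite (_ : (fibre_var i == fibre_var j) = false).
      by rewrite mul0n addn0; move/reducedP: (monomial_of_reduced s); apply.
    by rewrite !(inj_eq lift_inj); apply: gtn_eqF.
  have [u uE] := choice up.
  have down (t : T) : exists s : option (normal_monomial i (m - d i)),
      ~~ (monomial_of t (fibre_var i) < d i)%N ->
      exists2 s', s = Some s' & u s' = t.
    case: ltnP => Ht; first by exists None.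
    have [||s sE] := @monomial_of_exists i (m - d i) (monomial_of t - U_(fibre_var i) *+ d i)%MM.
    - apply/eqP; rewrite -(eqn_add2r (d i)) subnK // -[X in (_ + X)%N == _](_ : mdeg (U_(fibre_var i) *+ d i)%MM = _).
        by rewrite -mdegD submK ?shift -?leqNgt // monomial_of_mdeg.
      by rewrite mdegMn mdeg1 mul1n.
    - apply/reducedP => j ji; rewrite mnmBE; apply: leq_ltn_trans (leq_subr _ _) _.
      by move/reducedP: (monomial_of_reduced t); apply.
    exists (Some s) => _; exists s => //; apply: monomial_of_inj.
    by rewrite uE sE submK // shift // -leqNgt.
  have [dn dnE] := choice down.
  rewrite mulr_suml (reindex_omap u dn) /=; last first.
    by move=> t /dnE[s -> /= ->].
  apply: eq_big => [s|s _].
    have Hu : ~~ (monomial_of (u s) (fibre_var i) < d i)%N.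
      by rewrite uE mnmDE mulmnE mnm1E eqxx mul1n -leqNgt leq_addl.
    have [s' E us'] := dnE _ Hu; rewrite Hu E /=; apply/esym/eqP; congr Some.
    apply: monomial_of_inj; apply: (@addIm _ (U_(fibre_var i) *+ d i)%MM).
    by rewrite -!uE us'.
  have Hu : (monomial_of (u s) (fibre_var i) < d i)%N = false.
    by rewrite uE mnmDE mulmnE mnm1E eqxx mul1n ltnNge leq_addl.
  by rewrite /x /F Hu uE addmK -scalerAl.
have decomp q : equation_ideal (n := c.+1) (truncate i.+1 f) q -> q \is m.-homog ->
    exists a1, [/\ normal d i a1, ((d i <= m)%N -> a1 \is (m - d i).-homog),
      ((m < d i)%N -> a1 = 0) & Z (q - a1 * f i)].
  move=> /truncateS[a Za] hq.
  pose a' := if (d i <= m)%N then pihomog mdeg (m - d i) a else 0.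
  have Za' : Z (q - a' * f i).
    have := @equation_ideal_pihomog k c.+1 c _ d (truncate_homog i hf) m _ Za.
    rewrite linearB /= (pihomog_dE hq) (pihomog_mul _ _ (hf i)) /a'.
    by case: ifP => //; rewrite mul0r.
  have [a1 [na1 Ia1]] := red_i a'.
  exists (if (d i <= m)%N then pihomog mdeg (m - d i) a1 else 0); split.
  - by case: ifP => _; [apply: normal_pihomog | case: (normal_subspace k d i)].
  - by move=> ->; apply: pihomogP.
  - by move=> H; rewrite leqNgt H.
  have I1 : Z (a' - (if (d i <= m)%N then pihomog mdeg (m - d i) a1 else 0)).
    rewrite {1}/a'; case: leqP => H; last by rewrite subrr; apply: equation_ideal0.
    have := @equation_ideal_pihomog k c.+1 c _ d (truncate_homog i hf) (m - d i) _ Ia1.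
    have ha' : a' \is (m - d i).-homog by rewrite /a' H; apply: pihomogP.
    by rewrite linearB /= (pihomog_dE ha') {1}/a' H.
  apply: equation_ideal_congr Za' _; rewrite -mulrBl mulrC.
  exact: equation_idealM.
have bF t : spanned Z F (b t).
  have hb : b t \is m.-homog by apply: dhomog_monomial; apply: monomial_of_mdeg.
  have [b1 [nb1 hb1 Ib1]] := reduces_homog hf hb (red_Si (b t)).
  have [|a1 [na1 ha1 a10 Za1]] := decomp _ Ib1; first by rewrite rpredB.
  have [x xE _] := FE _ _ nb1 hb1 na1 ha1 a10.
  by exists x; rewrite -xE opprD addrA.
have iF := independent_of_card sZ ib bF (erefl _).
move=> Ip; have [a1 [na1 ha1 a10 Za1]] := decomp _ Ip hp.
(* The element p - a1 f_i lies in Z and is a combination of the independent family [F], so all its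
   coefficients vanish. Those at the monomials bounded in x_(i+2) are the coefficients of p. *)
have nN : normal d i (- a1) by apply: (subspaceN (normal_subspace k d i)).
have [x xE xp] : exists2 x : T -> k, p + (- a1) * f i = \sum_t x t *: F t &
    forall t, (monomial_of t (fibre_var i) < d i)%N -> x t = p@_(monomial_of t).
  apply: FE => //; first by move=> /ha1; rewrite rpredN.
  by move=> /a10->; rewrite oppr0.
have x0 : forall t, x t = 0 by apply: iF; rewrite -xE mulNr.
have npi : normal d i p.
  by move=> mu /np /reducedP H; apply/reducedP => j ji; apply: H; apply: ltnW.
rewrite (normal_homog_sum npi hp) big1 // => t _.
have [->|pt] := eqVneq p@_(monomial_of t) 0; first by rewrite scale0r.
rewrite -xp ?x0 ?scale0r //.
by have /reducedP/(_ i (ltnSn i)) := np _ pt.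
Qed.

End Uniqueness.

(** * Open conditions on the equations *)

Section Openness.

Variables (k : fieldType) (n c : nat) (d : c.-tuple nat).
Local Notation R := {mpoly k[n.+1]}.
Local Notation system := ('I_c -> R).

Definition regular_function (F : system -> k) :=
  exists Phi : {mpoly k[#|coef_index n d|]},
    forall f, hypersurfaces d f -> F f = Phi.@[coefs f].

Lemma regular_cst a : regular_function (fun=> a).
Proof. by exists a%:MP => f _; rewrite mevalC. Qed.

Lemma regular_mul F G : regular_function F -> regular_function G ->
  regular_function (fun f => F f * G f).
Proof. by move=> [p Hp] [q Hq]; exists (p * q) => f hf; rewrite mevalM Hp ?Hq. Qed.

Lemma regular_sum (T : Type) (s : seq T) (F : T -> system -> k) :
  (forall t, regular_function (F t)) -> regular_function (fun f => \sum_(t <- s) F t f).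
Proof.
move=> rF; elim: s => [|t s [p Hp]].
  by exists 0 => f _; rewrite meval0 big_nil.
by have [q Hq] := rF t; exists (q + p) => f hf; rewrite big_cons mevalD Hp ?Hq.
Qed.

Lemma regular_prod (T : Type) (s : seq T) (F : T -> system -> k) :
  (forall t, regular_function (F t)) -> regular_function (fun f => \prod_(t <- s) F t f).
Proof.
move=> rF; elim: s => [|t s [p Hp]].
  by exists 1 => f _; rewrite meval1 big_nil.
by have [q Hq] := rF t; exists (q * p) => f hf; rewrite big_cons mevalM Hp ?Hq.
Qed.

Lemma regular_coef j mu : regular_function (fun f => (f j)@_mu).
Proof.
case: (ltnP (mdeg mu) (tnth d j).+1) => lt; last first.
  exists 0 => f hf; rewrite meval0; apply: (dhomog_nemf_coeff (hf j)).
  by apply/eqP => E; have := lt; rewrite -E ltnn.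
pose t : coef_index n d := Tagged (fun j => 'X_{1..n.+1 < (tnth d j).+1}) (BMultinom lt).
exists 'X_(enum_rank t) => f hf.
by rewrite mevalXU /coefs enum_rankK.
Qed.

Lemma regular_det r (F : 'I_r -> 'I_r -> system -> k) :
  (forall i j, regular_function (F i j)) ->
  regular_function (fun f => \det (\matrix_(i, j) F i j f)).
Proof.
move=> rF; apply: regular_sum => s; apply: regular_mul; first exact: regular_cst.
have [p Hp] : regular_function (fun f => \prod_i F i (s i) f).
  exact: regular_prod.
by exists p => f hf; rewrite -Hp //; apply: eq_bigr => i _; rewrite mxE.
Qed.

Variable f0 : system.

(** A principal open neighbourhood of [f0]. Only finitely many conditions can be intersected, so
    every statement about all degrees has to be reduced to a bounded range of degrees. *)
Definition near (P : system -> Prop) :=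
  exists Phi : {mpoly k[#|coef_index n d|]}, Phi.@[coefs f0] != 0 /\
    forall f, hypersurfaces d f -> Phi.@[coefs f] != 0 -> P f.

Lemma near_impl (P Q : system -> Prop) :
  (forall f, hypersurfaces d f -> P f -> Q f) -> near P -> near Q.
Proof. by move=> PQ [p [p0 Hp]]; exists p; split=> // f hf pf; apply/PQ/Hp. Qed.

Lemma near_true (P : system -> Prop) : (forall f, hypersurfaces d f -> P f) -> near P.
Proof. by move=> HP; exists 1; rewrite meval1 oner_eq0; split=> // f hf _; apply: HP. Qed.

Lemma near_and (P Q : system -> Prop) : near P -> near Q -> near (fun f => P f /\ Q f).
Proof.
move=> [p [p0 Hp]] [q [q0 Hq]]; exists (p * q); rewrite mevalM mulf_neq0 //.
split=> // f hf; rewrite mevalM mulf_eq0 negb_or => /andP[pf qf].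
by split; [apply: Hp | apply: Hq].
Qed.

Lemma near_forall_lt (P : nat -> system -> Prop) m :
  (forall i, near (P i)) -> near (fun f => forall i, (i < m)%N -> P i f).
Proof.
move=> HP; elim: m => [|m IHm]; first exact: near_true.
apply: near_impl (near_and IHm (HP m)) => f _ [Hlt Hm] i.
by rewrite ltnS leq_eqVlt => /orP[/eqP->|/Hlt].
Qed.

Hypothesis f0_hyp : hypersurfaces d f0.

(** Independence is detected by a nonzero maximal minor of the matrix of coefficients, and this
    minor is a polynomial in the coefficients of the equations. *)
Lemma near_independent (T Pos : finType) (b : system -> T -> Pos -> R) :
  (forall t pos mu, regular_function (fun f => (b f t pos)@_mu)) ->
  (forall x : T -> k, (forall pos, \sum_t x t *: b f0 t pos = 0) -> forall t, x t = 0) ->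
  near (fun f => forall x : T -> k,
    (forall pos, \sum_t x t *: b f t pos = 0) -> forall t, x t = 0).
Proof.
move=> rb ib.
(* [B] bounds the degrees that occur at [f0]. At another system more coefficients may occur, but a
   nonzero minor formed from some of them already gives independence. *)
pose B := (\max_(tp : T * Pos) msize (b f0 tp.1 tp.2))%N.
pose Kt : finType := (Pos * 'X_{1..n.+1 < B})%type.
pose A f := \matrix_(i < #|Kt|, j < #|T|)
  (b f (enum_val j) (enum_val i).1)@_(enum_val i).2.
have full : row_full (A f0).
  rewrite /row_full -mxrank_tr; apply/inj_row_free => v vA.
  have v0 : forall t, v 0 (enum_rank t) = 0.
    apply: ib => pos; apply/mpolyP => mu; rewrite mcoeff0 raddf_sum /=.
    case: (ltnP (mdeg mu) B) => lt.
      have := congr1 (fun M : 'rV_(_) => M 0 (enum_rank ((pos, BMultinom lt) : Kt))) vA.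
      rewrite !mxE => H; rewrite -[RHS]H [RHS](reindex (@enum_rank T)) /=; last first.
        by apply: onW_bij; apply: enum_rank_bij.
      by apply: eq_bigr => t _; rewrite mcoeffZ !mxE !enum_rankK.
    rewrite big1 // => t _; rewrite mcoeffZ memN_msupp_eq0 ?mulr0 //.
    apply: msize_mdeg_ge; apply: leq_trans lt.
    exact: (leq_bigmax (F := fun tp : T * Pos => msize (b f0 tp.1 tp.2)) (t, pos)).
  by apply/rowP => j; rewrite mxE -(v0 (enum_val j)) enum_valK.
pose g := fullrankfun full.
have [p Hp] : regular_function (fun f => \det (rowsub g (A f))).
  have [p Hp] := regular_det (F := fun i j f =>
    (b f (enum_val j) (enum_val (g i)).1)@_(enum_val (g i)).2) (fun i j => rb _ _ _).
  exists p => f hf; rewrite -Hp //; congr (\det _).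
  by apply/matrixP => i j; rewrite !mxE.
exists p; split.
  by rewrite -Hp // -unitfE -[_ \is a _]/(_ \in unitmx) fullrowsub_unit.
move=> f hf; rewrite -Hp // => det0 x xb t.
pose u : 'cV[k]_#|T| := \col_j x (enum_val j).
have Au : rowsub g (A f) *m u = 0.
  apply/colP => i; rewrite !mxE.
  have := congr1 (mcoeff (enum_val (g i)).2) (xb (enum_val (g i)).1).
  rewrite mcoeff0 raddf_sum /= => H; rewrite -[RHS]H.
  rewrite (reindex (@enum_rank T)) /=; last first.
    by apply: onW_bij; apply: enum_rank_bij.
  by apply: eq_bigr => s _; rewrite mcoeffZ !mxE !enum_rankK mulrC.
have U : rowsub g (A f) \in unitmx by rewrite unitmxE unitfE.
have := congr1 (fun M : 'cV_(_) => M (enum_rank t) 0) (mulKmx U u).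
by rewrite Au mulmx0 !mxE enum_rankK.
Qed.

End Openness.

(** * Normal forms for general equations *)

Section GenericNormalForms.

Variables (k : fieldType) (c : nat) (d : c.-tuple nat).
Local Notation R := {mpoly k[c.+2]}.
Local Notation system := ('I_c -> R).
Local Notation fibre_var := (@fibre_var c).
Local Notation deg := (tnth d).
Local Notation base_degree mu := (mu ord0 + mu (lift ord0 ord0))%N.

Lemma mcoeff_monomialM nu (p : R) mu :
  ('X_[nu] * p)@_mu = if (nu <= mu)%MM then p@_(mu - nu) else 0.
Proof.
case: ifP => [le|nle]; first by rewrite -{1}(submK le) addmC mulrC mcoeffMX.
apply: memN_msupp_eq0; rewrite mulrC (perm_mem (msuppMX _ _)).
apply/mapP => -[mu' _ E]; move/negP: nle; apply.
by rewrite E lem_addr.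
Qed.

Definition violation i (mu : 'X_{1..c.+2}) :=
  [pick j : 'I_c | (j < i)%N && (deg j <= mu (fibre_var j))%N].

(** One form of degree |mu| for each monomial mu: the monomial itself if it is reduced, otherwise a
    multiple of an equation f_j, with mu as the product of its cofactor and x_(j+2)^(d_j). *)
Definition reducer i (f : system) (mu : 'X_{1..c.+2}) : R :=
  if violation i mu is Some j then 'X_[mu - U_(fibre_var j) *+ deg j] * f j else 'X_[mu].

Variant violation_spec i (mu : 'X_{1..c.+2}) : option 'I_c -> Prop :=
| Violation (j : 'I_c) of (j < i)%N & (U_(fibre_var j) *+ deg j <= mu)%MM & ~~ reduced deg i mu :
    violation_spec i mu (Some j)
| NoViolation of reduced deg i mu : violation_spec i mu None.

Lemma violationP i mu : violation_spec i mu (violation i mu).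
Proof.
rewrite /violation; case: pickP => [j /andP[ji dj]|nv]; constructor => //.
- apply/mnm_lepP => v; rewrite mulmnE mnm1E.
  by case: eqP => [<-|]; rewrite ?mul1n.
- by apply/negP => /reducedP/(_ j ji); rewrite ltnNge dj.
by apply/reducedP => j ji; have := nv j; rewrite ji /= ltnNge => ->.
Qed.

Lemma reducer_homog i f mu : hypersurfaces d f -> reducer i f mu \is (mdeg mu).-homog.
Proof.
move=> hf; rewrite /reducer; case: violationP => [j ji le _|_]; last exact: dhomog_monomial.
rewrite -{2}(submK le) mdegD; apply: dhomogM; first exact: dhomog_monomial.
by rewrite mdegMn mdeg1 mul1n; apply: hf.
Qed.

(** There are as many reducers of degree m as monomials, so that independence makes them a basis of
    R_m ([reducer_span]). Unlike the existence of normal forms, this is visibly an open condition.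
    The position [unit] fits the format of [near_independent]. *)
Definition reducer_basis i m (f : system) := forall x : normal_monomial deg 0 m -> k,
  (forall pos : unit, \sum_t x t *: reducer i f (monomial_of t) = 0) -> forall t, x t = 0.

Lemma reducer_span i m f p : reducer_basis i m f -> hypersurfaces d f -> p \is m.-homog ->
  exists x : normal_monomial deg 0 m -> k, p = \sum_t x t *: reducer i f (monomial_of t).
Proof.
move=> ib hf hp.
pose Z (v : R) := v = 0.
have sZ : subspace Z by split=> // e u v -> ->; rewrite scaler0 addr0.
have span q : q \is m.-homog ->
    spanned Z (fun t : normal_monomial deg 0 m => 'X_[monomial_of t]) q.
  move=> hq; exists (fun t => q@_(monomial_of t)).
  by rewrite -(normal_homog_sum (@normal0_all k c deg q) hq) /Z subrr.
have [x /eqP] : spanned Z (fun t : normal_monomial deg 0 m => reducer i f (monomial_of t)) p.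
  apply: (spanned_of_card (b' := fun t : normal_monomial deg 0 m => 'X_[monomial_of t])) => //.
  - by move=> x Zx; apply: ib => _; apply: Zx.
  - move=> t; apply: span.
    by rewrite -[m in m.-homog](monomial_of_mdeg t); apply: reducer_homog.
  - exact: span.
by rewrite subr_eq0 => /eqP; exists x.
Qed.

Lemma reducer_reduces i f mu : reduces deg i f (reducer i f mu).
Proof.
rewrite /reducer; case: violationP => [j ji _ _|rmu]; last first.
  exists 'X_[mu]; split; first exact: normalX.
  by rewrite subrr; apply: equation_ideal0.
exists 0; split; first by case: (normal_subspace k deg i).
rewrite subr0; apply: equation_idealM.
have -> : f j = truncate i f j by rewrite /truncate ji.
exact: equation_ideal_gen.
Qed.

Lemma reducer_basis_reduces i m f p : reducer_basis i m f -> hypersurfaces d f ->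
  p \is m.-homog -> reduces deg i f p.
Proof.
move=> ib hf hp; have [x ->] := reducer_span ib hf hp.
apply: subspace_lincomb; first exact: reduces_subspace.
by move=> t; apply: reducer_reduces.
Qed.

Variable f0 : system.
Hypothesis f0_hyp : hypersurfaces d f0.
Hypothesis f0_lead : forall j, (f0 j)@_(U_(fibre_var j) *+ deg j) = 1.
Hypothesis f0_tail : forall j mu, (f0 j)@_mu != 0 -> mu != (U_(fibre_var j) *+ deg j)%MM ->
  (0 < base_degree mu)%N.

Lemma f0_reducer_basis i m : reducer_basis i m f0.
Proof.
move=> x xb.
pose Z (v : R) := v = 0.
have sZ : subspace Z by split=> // e u v -> ->; rewrite scaler0 addr0.
pose T := normal_monomial deg 0 m.
suff : independent Z (fun t : T => reducer i f0 (monomial_of t)).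
  by apply; apply: (xb tt).
apply: (independent_of_card (b := fun t : T => 'X_[monomial_of t])) => //.
  move=> y /(congr1 (@mcoeff _ _ _)) Zy t; have := Zy (monomial_of t).
  rewrite mcoeff0 raddf_sum /= (bigD1 t) //= mcoeffZ mcoeffX eqxx mulr1 big1 ?addr0 //.
  by move=> t' tt'; rewrite mcoeffZ mcoeffX (inj_eq (@monomial_of_inj _ _ _ _)) (negbTE tt') mulr0.
have sS := spanned_subspace (fun t : T => reducer i f0 (monomial_of t)) sZ.
(* Induction on m minus the degree in x_0, x_1. Subtracting the reducer of mu replaces the monomial
   by others that have larger degree in x_0, x_1, because all terms of [f0 j] except the leading one
   involve x_0 or x_1. *)
suff H : forall w (mu : 'X_{1..c.+2}), mdeg mu = m -> (m - base_degree mu < w)%N ->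
    spanned Z (fun t : T => reducer i f0 (monomial_of t)) 'X_[mu].
  move=> t; apply: (H m.+1); first exact: monomial_of_mdeg.
  by rewrite ltnS leq_subr.
elim=> [//|w IHw] mu Hmu; rewrite ltnS => lew.
have [t tE] : exists t : T, monomial_of t = mu.
  by apply: monomial_of_exists => //; apply/reducedP.
have St : spanned Z (fun t : T => reducer i f0 (monomial_of t)) (reducer i f0 mu).
  by rewrite -tE; apply: (spanned_mem (fun t : T => reducer i f0 (monomial_of t)) t sZ).
move: St; rewrite {2}/reducer; case: violationP => [j ji le _|//] St.
suff : spanned Z (fun t : T => reducer i f0 (monomial_of t))
    ('X_[mu] - 'X_[mu - U_(fibre_var j) *+ deg j] * f0 j).
  by move=> Sd; have := subspaceD sS Sd St; rewrite subrK.
rewrite -{1}(submK le) mpolyXD -mulrBr.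
apply: (subspace_mpoly (P := fun q => spanned _ _ ('X_[mu - U_(fibre_var j) *+ deg j] * q))).
  split; first by rewrite mulr0; case: sS.
  by move=> e u v Su Sv; rewrite mulrDr -scalerAr; case: sS => _; apply.
move=> nu; rewrite mcoeffB mcoeffX; case: ((U_(fibre_var j) *+ deg j)%MM =P nu) => [<-|ne].
  by rewrite f0_lead subrr eqxx.
rewrite sub0r oppr_eq0 => cnu; rewrite -mpolyXD.
have base : (0 < base_degree nu)%N by apply: (f0_tail cnu); apply/eqP => E; apply: ne.
have dnu : mdeg nu = deg j by apply: (dhomog_mf (f0_hyp j)); rewrite mcoeff_msupp.
have Hle := mnm_lepP le.
apply: IHw.
  by rewrite mdegD dnu -Hmu -[in RHS](submK le) mdegD mdegMn mdeg1 mul1n.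
apply: leq_trans lew; rewrite !mnmDE !mnmBE !mulmnE !mnm1E /= !mul0n !subn0.
have : (base_degree mu + base_degree nu <= m)%N.
  rewrite -Hmu -[X in (_ <= mdeg X)%N](submK le) mdegD mdegMn mdeg1 mul1n -dnu.
  rewrite [mdeg nu]mdeg_fibre_var [mdeg (_ - _)]mdeg_fibre_var.
  rewrite !mnmBE !mulmnE !mnm1E /= !mul0n !subn0; lia.
lia.
Qed.

Lemma near_reducer_basis i m : near d f0 (reducer_basis i m).
Proof.
apply: near_independent => //; last first.
  by move=> x xb; apply: (@f0_reducer_basis i m x) => pos; apply: xb pos.
move=> t [] mu; rewrite /reducer; case: violationP => [j _ _ _|_]; last exact: regular_cst.
have [p Hp] := regular_coef k d j (mu - (monomial_of t - U_(fibre_var j) *+ deg j))%MM.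
case: (boolP (monomial_of t - U_(fibre_var j) *+ deg j <= mu)%MM) => le.
  by exists p => f hf; rewrite mcoeff_monomialM le; apply: Hp.
by exists 0 => f hf; rewrite mcoeff_monomialM (negbTE le) meval0.
Qed.

Definition has_normal_basis (f : system) :=
  (forall p, reduces deg c f p) /\ normal_unique deg c f.

(** The degrees up to [degree_bound] + 1 are finitely many open conditions. [reduces_all] passes
    from them to existence of normal forms in all degrees, and [normal_uniqueS] deduces uniqueness
    from existence by counting. *)
Lemma near_has_normal_basis : near d f0 has_normal_basis.
Proof.
apply: (near_impl (P := fun f => forall i, (i < c.+1)%N ->
  forall m, (m < (degree_bound deg).+2)%N -> reducer_basis i m f)); last first.
  by apply: near_forall_lt => i; apply: near_forall_lt => m; apply: near_reducer_basis.
move=> f hf Hb.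
have red i : (i <= c)%N -> forall p, reduces deg i f p.
  move=> ic; apply: reduces_all => // m lem p hp.
  by apply: reducer_basis_reduces hp => //; apply: Hb.
split; first exact: red.
suff H : forall i, (i <= c)%N -> normal_unique deg i f by apply: H.
elim=> [|i IHi] ic; first exact: normal_unique0.
apply: (normal_uniqueS (i := Ordinal ic)) => //=.
- by apply: red; apply: ltnW.
- by apply: IHi; apply: ltnW.
- exact: red.
Qed.

End GenericNormalForms.

(** * Regular elements and independence modulo x_0 *)

Section Regularity.

Variables (k : fieldType) (c : nat) (d : c.-tuple nat).
Local Notation R := {mpoly k[c.+2]}.
Local Notation fibre_var := (@fibre_var c).
Local Notation deg := (tnth d).
Local Notation x0 := ('X_ord0 : R).
Local Notation x1 := ('X_(lift ord0 ord0) : R).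

Definition base_poly (g : R) := forall mu, g@_mu != 0 -> forall j, mu (fibre_var j) = 0%N.

Lemma base_poly_subspace : subspace base_poly.
Proof.
split=> [mu|e u v bu bv mu]; first by rewrite mcoeff0 eqxx.
rewrite mcoeffD mcoeffZ; have [/bu //|] := boolP (u@_mu != 0).
by rewrite negbK => /eqP->; rewrite mulr0 add0r; apply: bv.
Qed.

Lemma base_polyX (mu : 'X_{1..c.+2}) : (forall j, mu (fibre_var j) = 0%N) -> base_poly 'X_[mu].
Proof. by move=> H nu; rewrite mcoeffX; case: (mu =P nu) => [<-|]; rewrite ?eqxx. Qed.

Lemma base_poly_x0 : base_poly x0.
Proof. by apply: base_polyX => j; rewrite mnm1E. Qed.

Lemma base_poly_x1 : base_poly x1.
Proof. by apply: base_polyX => j; rewrite mnm1E. Qed.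

Lemma base_polyM g g' : base_poly g -> base_poly g' -> base_poly (g * g').
Proof.
move=> bg bg'; apply: (subspace_mpoly (P := fun g => base_poly (g * g'))).
  split; first by rewrite mul0r; case: base_poly_subspace.
  by move=> e u v bu bv; rewrite mulrDl -scalerAl; case: base_poly_subspace => _; apply.
move=> mu /bg mu0; apply: (subspace_mpoly (P := fun g' => base_poly (_ * g'))).
  split; first by rewrite mulr0; case: base_poly_subspace.
  by move=> e u v bu bv; rewrite mulrDr -scalerAr; case: base_poly_subspace => _; apply.
move=> nu /bg' nu0; rewrite -mpolyXD; apply: base_polyX => j.
by rewrite mnmDE mu0 nu0.
Qed.

Lemma normalM_base i g p : base_poly g -> normal deg i p -> normal deg i (g * p).
Proof.
move=> bg np; apply: (subspace_mpoly (P := fun g => normal deg i (g * p))).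
  split; first by rewrite mul0r; case: (normal_subspace k deg i).
  by move=> e u v bu bv; rewrite mulrDl -scalerAl; case: (normal_subspace k deg i) => _; apply.
by move=> mu /bg mu0; apply: normalM_monomial.
Qed.

(** Reduction modulo x_0, realized inside R; [kill_x0 g != 0] expresses that x_0 does not divide
    g. *)
Definition kill_x0 : R -> R :=
  comp_mpoly [tuple (if i == ord0 then 0 else 'X_i) | i < c.+2].

Lemma kill_x0X mu : kill_x0 'X_[mu] = if mu ord0 == 0%N then 'X_[mu] else 0.
Proof.
rewrite /kill_x0 comp_mpolyX; case: eqP => [mu0|/eqP mu0]; last first.
  by rewrite (bigD1 ord0) //= tnth_mktuple eqxx expr0n (negbTE mu0) mul0r.
rewrite [RHS]mpolyXE_id; apply: eq_bigr => i _; rewrite tnth_mktuple.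
by case: eqP => // ->; rewrite mu0 !expr0.
Qed.

Lemma kill_x0_spec p : exists q, p - kill_x0 p = x0 * q.
Proof.
apply: (subspace_mpoly (P := fun p => exists q, p - kill_x0 p = x0 * q)).
  split; first by exists 0; rewrite /kill_x0 raddf0 subr0 mulr0.
  move=> e u v [q Hq] [q' Hq']; exists (e *: q + q').
  by rewrite /kill_x0 comp_mpolyD comp_mpolyZ opprD addrACA -scalerBr Hq Hq' mulrDr scalerAr.
move=> mu _; rewrite kill_x0X; case: eqP => [_|/eqP mu0].
  by exists 0; rewrite subrr mulr0.
by exists 'X_[mu - U_(ord0)]; rewrite subr0 -mpolyXD addmC submK // lep1mP.
Qed.

Lemma kill_x0_x0 p : kill_x0 (x0 * p) = 0.
Proof. by rewrite /kill_x0 rmorphM /= -/(kill_x0 _) kill_x0X mnm1E mul0r. Qed.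

Lemma kill_x0M p q : kill_x0 (p * q) = kill_x0 p * kill_x0 q.
Proof. by rewrite /kill_x0 rmorphM. Qed.

Lemma x0_prime g p q : kill_x0 g != 0 -> g * p = x0 * q -> exists r, p = x0 * r.
Proof.
move=> g0 /(congr1 kill_x0); rewrite kill_x0_x0 kill_x0M => /eqP.
rewrite mulf_eq0 (negbTE g0) => /eqP p0.
by have [r] := kill_x0_spec p; rewrite p0 subr0 => ->; exists r.
Qed.

Lemma truncate_all (f : 'I_c -> R) : truncate c f = f.
Proof. by apply: funext => j; rewrite /truncate ltn_ord. Qed.

Variable f : 'I_c -> R.
Hypothesis f_hyp : hypersurfaces d f.
Hypothesis f_basis : has_normal_basis d f.
Local Notation I := (equation_ideal (n := c.+1) f).

Lemma normal_form p : exists b, normal deg c b /\ I (p - b).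
Proof. by have [H _] := f_basis; have := H p; rewrite /reduces truncate_all. Qed.

Lemma normal_form_homog m p : p \is m.-homog ->
  exists b, [/\ normal deg c b, b \is m.-homog & I (p - b)].
Proof.
move=> hp; have [H _] := f_basis.
by have := reduces_homog f_hyp hp (H p); rewrite truncate_all.
Qed.

Lemma normal_ideal0 b : normal deg c b -> I b -> b = 0.
Proof. by have [_ H] := f_basis; move=> nb Ib; apply: H; rewrite ?truncate_all. Qed.

(** A normal form is constrained in the fibre variables only, so multiplication by an element of
    k[x_0, x_1] preserves normality; a normal form in the ideal is zero, and R is a domain. *)
Lemma base_poly_regular g p : base_poly g -> g != 0 -> I (g * p) -> I p.
Proof.
move=> bg g0 Igp; have [b [nb Ib]] := normal_form p.
suff b0 : b = 0 by move: Ib; rewrite b0 subr0.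
have /eqP : g * b = 0.
  apply: normal_ideal0; first exact: normalM_base.
  have -> : g * b = g * p - g * (p - b) by rewrite mulrBr opprB addrC subrK.
  by apply: equation_idealB => //; apply: equation_idealM.
by rewrite mulf_eq0 (negbTE g0) => /eqP.
Qed.

Lemma x0_neq0 : x0 != 0.
Proof. by apply/eqP => /(congr1 (mcoeff U_(ord0))) /eqP; rewrite mcoeffX eqxx mcoeff0 oner_eq0. Qed.

(* An element of k[x_0, x_1] prime to x_0 is regular modulo (I, x_0), and conversely. *)
Lemma base_poly_regular_x0 g p q : base_poly g -> kill_x0 g != 0 ->
  I (g * p - x0 * q) -> exists r, I (p - x0 * r).
Proof.
move=> bg g0 Igp; have [b [nb Ib]] := normal_form p; have [b' [nb' Ib']] := normal_form q.
have E : g * b = x0 * b'.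
  apply/eqP; rewrite -subr_eq0; apply/eqP; apply: normal_ideal0.
    by apply: (subspaceB (normal_subspace k deg c)); apply: normalM_base => //; apply: base_poly_x0.
  have -> : g * b - x0 * b' = (g * p - x0 * q) - (g * (p - b) - x0 * (q - b')).
    by rewrite !mulrBr; apply/eqP; rewrite -subr_eq0; apply/eqP; ring.
  by do 2![apply: equation_idealB => //]; apply: equation_idealM.
by have [r E'] := x0_prime g0 E; exists r; rewrite -E'.
Qed.

End Regularity.

(** * The coordinate ring as a free module over k[x_0, x_1] *)

Section FreeOverBase.

Variables (k : fieldType) (c : nat) (d : c.-tuple nat).
Local Notation R := {mpoly k[c.+2]}.
Local Notation N := c.+2.
Local Notation x0 := ('X_ord0 : R).
Local Notation x1 := ('X_(lift ord0 ord0) : R).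

Variable f : 'I_c -> R.
Hypothesis f_hyp : hypersurfaces d f.
Hypothesis f_basis : has_normal_basis d f.
Local Notation I := (equation_ideal (n := c.+1) f).

Section Matrices.

Variables p q : nat.
Local Notation V := (kmatrix k N p q).

Definition zero_mod (v : 'M[R]_(p, q)) := forall i j, I (v i j).
Definition homog_mx m (v : 'M[R]_(p, q)) := forall i j, v i j \is m.-homog.

Lemma zero_mod_subspace : subspace (zero_mod : V -> Prop).
Proof.
split=> [i j|e u v Zu Zv i j]; first by rewrite mxE; apply: equation_ideal0.
by rewrite mxE kmatrix_mxE; apply: equation_idealD => //; apply: equation_idealZ.
Qed.

Lemma zero_modD u v : zero_mod u -> zero_mod v -> zero_mod (u + v).
Proof. exact: (subspaceD zero_mod_subspace). Qed.

Lemma zero_modZ (g : R) v : zero_mod v -> zero_mod (g *: v).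
Proof. by move=> Zv i j; rewrite mxE; apply: equation_idealM. Qed.

Lemma zero_mod_regular g v : base_poly g -> g != 0 -> zero_mod (g *: v) -> zero_mod v.
Proof.
by move=> bg g0 Zv i j; apply: (base_poly_regular f_basis bg g0); have := Zv i j; rewrite mxE.
Qed.

Lemma zero_mod_regular_x0 g u v : base_poly g -> kill_x0 g != 0 ->
  zero_mod (g *: u - x0 *: v) -> exists w, zero_mod (u - x0 *: w).
Proof.
move=> bg g0 Z.
have H ij : exists r, I (u ij.1 ij.2 - x0 * r).
  apply: (base_poly_regular_x0 f_basis bg g0 (q := v ij.1 ij.2)).
  by have := Z ij.1 ij.2; rewrite !mxE.
have [r Hr] := choice H; exists (\matrix_(i, j) r (i, j)) => i j.
by rewrite !mxE; apply: (Hr (i, j)).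
Qed.

Definition multiple_x0 (v : 'M[R]_(p, q)) := exists w, zero_mod (v - x0 *: w).

Lemma multiple_x0_subspace : subspace (multiple_x0 : V -> Prop).
Proof.
split.
  by exists 0 => i j; rewrite !mxE mulr0 subr0; apply: equation_ideal0.
move=> e u v [w Zw] [w' Zw']; exists (e%:MP *: w + w').
have -> : e *: u + v - x0 *: (e%:MP *: w + w') =
    e%:MP *: (u - x0 *: w) + (v - x0 *: w') :> 'M_(p, q).
  by apply/matrixP => i j; rewrite !mxE; ring.
by apply: zero_modD => //; apply: zero_modZ.
Qed.

Lemma zero_mod_multiple v : zero_mod v -> multiple_x0 v.
Proof. by move=> Zv; exists 0; rewrite scaler0 subr0. Qed.

Lemma multiple_x0_homog m v : homog_mx m.+1 v -> multiple_x0 v ->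
  exists2 w, homog_mx m w & zero_mod (v - x0 *: w).
Proof.
move=> hv [w Zw]; exists (map_mx (pihomog mdeg m) w).
  by move=> i j; rewrite mxE; apply: pihomogP.
move=> i j; rewrite !mxE.
have := equation_ideal_pihomog f_hyp m.+1 (Zw i j).
rewrite !mxE linearB /= (pihomog_dE (hv i j)) mulrC.
have hx : x0 \is 1.-homog by apply: variable_homog.
by rewrite (pihomog_mul _ _ hx) ltnS leq0n subSS subn0 mulrC.
Qed.

Lemma base_polyX_exp (g : R) i : base_poly g -> base_poly (g ^+ i).
Proof.
move=> bg; elim: i => [|i IHi].
  by rewrite expr0 -mpolyX0; apply: base_polyX => j; rewrite mnm0E.
by rewrite exprS; apply: base_polyM.
Qed.

Lemma kill_x0_x1_exp i : kill_x0 (x1 ^+ i) != 0.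
Proof.
rewrite /kill_x0 rmorphXn /= -/(kill_x0 _) kill_x0X mnm1E /= expf_neq0 //.
by apply/eqP => /(congr1 (mcoeff U_(lift ord0 ord0))) /eqP; rewrite mcoeffX eqxx mcoeff0 oner_eq0.
Qed.

(** Modulo x_0 only the term l = n survives, and x_1 is regular modulo (I, x_0); so W_n is a
    multiple of x_0, hence zero by hypothesis. The remaining sum is divisible by x_0, which is
    regular. *)
Lemma zero_mod_binary_form n (W : nat -> 'M[R]_(p, q)) :
  (forall l, multiple_x0 (W l) -> W l = 0) ->
  zero_mod (\sum_(l < n.+1) x0 ^+ (n - l) * x1 ^+ l *: W l) ->
  forall l, (l < n.+1)%N -> W l = 0.
Proof.
move=> HW; elim: n => [|n IHn].
  rewrite big_ord1 subnn !expr0 mulr1 scale1r => Z [|//] _.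
  by apply: HW; apply: zero_mod_multiple.
rewrite big_ord_recr /= subnn expr0 mul1r.
have -> : \sum_(l < n.+1) x0 ^+ (n.+1 - l) * x1 ^+ l *: W l =
    x0 *: \sum_(l < n.+1) x0 ^+ (n - l) * x1 ^+ l *: W l.
  rewrite scaler_sumr; apply: eq_bigr => l _.
  by rewrite scalerA mulrA -exprS -subSn // -ltnS.
move=> Z; have W0 : W n.+1 = 0.
  apply: HW; set S := \sum_(l < n.+1) _ in Z.
  apply: (@zero_mod_regular_x0 (x1 ^+ n.+1) _ (- S)).
  - by apply: base_polyX_exp; apply: base_poly_x1.
  - exact: kill_x0_x1_exp.
  - by rewrite scalerN opprK addrC.
move: Z; rewrite W0 scaler0 addr0 => /(zero_mod_regular (@base_poly_x0 k c) (@x0_neq0 k c)) /IHn H l.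
by rewrite ltnS leq_eqVlt => /orP[/eqP->|/H].
Qed.

(* A family independent modulo x_0 generates a free module over k[x_0, x_1]. *)
Lemma independent_translates (T : finType) (v : T -> 'M[R]_(p, q)) J n :
  independent (multiple_x0 : V -> Prop) v ->
  independent (zero_mod : V -> Prop)
    (fun tl : T * 'I_n.+1 => x0 ^+ (J + (n - tl.2)) * x1 ^+ tl.2 *: v tl.1).
Proof.
move=> iv x Zx.
pose W l : 'M[R]_(p, q) := \sum_t (x (t, inord l))%:MP *: v t.
have WE l : W l = \sum_t x (t, inord l) *: (v t : V) by [].
have {Zx} Zx : zero_mod (\sum_(l < n.+1) x0 ^+ (n - l) * x1 ^+ l *: W l).
  apply: (zero_mod_regular (g := x0 ^+ J)).
  - by apply: base_polyX_exp; apply: base_poly_x0.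
  - by rewrite expf_neq0 // x0_neq0.
  suff -> : x0 ^+ J *: (\sum_(l < n.+1) x0 ^+ (n - l) * x1 ^+ l *: W l : 'M[R]_(p, q)) =
    \sum_(tl : T * 'I_n.+1) x tl *: (x0 ^+ (J + (n - tl.2)) * x1 ^+ tl.2 *: v tl.1 : V) by [].
  apply: esym; rewrite (eq_bigr (fun tl => x (tl.1, tl.2) *:
    (x0 ^+ (J + (n - tl.2)) * x1 ^+ tl.2 *: v tl.1 : V))); last by case.
  rewrite -(pair_bigA _ (fun t l => x (t, l) *: (x0 ^+ (J + (n - l)) * x1 ^+ l *: v t : V))).
  rewrite exchange_big /= scaler_sumr; apply: eq_bigr => l _.
  rewrite scalerA scaler_sumr; apply: eq_bigr => t _.
  rewrite inord_val kmatrix_scaleE !scalerA; congr (_ *: _).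
  by rewrite exprD; ring.
move=> [t l]; have Wl : W l = 0.
  apply: zero_mod_binary_form (Zx) _ (ltn_ord l) => l'; rewrite {1}WE => /iv x0'.
  by rewrite /W big1 // => t' _; rewrite x0' mpolyC0 scale0r.
have : multiple_x0 (W l) by rewrite Wl; case: multiple_x0_subspace.
by rewrite WE => /iv/(_ t); rewrite inord_val.
Qed.

End Matrices.

End FreeOverBase.

(** * The bound for subsheaves of the kernel bundle *)

Section GradedDimension.

Variables (k : fieldType) (c : nat) (f : 'I_c -> {mpoly k[c.+2]}).
Local Notation R := {mpoly k[c.+2]}.

Local Notation zmod p q := (@zero_mod k c f p q : kmatrix k c.+2 p q -> Prop).

Lemma zero_sheafE p (v : 'rV[R]_p) : zero_sheaf (n := c.+1) f v <-> zero_mod f v.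
Proof. by split=> [H i j|H j]; [rewrite [i]ord1; apply: H | apply: H]. Qed.

Lemma graded_dimP p (A : set 'rV[R]_p) m D :
  graded_dim (n := c.+1) f A m D <->
  exists b : 'I_D -> kmatrix k c.+2 1 p, [/\ forall i, graded_part (n := c.+1) A m (b i),
    independent (zmod 1 p) b
  & forall v, graded_part (n := c.+1) A m v -> spanned (zmod 1 p) b v].
Proof.
have sZ := zero_mod_subspace f 1 p.
have comb (b : 'I_D -> kmatrix k c.+2 1 p) (x : 'I_D -> k) :
    \sum_i ((\row_j x j : 'rV[k]_D) 0 i)%:MP_[c.+2] *: (b i : 'rV_p) = \sum_i x i *: b i.
  by apply: eq_bigr => i _; rewrite mxE.
split=> [[b [Ab Hb]]|[b [Ab ib sb]]]; exists b; split=> //.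
- move=> x Zx i; have [y [_ uy]] := Hb _ (Ab i).
  pose x1 j : k := (j == i)%:R.
  have x1b : \sum_j x1 j *: (b j : kmatrix k c.+2 1 p) = b i.
    rewrite (bigD1 i) //= /x1 eqxx scale1r big1 ?addr0 // => j /negbTE->.
    by rewrite scale0r.
  (* Uniqueness is available for the representations of an element of the graded part. So a relation
     [x] is subtracted from the trivial representation of [b i], and the two representations of
     [b i] are compared. *)
  have E1 : y = \row_j x1 j.
    apply: uy; apply/zero_sheafE; rewrite comb x1b subrr.
    by case: sZ.
  have E2 : y = \row_j (x1 j - x j).
    apply: uy; apply/zero_sheafE; rewrite comb.
    rewrite (eq_bigr (fun j => x1 j *: (b j : kmatrix k c.+2 1 p) - x j *: (b j : kmatrix k c.+2 1 p))).
      by rewrite sumrB x1b opprB addrC subrK.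
    by move=> j _; rewrite scalerBl.
  move: E2; rewrite E1 => /rowP/(_ i); rewrite !mxE => /eqP.
  by rewrite -subr_eq0 opprB addrC subrK => /eqP.
- move=> v Av; have [y [/zero_sheafE Hy _]] := Hb v Av.
  by exists (fun i => y 0 i).
move=> v Av; have [x Hx] := sb v Av.
exists (\row_i x i); split; first by apply/zero_sheafE; rewrite comb.
move=> y /zero_sheafE Hy; apply/rowP => i; rewrite mxE; apply/eqP; rewrite -subr_eq0.
apply/eqP; apply: (ib (fun i => x i - y 0 i)).
have -> : \sum_i (x i - y 0 i) *: b i =
    ((v : kmatrix k c.+2 1 p) - \sum_i y 0 i *: b i) - ((v : kmatrix k c.+2 1 p) - \sum_i x i *: b i).
  have H (u1 u2 u3 : kmatrix k c.+2 1 p) : (u1 - u2) - (u1 - u3) = u3 - u2.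
    by rewrite opprB addrC addrA subrK.
  rewrite H -sumrB.
  by apply: eq_bigr => j _; rewrite scalerBl.
exact: (subspaceB sZ).
Qed.

End GradedDimension.

(** * Counting the sections of B (x) F *)

Section SubsheafBound.

Variables (k : fieldType) (c : nat) (d : c.-tuple nat).
Local Notation R := {mpoly k[c.+2]}.
Local Notation N := c.+2.
Local Notation x0 := ('X_ord0 : R).

Variable f : 'I_c -> R.
Hypothesis f_hyp : hypersurfaces d f.
Hypothesis f_basis : has_normal_basis d f.
Local Notation zmod p q := (@zero_mod k c f p q : kmatrix k c.+2 p q -> Prop).
Local Notation "u == v %[mod]" := (zero_mod f (u - v)) (at level 70, v at next level).

Variables (q : nat) (t : 'rV[R]_q) (h : R) (tau e a : nat).
Hypothesis t_homog : forall j, t 0 j \is tau.-homog.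
Hypothesis h_homog : h \is e.-homog.
Hypothesis h_base : base_poly h.
Hypothesis h_kill : kill_x0 h != 0.

Definition coordinates : 'cV[R]_N := \col_i 'X_i.

(* H^0 (M_C (m) (x) F), where F is the kernel of t : O^q -> O_(h = 0). *)
Definition test_section (v : 'M[R]_(q, N)) :=
  zero_mod f (v *m coordinates) /\ exists w, t *m v == h *: w %[mod].

Hypothesis no_test_section : forall v, homog_mx a v -> test_section v -> zero_mod f v.

Lemma h_neq0 : h != 0.
Proof. by apply: contra_neq h_kill => ->; rewrite /kill_x0 raddf0. Qed.

Lemma zero_modMl p1 p2 p3 (u : 'M[R]_(p1, p2)) (v : 'M[R]_(p2, p3)) :
  zero_mod f v -> zero_mod f (u *m v).
Proof.
move=> Zv i j; rewrite mxE; apply: equation_ideal_sum => l _.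
exact: equation_idealM.
Qed.

Lemma zero_modMr p1 p2 p3 (u : 'M[R]_(p1, p2)) (v : 'M[R]_(p2, p3)) :
  zero_mod f u -> zero_mod f (u *m v).
Proof.
move=> Zu i j; rewrite mxE; apply: equation_ideal_sum => l _; rewrite mulrC.
exact: equation_idealM.
Qed.

Lemma test_sectionZ g v : test_section v -> test_section (g *: v).
Proof.
move=> [Zv [w Zw]]; split; first by rewrite -scalemxAl; apply: zero_modZ.
exists (g *: w); rewrite -scalemxAr scalerA mulrC -scalerA -scalerBr.
exact: zero_modZ.
Qed.

Lemma test_section_congr u v : test_section u -> v == u %[mod] -> test_section v.
Proof.
move=> [Zu [w Zw]] Zvu; split.
  rewrite -(subrK u v) mulmxDl; apply: zero_modD => //.
  exact: zero_modMr.
exists w; rewrite -(subrK u v) mulmxDr -addrA; apply: zero_modD => //.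
exact: zero_modMl.
Qed.

(** As h is prime to x_0, the relation t (x_0 v) = h w forces w to be a multiple of x_0. So test
    sections may be divided by x_0, although sections of B may not. *)
Lemma test_section_x0 v : test_section (x0 *: v) -> test_section v.
Proof.
have b0 := @base_poly_x0 k c; have n0 := @x0_neq0 k c.
move=> [Zv [w Zw]]; split.
  by apply: (zero_mod_regular f_basis b0 n0); rewrite scalemxAl.
have [|w' Zw'] := @zero_mod_regular_x0 _ _ _ _ f_basis _ _ h w (t *m v) h_base h_kill.
  by have := zero_modZ (-1) Zw; rewrite scaleN1r opprB -scalemxAr.
exists w'; apply: (zero_mod_regular f_basis b0 n0).
rewrite scalerBr scalemxAr scalerA mulrC -scalerA.
have -> : t *m (x0 *: v) - h *: (x0 *: w') =
    (t *m (x0 *: v) - h *: w) + h *: (w - x0 *: w') by rewrite scalerBr addrA subrK.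
by apply: zero_modD => //; apply: zero_modZ.
Qed.

Lemma homog_mxZ p1 p2 (g : R) m n (v : 'M[R]_(p1, p2)) : g \is n.-homog -> homog_mx m v ->
  homog_mx (n + m) (g *: v).
Proof. by move=> hg hv i j; rewrite mxE; apply: dhomogM. Qed.

Lemma x0_exp_homog i : x0 ^+ i \is i.-homog.
Proof.
have h1 : x0 \is 1.-homog by apply: variable_homog.
by rewrite -[X in X.-homog]mul1n; apply: dhomogMn.
Qed.

Lemma x1_exp_homog i : ('X_(lift ord0 ord0) : R) ^+ i \is i.-homog.
Proof.
have h1 : ('X_(lift ord0 ord0) : R) \is 1.-homog by apply: variable_homog.
by rewrite -[X in X.-homog]mul1n; apply: dhomogMn.
Qed.

Lemma no_test_section_le m v : (m <= a)%N -> homog_mx m v -> test_section v -> zero_mod f v.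
Proof.
move=> ma hv tv; apply: (zero_mod_regular f_basis (g := x0 ^+ (a - m))).
- by apply: base_polyX_exp; apply: base_poly_x0.
- by rewrite expf_neq0 // x0_neq0.
apply: no_test_section; last exact: test_sectionZ.
by have := homog_mxZ (x0_exp_homog (a - m)) hv; rewrite subnK.
Qed.

Variable B : set 'rV[R]_N.
Hypothesis B_coherent : coherent_sheaf (n := c.+1) f B.
Hypothesis B_kernel : forall v, B v -> kernel_bundle (n := c.+1) f v.

Lemma sheaf_zero v : zero_mod f v -> B v.
Proof. by case: B_coherent => ZB _ _ Zv; apply: ZB => j; apply: Zv. Qed.

Lemma sheafZD (g : R) u v : B u -> B v -> B (g *: u + v).
Proof. by case: B_coherent => _ BD _; apply: BD. Qed.

Lemma sheafZ (g : R) u : B u -> B (g *: u).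
Proof.
move=> Bu; rewrite -[_ *: u]addr0; apply: sheafZD => //; apply: sheaf_zero => i j.
by rewrite mxE; apply: equation_ideal0.
Qed.

Lemma sheafD u v : B u -> B v -> B (u + v).
Proof. by move=> Bu Bv; rewrite -[u]scale1r; apply: sheafZD. Qed.

Lemma sheaf_congr u v : B u -> v == u %[mod] -> B v.
Proof. by move=> Bu Zvu; rewrite -(subrK u v); apply: sheafD => //; apply: sheaf_zero. Qed.

(** The sections of B (x) F. The quotient of [t *m v] by h has to lie in B again: the dimension
    count takes place inside B. *)
Definition sub_section (v : 'M[R]_(q, N)) :=
  (forall i, B (row i v)) /\ exists2 u, B u & t *m v == h *: u %[mod].

Lemma sub_section_test v : sub_section v -> test_section v.
Proof.
move=> [Bv [u _ Zu]]; split; last by exists u.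
move=> i j; have := B_kernel (Bv i); rewrite /kernel_bundle /evaluation mxE /=.
rewrite (eq_bigr (fun l => v i l * coordinates l j)) // => l _.
by rewrite !mxE.
Qed.

Lemma sub_section_congr u v : sub_section u -> v == u %[mod] -> sub_section v.
Proof.
move=> [Bu [w Bw Zw]] Zvu; split.
  move=> i; apply: sheaf_congr (Bu i) _ => i' j; rewrite !mxE.
  by have := Zvu i j; rewrite !mxE.
exists w => //; rewrite -(subrK u v) mulmxDr -addrA; apply: zero_modD => //.
exact: zero_modMl.
Qed.

Lemma sub_section_zero v : zero_mod f v -> sub_section v.
Proof.
move=> Zv; split=> [i|].
  by apply: sheaf_zero => i' j; rewrite mxE; apply: Zv.
exists 0; last by rewrite scaler0 subr0; apply: zero_modMl.
by apply: sheaf_zero; case: (zero_mod_subspace f 1 N).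
Qed.

Lemma sub_sectionD u v : sub_section u -> sub_section v -> sub_section (u + v).
Proof.
move=> [Bu [w Bw Zw]] [Bv [w' Bw' Zw']]; split.
  by move=> i; rewrite linearD; apply: sheafD (Bu i) (Bv i).
exists (w + w'); first exact: sheafD.
by rewrite mulmxDr scalerDr opprD addrACA; apply: zero_modD.
Qed.

Lemma sub_sectionZ g v : sub_section v -> sub_section (g *: v).
Proof.
move=> [Bv [w Bw Zw]]; split.
  by move=> i; rewrite linearZ; apply: sheafZ (Bv i).
exists (g *: w); first exact: sheafZ.
rewrite -scalemxAr scalerA mulrC -scalerA -scalerBr.
exact: zero_modZ.
Qed.

Variables (m0 beta : nat) (D : nat -> nat).
Hypothesis B_dim : forall m, (m0 <= m)%N ->
  graded_dim (n := c.+1) f B m (D m) /\ (D m = D m0 + beta * (m - m0))%N.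

Definition place (i : 'I_q) (u : 'rV[R]_N) : 'M[R]_(q, N) := delta_mx i 0 *m u.

Lemma row_place i i' u : row i (place i' u) = (i == i')%:R *: u.
Proof.
apply/rowP => j; rewrite !mxE big_ord1 !mxE eqxx andbT.
by case: eqP.
Qed.

Lemma mulmx_place i u : t *m place i u = t 0 i *: u.
Proof.
rewrite /place mulmxA; apply/rowP => j; rewrite !mxE big_ord1 !mxE (bigD1 i) //=.
rewrite !mxE !eqxx mulr1 big1 ?addr0 // => i' /negbTE ne.
by rewrite !mxE ne mulr0.
Qed.

Lemma matrix_place (v : 'M[R]_(q, N)) : v = \sum_i place i (row i v).
Proof.
apply/row_matrixP => i; rewrite linear_sum /= (bigD1 i) //= row_place eqxx scale1r.
by rewrite big1 ?addr0 // => i' ne; rewrite row_place eq_sym (negbTE ne) scale0r.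
Qed.

Lemma placeZ i (x : k) (u : kmatrix k N 1 N) :
  place i (x *: u) = x *: (place i u : kmatrix k N q N).
Proof. by rewrite /place -scalemxAr. Qed.

Lemma family_card_le m (T : finType) (v : T -> kmatrix k N q N) : (m0 <= m)%N ->
  (forall s, homog_mx m (v s)) -> (forall s i, B (row i (v s))) ->
  independent (zmod q N) v -> (#|T| <= q * D m)%N.
Proof.
move=> mm0 hv Bv iv; have [/graded_dimP[b [_ _ sb]] _] := B_dim mm0.
rewrite -[q in (q * _)%N]card_ord -[D m]card_ord -card_prod.
apply: (independent_card (b' := fun il : 'I_q * 'I_(D m) =>
  place il.1 (b il.2) : kmatrix k N q N)) (iv) _; first exact: zero_mod_subspace.
move=> s; have sp i : spanned (zmod 1 N) b (row i (v s)).
  by apply: sb; split; [apply: Bv | move=> j; rewrite mxE; apply: hv].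
have [x Hx] := choice sp; exists (fun il => x il.1 il.2).
rewrite -(pair_bigA _ (fun i l => x i l *: (place i (b l) : kmatrix k N q N))) /=.
rewrite {1}(matrix_place (v s)) -sumrB; apply: subspace_sum; first exact: zero_mod_subspace.
move=> i _; have -> : \sum_l x i l *: (place i (b l) : kmatrix k N q N) =
    place i (\sum_l x i l *: b l).
  rewrite /place mulmx_sumr; apply: eq_bigr => l _; exact: esym (placeZ _ _ _).
rewrite /place -mulmxBr; apply: zero_modMl; exact: Hx.
Qed.

(** A family independent modulo x_0 generates a free module over k[x_0, x_1], whose growth cannot
    exceed that of B^q; here beta is the leading coefficient of the Hilbert function of B. The
    factor x_0^J is there because B need not be saturated. *)
Lemma layer_card_le m J (T : finType) (v : T -> kmatrix k N q N) :
  (forall s, homog_mx m (v s)) -> (forall s, sub_section (x0 ^+ J *: (v s : 'M_(q, N)))) ->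
  independent (@multiple_x0 k c f q N : kmatrix k N q N -> Prop) v -> (#|T| <= q * beta)%N.
Proof.
move=> hv Ev iv; rewrite leqNgt; apply/negP => lt.
(* Large enough for (q beta + 1)(n + 1) to exceed q D(m0) + q beta (m + J + n), while m + J + n >=
   m0. *)
pose n := (q * D m0 + q * beta * (m + J) + m0)%N.
have mm0 : (m0 <= m + J + n)%N by rewrite /n; lia.
have := @family_card_le (m + J + n)%N [the finType of (T * 'I_n.+1)%type]
  (fun tl => x0 ^+ (J + (n - tl.2)) * 'X_(lift ord0 ord0) ^+ tl.2 *: (v tl.1 : 'M_(q, N))) mm0.
move=> H; have {}H : (#|T| * n.+1 <= q * D (m + J + n)%N)%N.
  rewrite -[n.+1 in X in (X <= _)%N]card_ord -card_prod; apply: H.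
  - move=> [s l] /=; have ln : (l <= n)%N by rewrite -ltnS.
    have -> : (m + J + n = (J + (n - l) + l) + m)%N by lia.
    apply: homog_mxZ => //; apply: dhomogM; first exact: x0_exp_homog.
    exact: x1_exp_homog.
  - move=> [s l] i /=; have [Bs _] := sub_sectionZ (x0 ^+ (n - l) * 'X_(lift ord0 ord0) ^+ l) (Ev s).
    by have := Bs i; rewrite scalerA [_ * x0 ^+ J]mulrC mulrA -exprD.
  - exact: (independent_translates f_basis (J := J) (n := n) iv).
move: H; have [_ ->] := B_dim mm0 => H.
have : ((q * beta).+1 * n.+1 <= q * D m0 + q * beta * (m + J + n))%N.
  apply: leq_trans (leq_mul lt (leqnn _)) _; apply: leq_trans H _.
  rewrite mulnDr leq_add2l mulnA leq_mul2l; apply/orP; right; lia.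
rewrite /n; nia.
Qed.

Lemma test_section_x0_exp J v : test_section (x0 ^+ J *: v) -> test_section v.
Proof.
elim: J v => [|J IHJ] v; first by rewrite expr0 scale1r.
by rewrite exprS -scalerA => /test_section_x0 /IHJ.
Qed.

(** Induction on the degree by means of x_0. In degree m + 1 at most q beta sections are independent
    modulo x_0; the combinations that are multiples of x_0 are divided by it, which raises J by one.
    Up to degree [a] there are no sections, since division by powers of x_0 leaves test sections. *)
Lemma sub_section_card_le m J (T : finType) (v : T -> kmatrix k N q N) :
  (forall s, homog_mx m (v s)) -> (forall s, sub_section (x0 ^+ J *: (v s : 'M_(q, N)))) ->
  independent (zmod q N) v -> (#|T| <= q * beta * (m - a))%N.
Proof.
elim: m J T v => [|m IHm] J T v hv Ev iv.
all: have tv s : test_section (v s) by apply: (@test_section_x0_exp J); apply: sub_section_test.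
  by rewrite (independent_zero _ iv) // => s; apply: no_test_section_le (hv s) (tv s).
case: (leqP m.+1 a) => ma.
  by rewrite (independent_zero _ iv) // => s; apply: no_test_section_le (hv s) (tv s).
pose U (u : kmatrix k N q N) := homog_mx m.+1 u /\ sub_section (x0 ^+ J *: (u : 'M_(q, N))).
have sM := multiple_x0_subspace f q N.
have bU : bounded_dim (@multiple_x0 k c f q N : kmatrix k N q N -> Prop) U (q * beta).
  move=> S u Uu iu; by apply: (@layer_card_le m.+1 J S u) iu => s; case: (Uu s).
have [n [w [nle Uw _ sw]]] := spanning_family sM bU.
have sv s : spanned (@multiple_x0 k c f q N : kmatrix k N q N -> Prop) w (v s).
  by apply: sw; split.
have [X [iX MX]] := kernel_family sM iv sv.
have hX i : homog_mx m.+1 (\sum_s X i s *: v s : kmatrix k N q N).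
  move=> i' j'; rewrite summxE; apply: rpred_sum => s _; rewrite kmatrix_mxE.
  by apply: dhomogZ; apply: hv.
have H i : exists u : 'M[R]_(q, N), homog_mx m u /\
    (\sum_s X i s *: v s : kmatrix k N q N) == x0 *: u %[mod].
  by have [u hu Zu] := multiple_x0_homog f_hyp (hX i) (MX i); exists u.
have [u Hu] := choice H.
have Eu i : sub_section (x0 ^+ J.+1 *: u i).
  have [_ Zu] := Hu i.
  apply: (@sub_section_congr (x0 ^+ J *: (\sum_s X i s *: v s : kmatrix k N q N))).
    apply: (big_ind (fun u : kmatrix k N q N => sub_section (x0 ^+ J *: (u : 'M_(q, N))))).
    - by apply: sub_section_zero; apply: zero_modZ; case: (zero_mod_subspace f q N).
    - by move=> u1 u2 E1 E2; rewrite scalerDr; apply: sub_sectionD.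
    - move=> s _; rewrite kmatrix_scaleE scalerA mulrC -scalerA.
      exact: sub_sectionZ (Ev s).
  rewrite exprSr -scalerA -scalerBr; apply: zero_modZ.
  by rewrite -opprB -scaleN1r; apply: zero_modZ.
have le := IHm _ _ (u : _ -> kmatrix k N q N) (fun i => proj1 (Hu i)) Eu.
have {le} : (#|'I_(#|T| - #|'I_n|)| <= q * beta * (m - a))%N.
  apply: le => y Zy; apply: (iX y).
  have -> : \sum_i y i *: (\sum_s X i s *: v s : kmatrix k N q N) =
      (\sum_i y i *: ((\sum_s X i s *: v s : kmatrix k N q N) - (x0 *: u i : 'M_(q, N))) : kmatrix k N q N)
      + (x0 *: (\sum_i y i *: (u i : kmatrix k N q N) : 'M_(q, N)) : 'M_(q, N)).
    rewrite scaler_sumr -big_split; apply: eq_bigr => i _ /=.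
    rewrite !kmatrix_scaleE scalerBr [x0 *: (_ *: _)]scalerA mulrC -scalerA subrK.
    by [].
  apply: zero_modD; last exact: zero_modZ.
  apply: subspace_lincomb; first exact: zero_mod_subspace.
  by move=> i; case: (Hu i).
rewrite !card_ord subSn // mulnS => le.
by rewrite -leq_subLR; apply: leq_trans le; apply: leq_sub2l.
Qed.

(** Sections of B (x) F are the kernel of t from B_m^q to B_(m + tau) / h B_(m + tau - e), and
    multiplication by h is injective; so the target has dimension at most D(m + tau) - D(m + tau -
    e) = beta e. *)
Lemma sub_section_family m : (m0 <= m)%N -> (e <= m)%N -> (m0 <= m + tau - e)%N ->
  exists (T : finType) (v : T -> kmatrix k N q N),
  [/\ (q * D m - beta * e <= #|T|)%N, independent (zmod q N) v,
      forall s, homog_mx m (v s) & forall s, sub_section (v s)].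
Proof.
move=> mm0 em em0.
have [/graded_dimP[b [Bb ib _]] _] := B_dim mm0.
have [/graded_dimP[b' [Bb' ib' _]] DE'] := B_dim em0.
have em0' : (m0 <= m + tau)%N by apply: leq_trans em0 (leq_subr _ _).
have [/graded_dimP[b'' [_ _ sb'']] DE''] := B_dim em0'.
have sZ := zero_mod_subspace f 1 N.
pose Y (u : kmatrix k N 1 N) := exists2 u', B u' & u == h *: u' %[mod].
have sY : subspace Y.
  split; first by exists 0; [apply: sheaf_zero; case: sZ | rewrite scaler0 subr0; case: sZ].
  move=> x u v [u' Bu Zu] [v' Bv Zv]; exists (x%:MP *: u' + v'); first exact: sheafZD.
  have -> : x *: u + v - h *: (x%:MP *: u' + v') =
     x%:MP *: (u - h *: u') + (v - h *: v') :> 'M_(1, N).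
    by apply/matrixP => i j; rewrite !mxE; ring.
  by apply: zero_modD => //; apply: zero_modZ.
have ZY u : zero_mod f u -> Y u.
  by move=> Zu; exists 0; [apply: sheaf_zero; case: sZ | rewrite scaler0 subr0].
pose U : kmatrix k N 1 N -> Prop := graded_part (n := c.+1) B (m + tau).
have bU : bounded_dim Y U (#|'I_(D (m + tau)%N)| - #|'I_(D (m + tau - e)%N)|).
  apply: (bounded_dim_quotient (Z := zmod 1 N) (b := b'')
    (b' := fun i => (h *: (b' i : 'M_(1, N)) : kmatrix k N 1 N))) => //.
  - move=> i; have [Bi hi] := Bb' i; split; first exact: sheafZ.
    move=> j; rewrite mxE -(@subnKC e (m + tau)); first by apply: dhomogM.
    exact: leq_trans em (leq_addr _ _).
  - move=> i; have [Bi _] := Bb' i; exists (b' i) => //.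
    by rewrite subrr; case: sZ.
  - move=> x Zx; apply: (ib' x); apply: (zero_mod_regular f_basis h_base h_neq0).
    rewrite scaler_sumr.
    suff -> : \sum_i h *: (x i *: b' i : 'M_(1, N)) =
      \sum_i x i *: (h *: (b' i : 'M_(1, N)) : kmatrix k N 1 N) by [].
    apply: eq_bigr => i _; rewrite !kmatrix_scaleE !scalerA mulrC //.
have [n [w [nle _ _ sw]]] := spanning_family sY bU.
pose b1 (il : 'I_q * 'I_(D m)) : kmatrix k N q N := place il.1 (b il.2).
pose w1 (il : 'I_q * 'I_(D m)) : kmatrix k N 1 N := t 0 il.1 *: (b il.2 : 'M_(1, N)).
have ib1 : independent (zmod q N) b1.
  move=> x Zx [i l]; apply: (ib (fun l => x (i, l))) => i' j.
  have := Zx i j; rewrite [i']ord1.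
  suff -> : (\sum_il x il *: b1 il) i j = (\sum_l x (i, l) *: b l) 0 j by [].
  rewrite (eq_bigr (fun il => x (il.1, il.2) *: (place il.1 (b il.2) : kmatrix k N q N))); last by case.
  rewrite -(pair_bigA _ (fun i l => x (i, l) *: (place i (b l) : kmatrix k N q N))) /=.
  rewrite !summxE (bigD1 i) //= [X in _ + X]big1 ?addr0.
    rewrite summxE; apply: eq_bigr => l' _; rewrite !kmatrix_mxE; congr (_ *: _).
    by have := congr1 (fun M : 'rV_(_) => M 0 j) (row_place i i (b l')); rewrite eqxx scale1r mxE.
  move=> i2 ne; rewrite summxE big1 // => l' _; rewrite kmatrix_mxE.
  have := congr1 (fun M : 'rV_(_) => M 0 j) (row_place i i2 (b l')).
  by rewrite eq_sym (negbTE ne) scale0r !mxE => ->; rewrite scaler0.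
have sw1 il : spanned Y w (w1 il).
  apply: sw; have [Bi hi] := Bb il.2; split; first exact: sheafZ.
  by move=> j; rewrite mxE addnC; apply: dhomogM.
have [X [iX YX]] := kernel_family sY ib1 sw1.
exists [the finType of 'I_(#|{: 'I_q * 'I_(D m)}| - #|'I_n|)], (fun i => \sum_il X i il *: b1 il).
split=> //.
- rewrite card_ord card_prod !card_ord; apply: leq_sub2l; apply: leq_trans nle _.
  rewrite !card_ord DE' DE''; nia.
- move=> i; apply: (big_ind (fun u : kmatrix k N q N => homog_mx m u)).
  + by move=> i' j; rewrite mxE; apply: dhomog0.
  + by move=> u v hu hv i' j; rewrite mxE; apply: dhomogD.
  move=> il _ i' j; rewrite kmatrix_mxE; apply: dhomogZ.
  have := congr1 (fun M : 'rV_(_) => M 0 j) (row_place i' il.1 (b il.2)).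
  rewrite mxE => ->; have [_ hi] := Bb il.2; rewrite mxE.
  by case: eqP => _; rewrite ?mul1r ?mul0r //; apply: dhomog0.
move=> i; split.
  move=> i'; apply: (big_ind (fun u : kmatrix k N q N => B (row i' u))).
  - by apply: sheaf_zero => i2 j; rewrite !mxE; apply: equation_ideal0.
  - by move=> u v Bu Bv; rewrite linearD; apply: sheafD.
  move=> il _; rewrite kmatrix_scaleE linearZ /= row_place; apply: sheafZ; apply: sheafZ.
  by case: (Bb il.2).
have [u Bu Zu] := YX i; exists u => //.
suff -> : t *m (\sum_il X i il *: b1 il : kmatrix k N q N) = \sum_il X i il *: w1 il by [].
rewrite mulmx_sumr; apply: eq_bigr => il _.
by rewrite !kmatrix_scaleE -scalemxAr mulmx_place.
Qed.

(** With D(m) = chi(B) + beta m for large m, the inequality says q (chi(B) + beta a) <= beta e, that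
    is, chi(B(a) (x) F) <= 0. *)
Theorem subsheaf_bound : exists m1, forall m, (m1 <= m)%N ->
  (q * D m <= q * beta * (m - a) + beta * e)%N.
Proof.
exists (m0 + e)%N => m mm; have [||| T [v [leT iv hv Ev]]] := @sub_section_family m; try lia.
rewrite addnC -leq_subLR; apply: leq_trans leT _.
by apply: (@sub_section_card_le m 0 T v hv) iv => s; rewrite expr0 scale1r.
Qed.

End SubsheafBound.

(** * A degenerate complete intersection of lines *)

(** A sum of two distinct powers of 2 is a binary expansion and determines its two exponents. This
    keeps the nodes of a line apart. *)
Lemma sidon_pow2 a b a' b' : a <> b -> a' <> b' ->
  (2 ^ a + 2 ^ b = 2 ^ a' + 2 ^ b')%N -> (a = a' /\ b = b') \/ (a = b' /\ b = a').
Proof.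
wlog ab : a b / (a < b)%N => [H ne ne' E|].
  case: (ltngtP a b) => [ab|ba|//]; first exact: H.
  by case: (H b a ba (fun E' => ne (esym E')) ne' (etrans (addnC _ _) E)) => -[-> ->]; [right | left].
wlog ab' : a' b' / (a' < b')%N => [H ne ne' E|].
  case: (ltngtP a' b') => [ab'|ba'|//]; first exact: H.
  by case: (H b' a' ba' ne (fun E' => ne' (esym E')) (etrans E (addnC _ _))); [right | left].
move=> _ _ E; left.
have pos n : (0 < 2 ^ n)%N by rewrite expn_gt0.
have dbl n m : (n < m)%N -> (2 * 2 ^ n <= 2 ^ m)%N by move=> nm; rewrite -expnS leq_exp2l.
have bb' : b = b'.
  case: (ltngtP b b') => // lt.
    by have := dbl _ _ lt; have := dbl _ _ ab; have := pos a'; lia.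
  by have := dbl _ _ lt; have := dbl _ _ ab'; have := pos a; lia.
split=> //; move: E; rewrite bb' => /addIn /eqP; rewrite eqn_exp2l // => /eqP //.
Qed.

Lemma mpoly_morphism_ext (k : fieldType) n (S : comNzRingType)
    (phi psi : {rmorphism {mpoly k[n]} -> S}) :
  (forall e, phi e%:MP = psi e%:MP) -> (forall i, phi 'X_i = psi 'X_i) -> phi =1 psi.
Proof.
move=> HC HX p; rewrite (mpolyE p) !rmorph_sum; apply: eq_bigr => mu _.
rewrite -mul_mpolyC !rmorphM HC mpolyXE_id !rmorph_prod; congr (_ * _).
by apply: eq_bigr => i _; rewrite !rmorphXn /= HX.
Qed.

Section Lines.

Variables (k : fieldType) (char0 : [pchar k] =i pred0).
Variables (c : nat) (d : c.-tuple nat).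
Local Notation R := {mpoly k[c.+2]}.
Local Notation N := c.+2.
Local Notation x0 := ('X_ord0 : R).
Local Notation x1 := ('X_(lift ord0 ord0) : R).
Local Notation fibre_var := (@fibre_var c).
Local Notation deg := (tnth d).

Lemma natr_inj (m n : nat) : m%:R = n%:R :> k -> m = n.
Proof.
wlog mn : m n / (m <= n)%N => [H E|E].
  by case: (leqP m n) => [|/ltnW] le; [|symmetry]; apply: H.
have /eqP : (n - m)%:R = 0 :> k by rewrite natrB // E subrr.
by move/pcharf0P: char0 => ->; rewrite subn_eq0 => nm; apply/eqP; rewrite eqn_leq mn.
Qed.

Definition point_of (S : Type) (A B : S) (F : 'I_c -> S) (v : 'I_c.+2) : S :=
  if unlift ord0 v is Some v1 then if unlift ord0 v1 is Some j then F j else B else A.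

Lemma point_of0 S A B F : @point_of S A B F ord0 = A.
Proof. by rewrite /point_of unlift_none. Qed.

Lemma point_of1 S A B F : @point_of S A B F (lift ord0 ord0) = B.
Proof. by rewrite /point_of liftK unlift_none. Qed.

Lemma point_of_fibre S A B F j : @point_of S A B F (fibre_var j) = F j.
Proof. by rewrite /point_of /fibre_var !liftK. Qed.

Variant var_spec : 'I_c.+2 -> Type :=
| Var0 : var_spec ord0
| Var1 : var_spec (lift ord0 ord0)
| VarFibre j : var_spec (fibre_var j).

Lemma varP v : var_spec v.
Proof.
case: (unliftP ord0 v) => [v1 ->|->]; last exact: Var0.
by case: (unliftP ord0 v1) => [j ->|->]; [exact: VarFibre | exact: Var1].
Qed.

(* Planes of slopes theta and theta' meet over x_1 / x_0 = theta + theta'; for distinct powers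
   of 2 these sums are distinct and even. *)
Definition code (j : 'I_c) (a : nat) := (a * c + j).+1.
Definition theta j a : k := (2 ^ code j a)%:R.

Lemma code_inj j a j' a' : code j a = code j' a' -> j = j' /\ a = a'.
Proof.
move=> [E]; have c0 : (0 < c)%N by apply: leq_ltn_trans (ltn_ord j).
split.
  apply: val_inj; have := congr1 (fun n => n %% c)%N E.
  by rewrite !modnMDl !modn_small.
have := congr1 (fun n => n %/ c)%N E.
by rewrite !divnMDl // !divn_small // !addn0.
Qed.

Lemma theta_inj j a b : theta j a = theta j b -> a = b.
Proof. by move/natr_inj/eqP; rewrite eqn_exp2l // => /eqP/code_inj[]. Qed.

Definition slope_form j a : R := theta j a *: x1 - theta j a ^+ 2 *: x0.
Definition plane_form j a : R := 'X_(fibre_var j) - slope_form j a.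
Definition special_system (j : 'I_c) : R := \prod_(a < deg j) plane_form j a.

Variables (G : finType) (co : G -> 'I_c -> nat).
Hypothesis co_lt : forall g j, (co g j < deg j)%N.
Hypothesis co_inj : forall g g', co g =1 co g' -> g = g'.
Hypothesis co_surj : forall a : 'I_c -> nat, (forall j, a j < deg j)%N ->
  exists g, co g =1 a.

(** The line on which x_(j+2) = theta x_1 - theta^2 x_0 with theta = [theta j (co g j)],
    parametrized by x_0 = 1 and x_1 = X. Thus G numbers the choices of one linear factor in each
    equation. *)
Definition line_point g : 'I_N -> {poly k} :=
  point_of 1 'X (fun j => theta j (co g j) *: 'X - (theta j (co g j) ^+ 2)%:P).

Definition line g : R -> {poly k} := mmap polyC (line_point g).

HB.instance Definition _ g := GRing.RMorphism.copy (line g) (mmap polyC (line_point g)).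

Lemma lineX g i : line g 'X_i = line_point g i.
Proof. by rewrite /line mmapX mmap1U. Qed.

Lemma lineC g e : line g e%:MP = e%:P.
Proof. by rewrite /line mmapC. Qed.

Lemma lineZ g e p : line g (e *: p) = e *: line g p.
Proof. by rewrite -mul_mpolyC rmorphM /= lineC mul_polyC. Qed.

Lemma line_slope_form g j a :
  line g (slope_form j a) = theta j a *: 'X - (theta j a ^+ 2)%:P.
Proof.
rewrite /slope_form rmorphB /= !lineZ !lineX /line_point point_of0 point_of1.
by rewrite -mul_polyC -mul_polyC mulr1.
Qed.

Lemma line_special g j : line g (special_system j) = 0.
Proof.
rewrite /special_system rmorph_prod /= (bigD1 (Ordinal (co_lt g j))) //=.
rewrite /plane_form rmorphB /= line_slope_form lineX /line_point point_of_fibre.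
by rewrite subrr mul0r.
Qed.

Lemma line_ideal g p : equation_ideal (n := c.+1) special_system p -> line g p = 0.
Proof.
move=> [a ->]; rewrite rmorph_sum big1 // => j _.
by rewrite rmorphM /= line_special mulr0.
Qed.

Lemma size_line_point g i : (size (line_point g i) <= 2)%N.
Proof.
case: (varP i) => [||j]; rewrite /line_point ?point_of0 ?point_of1 ?point_of_fibre.
- by rewrite size_poly1.
- by rewrite size_polyX.
apply: leq_trans (size_polyD _ _) _; rewrite size_polyN geq_max.
rewrite (leq_trans (size_scale_leq _ _)) ?size_polyX //.
by rewrite (leq_trans (size_polyC_leq1 _)).
Qed.

Lemma size_line g m p : p \is m.-homog -> (size (line g p) <= m.+1)%N.
Proof.
move=> hp; rewrite (mpolyE p) rmorph_sum /=; apply: leq_trans (size_sum _ _ _) _.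
apply/bigmax_leqP_seq => mu mus _; rewrite lineZ; apply: leq_trans (size_scale_leq _ _) _.
rewrite /line mmapX /mmap1 -(dhomog_mf hp mus) /= mdegE.
elim/big_rec2: _ => [|i n q _ IH]; first by rewrite size_poly1.
apply: leq_trans (size_polyMleq _ _) _.
have H : (size (line_point g i ^+ mu i) <= (mu i).+1)%N.
  apply: leq_trans (size_poly_exp_leq _ _) _.
  by rewrite ltnS -[X in (_ <= X)%N]mul1n leq_mul2r; have := size_line_point g i; lia.
by have := leq_sub2r 1 (leq_add H IH); rewrite !subn1 addSn addnS.
Qed.

Lemma line_horner g p z :
  (line g p).[z] = p.@[fun i => (line_point g i).[z]].
Proof.
pose phi : {rmorphism R -> k} := horner_eval z \o line g.
apply: (mpoly_morphism_ext (phi := phi) (psi := meval (fun i => (line_point g i).[z]))).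
  by move=> e; rewrite /= lineC /horner_eval hornerC mevalC.
by move=> i; rewrite /= lineX mevalXU.
Qed.

End Lines.

(** * The ideal of the degenerate curve *)

Section SpecialSystem.

Variables (k : fieldType) (char0 : [pchar k] =i pred0).
Variables (c : nat) (d : c.-tuple nat).
Local Notation R := {mpoly k[c.+2]}.
Local Notation N := c.+2.
Local Notation x0 := ('X_ord0 : R).
Local Notation x1 := ('X_(lift ord0 ord0) : R).
Local Notation fibre_var := (@fibre_var c).
Local Notation deg := (tnth d).
Local Notation theta := (@theta k c).
Local Notation slope_form := (@slope_form k c).
Local Notation plane_form := (@plane_form k c).
Local Notation special_system := (@special_system k c d).

Lemma plane_form_homog j a : plane_form j a \is 1.-homog.
Proof. by rewrite /plane_form !rpredB ?rpredZ // ?variable_homog. Qed.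

Lemma prod_homog n (F : nat -> R) : (forall a, F a \is 1.-homog) ->
  \prod_(a < n) F a \is n.-homog.
Proof.
move=> hF; elim: n => [|n IHn]; first by rewrite big_ord0 dhomog1.
by rewrite big_ord_recr /=; have := dhomogM IHn (hF n); rewrite addn1.
Qed.

Lemma special_system_hyp : hypersurfaces (n := c.+1) d special_system.
Proof. by move=> j; apply: prod_homog (plane_form_homog j). Qed.

(** Modulo x_0 and x_1 each plane form becomes x_(j+2). This is the shape of leading term and tail
    from which [near_has_normal_basis] starts. *)
Lemma special_system_expand j : exists A B,
  special_system j = 'X_(fibre_var j) ^+ deg j + x0 * A + x1 * B.
Proof.
rewrite /special_system; elim: (deg j) => [|n [A [B E]]].
  by exists 0, 0; rewrite big_ord0 expr0 !mulr0 !addr0.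
rewrite big_ord_recr /= E /plane_form /slope_form.
exists (A * ('X_(fibre_var j) - slope_form j n) + theta j n ^+ 2 *: 'X_(fibre_var j) ^+ n).
exists (B * ('X_(fibre_var j) - slope_form j n) - theta j n *: 'X_(fibre_var j) ^+ n).
have -> : ('X_(fibre_var j) : R) ^+ n.+1 = 'X_(fibre_var j) ^+ n * 'X_(fibre_var j) by rewrite exprSr.
rewrite /slope_form -!mul_mpolyC; move: (_%:MP) (_%:MP) ('X_(fibre_var j) ^+ n) => u v w; ring.
Qed.

Lemma special_system_coef j (mu : 'X_{1..c.+2}) : (mu ord0 + mu (lift ord0 ord0))%N = 0%N ->
  (special_system j)@_mu = ((U_(fibre_var j) *+ deg j)%MM == mu)%:R.
Proof.
move/eqP; rewrite addn_eq0 => /andP[/eqP mu0 /eqP mu1].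
have [A [B ->]] := special_system_expand j.
rewrite !mcoeffD mpolyXn mcoeffX !mcoeff_monomialM !lep1mP mu0 mu1 /=.
by rewrite !addr0.
Qed.

Lemma special_system_lead j : (special_system j)@_(U_(fibre_var j) *+ deg j) = 1.
Proof. by rewrite special_system_coef ?eqxx // !mulmnE !mnm1E !mul0n. Qed.

Lemma special_system_tail j (mu : 'X_{1..c.+2}) : (special_system j)@_mu != 0 ->
  mu != (U_(fibre_var j) *+ deg j)%MM -> (0 < mu ord0 + mu (lift ord0 ord0))%N.
Proof.
move=> cmu ne; rewrite lt0n; apply: contra ne => /eqP E.
by move: cmu; rewrite special_system_coef //; case: ((U_(fibre_var j) *+ deg j)%MM =P mu) => [-> | _]; rewrite eqxx.
Qed.

Variables (G : finType) (co : G -> 'I_c -> nat).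
Hypothesis co_lt : forall g j, (co g j < deg j)%N.
Hypothesis co_inj : forall g g', co g =1 co g' -> g = g'.
Hypothesis co_surj : forall a : 'I_c -> nat, (forall j, a j < deg j)%N ->
  exists g, co g =1 a.
Local Notation line := (line co).

(* The first i fibre variables are evaluated on the line g. *)
Definition partial_line i g : R -> R :=
  comp_mpoly [tuple point_of x0 x1
    (fun j : 'I_c => if (j < i)%N then slope_form j (co g j) else 'X_(fibre_var j)) v | v < N].

HB.instance Definition _ i g := GRing.RMorphism.copy (partial_line i g)
  (comp_mpoly [tuple point_of x0 x1
    (fun j : 'I_c => if (j < i)%N then slope_form j (co g j) else 'X_(fibre_var j)) v | v < N]).

Definition plane_subst (i : 'I_c) a : R -> R :=
  comp_mpoly [tuple point_of x0 x1
    (fun j : 'I_c => if j == i then slope_form j a else 'X_(fibre_var j)) v | v < N].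

HB.instance Definition _ i a := GRing.RMorphism.copy (plane_subst i a)
  (comp_mpoly [tuple point_of x0 x1
    (fun j : 'I_c => if j == i then slope_form j a else 'X_(fibre_var j)) v | v < N]).

Lemma comp_mpoly_var (F : 'I_N -> R) v : 'X_v \mPo [tuple F v | v < N] = F v.
Proof. by rewrite comp_mpolyXU (nth_map v) ?size_enum_ord // nth_ord_enum. Qed.

Lemma partial_lineX i g v : partial_line i g 'X_v = point_of x0 x1
    (fun j : 'I_c => if (j < i)%N then slope_form j (co g j) else 'X_(fibre_var j)) v.
Proof. exact: comp_mpoly_var. Qed.

Lemma plane_substX i a v : plane_subst i a 'X_v = point_of x0 x1
    (fun j : 'I_c => if j == i then slope_form j a else 'X_(fibre_var j)) v.
Proof. exact: comp_mpoly_var. Qed.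

Lemma partial_lineC i g e : partial_line i g e%:MP = e%:MP.
Proof. exact: comp_mpolyC. Qed.

Lemma plane_substC i g e : plane_subst i g e%:MP = e%:MP.
Proof. exact: comp_mpolyC. Qed.

Lemma partial_line_slope_form i g j a : partial_line i g (slope_form j a) = slope_form j a.
Proof.
rewrite /slope_form rmorphB -!mul_mpolyC !rmorphM /= !partial_lineC !partial_lineX.
by rewrite point_of0 point_of1.
Qed.

Lemma plane_substE i a p : exists q, p - plane_subst i a p = plane_form i a * q.
Proof.
pose P p := exists q, p - plane_subst i a p = plane_form i a * q.
have PD u v : P u -> P v -> P (u + v).
  move=> [q E] [q' E']; exists (q + q').
  by rewrite rmorphD opprD addrACA E E' mulrDr.
have PM u v : P u -> P v -> P (u * v).
  move=> [q E] [q' E']; exists (q * v + plane_subst i a u * q').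
  rewrite rmorphM /= mulrDr mulrA -E mulrCA -E'; ring.
have PC e : P e%:MP by exists 0; rewrite plane_substC subrr mulr0.
have PX v : P 'X_v.
  rewrite /P plane_substX; case: (varP v) => [||j].
  - by exists 0; rewrite point_of0 subrr mulr0.
  - by exists 0; rewrite point_of1 subrr mulr0.
  rewrite point_of_fibre; case: eqP => [->|_]; first by exists 1; rewrite mulr1.
  by exists 0; rewrite subrr mulr0.
have P0 : P 0 by have := PC 0; rewrite mpolyC0.
rewrite -/(P p) (mpolyE p); apply: (big_ind P P0 PD) => mu _.
rewrite -mul_mpolyC; apply: (PM _ _ (PC _)); rewrite mpolyXE_id.
have P1 : P 1 by have := PC 1; rewrite mpolyC1.
apply: (big_ind P P1 PM) => v _; elim: (mu v) => [|n IHn]; first exact: P1.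
by rewrite exprS; exact: PM (PX v) IHn.
Qed.

Lemma partial_line_subst (i : 'I_c) g g' a p :
  (forall j : 'I_c, (j < i)%N -> co g' j = co g j) -> co g' i = a ->
  partial_line i g (plane_subst i a p) = partial_line i.+1 g' p.
Proof.
move=> Eg Ea; pose phi : {rmorphism R -> R} := partial_line i g \o plane_subst i a.
apply: (mpoly_morphism_ext (phi := phi) (psi := partial_line i.+1 g')).
  by move=> e; rewrite /= plane_substC !partial_lineC.
move=> v; rewrite /= plane_substX partial_lineX; case: (varP v) => [||j].
- by rewrite !point_of0 partial_lineX point_of0.
- by rewrite !point_of1 partial_lineX point_of1.
rewrite !point_of_fibre; case: eqP => [->|/eqP ne].
  by rewrite partial_line_slope_form ltnSn Ea.
rewrite partial_lineX point_of_fibre ltnS [in RHS]leq_eqVlt (inj_eq val_inj) (negbTE ne) /=.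
by case: ltnP => // ji; rewrite Eg.
Qed.

Lemma partial_line_truncate i g p :
  equation_ideal (n := c.+1) (truncate i special_system) p -> partial_line i g p = 0.
Proof.
move=> [a ->]; rewrite rmorph_sum big1 // => j _.
rewrite rmorphM /= /truncate; case: ifP => ji; last by rewrite rmorph0 mulr0.
rewrite /special_system rmorph_prod /= (bigD1 (Ordinal (co_lt g j))) //=.
rewrite /plane_form rmorphB /= partial_line_slope_form partial_lineX point_of_fibre ji.
by rewrite subrr mul0r mulr0.
Qed.

Lemma slope_form_inj j a b : slope_form j a = slope_form j b -> a = b.
Proof.
move=> /(congr1 (mcoeff U_(lift ord0 ord0))).
rewrite /slope_form !mcoeffB !mcoeffZ !mcoeffX eqxx !mulr1.
rewrite (_ : (U_(ord0) == U_(lift ord0 ord0))%MM = false).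
  by rewrite !mulr0 !subr0 => /(theta_inj char0).
by apply/eqP => /mnmP/(_ ord0); rewrite !mnm1E.
Qed.

Lemma truncateS_sub (i : nat) (f : 'I_c -> R) p : equation_ideal (n := c.+1) (truncate i f) p ->
  equation_ideal (n := c.+1) (truncate i.+1 f) p.
Proof.
move=> [a ->]; exists (fun j : 'I_c => if (j < i)%N then a j else 0).
apply: eq_bigr => j _; rewrite /truncate; case: ltnP => ji; last by rewrite mulr0 mul0r.
by rewrite ltnS ltnW.
Qed.

(** Induction on the number of equations; the linear factors of the next equation are divided out of
    p one after the other. *)
Lemma partial_lines_ideal (g0 : G) i p : (i <= c)%N -> (forall g, partial_line i g p = 0) ->
  equation_ideal (n := c.+1) (truncate i special_system) p.
Proof.
elim: i p => [|i IHi] p ic Hp.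
  have -> : p = 0.
    rewrite -(Hp g0); apply: esym.
    apply: (mpoly_morphism_ext (phi := partial_line 0 g0) (psi := idfun)).
      exact: partial_lineC.
    move=> v; apply: etrans (partial_lineX 0 g0 v) _; case: (varP v) => [||j];
      by rewrite ?point_of0 ?point_of1 ?point_of_fibre.
  exact: equation_ideal0.
pose i' := Ordinal ic.
(* Modulo the ideal, p is the product of the first n factors times q, and q still vanishes on the
   lines in the remaining planes. The restriction of q to plane n is in the ideal by induction, the
   rest is divisible by the n-th form, and that form is nonzero on the later lines because the
   slopes are distinct. For n = d_i the product is the equation itself. *)
have H n : (n <= deg i')%N -> exists q,
    equation_ideal (n := c.+1) (truncate i.+1 special_system)
      (p - (\prod_(a < n) plane_form i' a) * q) /\
    forall g, (n <= co g i')%N -> partial_line i.+1 g q = 0.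
  elim: n => [|n IHn] nd.
    by exists p; rewrite big_ord0 mul1r subrr; split=> //; apply: equation_ideal0.
  have [q [Iq Zq]] := IHn (ltnW nd).
  have Iq' : equation_ideal (n := c.+1) (truncate i special_system) (plane_subst i' n q).
    apply: IHi (ltnW ic) _ => g.
    have [g' Eg'] : exists g', co g' =1 (fun j => if j == i' then n else co g j).
      by apply: co_surj => j; case: eqP => [->|].
    rewrite (@partial_line_subst i' g g' n).
    - by apply: Zq; rewrite Eg' eqxx.
    - by move=> j ji; rewrite Eg' -val_eqE /= (ltn_eqF ji).
    - by rewrite Eg' eqxx.
  have [q' Eq'] := plane_substE i' n q; exists q'; split.
    rewrite big_ord_recr /= -mulrA -Eq'.
    have -> : p - (\prod_(a < n) plane_form i' a) * (q - plane_subst i' n q) =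
      (p - (\prod_(a < n) plane_form i' a) * q) + (\prod_(a < n) plane_form i' a) * plane_subst i' n q by ring.
    apply: equation_idealD => //; apply: equation_idealM; exact: truncateS_sub.
  move=> g ng; have /eqP := congr1 (partial_line i.+1 g) Eq'.
  rewrite rmorphB rmorphM /= (Zq _ (ltnW ng)) (partial_line_truncate g (truncateS_sub Iq')) subr0.
  rewrite eq_sym mulf_eq0 => /orP[|/eqP//].
  rewrite /plane_form rmorphB /= partial_line_slope_form partial_lineX point_of_fibre ltnSn.
  by rewrite subr_eq0 => /eqP/slope_form_inj E; rewrite E ltnn in ng.
have [q [Iq _]] := H _ (leqnn _).
rewrite -(subrK ((\prod_(a < deg i') plane_form i' a) * q) p).
apply: equation_idealD => //; rewrite mulrC; apply: equation_idealM.
have -> : \prod_(a < deg i') plane_form i' a = truncate i.+1 special_system i'.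
  by rewrite /truncate /= ltnSn.
exact: equation_ideal_gen.
Qed.

End SpecialSystem.

(** * Restriction to the lines, and their nodes *)

Section LineConfiguration.

Variables (k : fieldType) (char0 : [pchar k] =i pred0).
Variables (c : nat) (d : c.-tuple nat).
Local Notation R := {mpoly k[c.+2]}.
Local Notation N := c.+2.
Local Notation fibre_var := (@fibre_var c).
Local Notation deg := (tnth d).
Local Notation theta := (@theta k c).
Local Notation slope_form := (@slope_form k c).
Local Notation special_system := (@special_system k c d).

Variables (G : finType) (co : G -> 'I_c -> nat).
Hypothesis co_lt : forall g j, (co g j < deg j)%N.
Hypothesis co_inj : forall g g', co g =1 co g' -> g = g'.
Hypothesis co_surj : forall a : 'I_c -> nat, (forall j, a j < deg j)%N ->
  exists g, co g =1 a.
Local Notation line := (@line k c G co).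
Local Notation line_point := (@line_point k c G co).

Lemma line_base g (mu : 'X_{1..c.+2}) : (forall j, mu (fibre_var j) = 0%N) ->
  line g 'X_[mu] = 'X^(mu (lift ord0 ord0)).
Proof.
move=> mu0; rewrite /line mmapX /mmap1 big_ord_recl big_ord_recl big1 ?mulr1; last first.
  by move=> j _; rewrite mu0 expr0.
by rewrite /line_point point_of0 point_of1 expr1n mul1r.
Qed.

Lemma base_line_eq0 g m b : base_poly b -> b \is m.-homog -> line g b = 0 -> b = 0.
Proof.
move=> bb hb lb; apply/mpolyP => nu; rewrite mcoeff0; apply/eqP; apply: contraT => nub.
have /eqP : (line g b)`_(nu (lift ord0 ord0)) = 0 by rewrite lb coef0.
rewrite {1}(mpolyE b) rmorph_sum /= coef_sum (bigD1_seq nu) ?msupp_uniq ?mcoeff_msupp //=.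
rewrite lineZ coefZ line_base; last exact: bb.
rewrite coefXn eqxx mulr1 big1_seq ?addr0 ?(negbTE nub) // => mu /andP[ne mub].
have bmu : forall j, mu (fibre_var j) = 0%N by apply: bb; rewrite -mcoeff_msupp.
rewrite lineZ coefZ line_base // coefXn; case: eqP; rewrite ?mulr0 // => E.
case/eqP: ne; apply/mnmP => v.
have := dhomog_mf hb mub; rewrite -(dhomog_mf hb (_ : nu \in msupp b)) ?mcoeff_msupp //=.
rewrite !mdeg_fibre_var big1 // big1; last by move=> j _; apply: bb.
rewrite !addn0 E => /addIn E0.
by case: (varP v) => [||j] //; rewrite bmu bb.
Qed.

Lemma partial_line_monomial g (mu : 'X_{1..c.+2}) :
  exists F : 'I_N -> R, [/\ forall v, F v \is 1.-homog, forall v, base_poly (F v)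
    & partial_line co c g 'X_[mu] = \prod_v F v ^+ mu v].
Proof.
exists (fun v => partial_line co c g 'X_v); split=> [v|v|].
- rewrite partial_lineX; case: (varP v) => [||j]; rewrite ?point_of0 ?point_of1 ?point_of_fibre.
  + exact: variable_homog.
  + exact: variable_homog.
  by rewrite ltn_ord /slope_form rpredB // rpredZ // variable_homog.
- rewrite partial_lineX; case: (varP v) => [||j]; rewrite ?point_of0 ?point_of1 ?point_of_fibre.
  + exact: base_poly_x0.
  + exact: base_poly_x1.
  rewrite ltn_ord /slope_form; apply: (subspaceB (@base_poly_subspace k c));
    apply: (subspaceZ (@base_poly_subspace k c)).
    exact: base_poly_x1.
  exact: base_poly_x0.
rewrite mpolyXE_id rmorph_prod; apply: eq_bigr => v _; exact: rmorphXn.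
Qed.

Lemma base_poly1 : base_poly (1 : R).
Proof. by rewrite -mpolyX0; apply: base_polyX => j; rewrite mnm0E. Qed.

Lemma partial_line_base g (p : R) : base_poly (partial_line co c g p).
Proof.
apply: (subspace_mpoly (P := fun p => base_poly (partial_line co c g p))).
  split; first by rewrite rmorph0; case: (@base_poly_subspace k c).
  move=> e u v bu bv; rewrite rmorphD -mul_mpolyC rmorphM /= partial_lineC mul_mpolyC.
  by case: (@base_poly_subspace k c) => _; apply.
move=> mu _; have [F [_ bF ->]] := partial_line_monomial g mu.
apply: (big_ind (@base_poly k c)); [exact: base_poly1 | exact: base_polyM |].
by move=> v _; apply: base_polyX_exp; apply: bF.
Qed.

Lemma partial_line_homog g m (p : R) : p \is m.-homog -> partial_line co c g p \is m.-homog.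
Proof.
move=> hp; rewrite (mpolyE p) rmorph_sum big_seq; apply: rpred_sum => mu mup.
rewrite -mul_mpolyC rmorphM /= partial_lineC mul_mpolyC; apply: rpredZ.
have [F [hF _ ->]] := partial_line_monomial g mu.
rewrite -(dhomog_mf hp mup) /= mdegE.
apply: (big_ind2 (fun (q : R) n => q \is n.-homog)).
- exact: dhomog1.
- by move=> q1 n1 q2 n2; apply: dhomogM.
by move=> v _; have := dhomogMn (mu v) (hF v); rewrite mul1n.
Qed.

Lemma line_partial_line g p : line g (partial_line co c g p) = line g p.
Proof.
pose phi : {rmorphism R -> {poly k}} := line g \o partial_line co c g.
apply: (mpoly_morphism_ext (phi := phi) (psi := line g)).
  by move=> e; rewrite /= partial_lineC.
move=> v; rewrite /= partial_lineX lineX /line_point.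
case: (varP v) => [||j]; rewrite ?point_of0 ?point_of1 ?point_of_fibre ?lineX /line_point ?point_of0 ?point_of1 //.
by rewrite ltn_ord line_slope_form.
Qed.

(** The degenerate curve is reduced. This allows a section to be shown zero modulo the ideal by
    restricting it to each line. *)
Lemma lines_ideal (g0 : G) m p : p \is m.-homog -> (forall g, line g p = 0) ->
  equation_ideal (n := c.+1) special_system p.
Proof.
move=> hp lp; rewrite -(truncate_all special_system).
apply: (partial_lines_ideal char0 co_lt co_surj g0) => // g.
apply: (@base_line_eq0 g m _ (@partial_line_base g p) (partial_line_homog g hp)).
by rewrite line_partial_line.
Qed.

Definition adjacent (g g' : G) :=
  [exists j, (co g j != co g' j) && [forall j', (j' != j) ==> (co g j' == co g' j')]].

Lemma adjacentP g g' : reflect (exists2 j, co g j <> co g' j &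
  forall j', j' != j -> co g j' = co g' j') (adjacent g g').
Proof.
apply: (iffP existsP) => [[j /andP[/eqP ne /forallP H]]|[j ne H]]; exists j => //.
  by move=> j' jj'; have := H j'; rewrite jj' => /eqP.
by apply/andP; split; [exact/eqP | apply/forallP => j'; apply/implyP => /H ->].
Qed.

Lemma adjacent_sym g g' : adjacent g g' = adjacent g' g.
Proof.
by apply/adjacentP/adjacentP => -[j ne H]; exists j => [E|j' /H->] //; apply: ne.
Qed.

(** For adjacent lines the sum has one term, theta + theta', the value of x_1 / x_0 at their common
    point. Summing over all differing coordinates avoids choosing the direction. *)
Definition node_nat (g g' : G) := (\sum_(j | co g j != co g' j)
  (2 ^ code j (co g j) + 2 ^ code j (co g' j)))%N.
Definition node g g' : k := (node_nat g g')%:R.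

Lemma node_natE g g' j : co g j <> co g' j -> (forall j', j' != j -> co g j' = co g' j') ->
  node_nat g g' = (2 ^ code j (co g j) + 2 ^ code j (co g' j))%N.
Proof.
move=> /eqP ne H; rewrite /node_nat (bigD1 j) //= big1 ?addn0 // => j' /andP[ne' jj'].
by rewrite H ?eqxx in ne'.
Qed.

Lemma node_nat_even g g' : ~~ odd (node_nat g g').
Proof.
apply: (big_ind (fun n => ~~ odd n)) => // [m n /negbTE om /negbTE on|j _].
  by rewrite oddD om on.
by rewrite /code !expnS !mul2n -doubleD odd_double.
Qed.

Lemma node_inj g g1 g2 : adjacent g g1 -> adjacent g g2 -> node g g1 = node g g2 -> g1 = g2.
Proof.
move=> /adjacentP[j ne H] /adjacentP[j' ne' H'] /(natr_inj char0).
rewrite (node_natE ne H) (node_natE ne' H') => E.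
have nc : code j (co g j) <> code j (co g1 j) by move=> /code_inj[_ /ne].
have nc' : code j' (co g j') <> code j' (co g2 j') by move=> /code_inj[_ /ne'].
case: (sidon_pow2 nc nc' E) => -[/code_inj[jj' E1] /code_inj[_ E2]]; subst j'; last first.
  by case: ne'.
apply: co_inj => i; have [->|ij] := eqVneq i j; first by rewrite E2.
by rewrite -H // H'.
Qed.

Lemma line_point_node g g' i : adjacent g g' ->
  (line_point g i).[node g g'] = (line_point g' i).[node g g'].
Proof.
move=> /adjacentP[j ne H]; rewrite /line_point /node (node_natE ne H) natrD -!/(theta _ _).
case: (varP i) => [||l]; rewrite ?point_of0 ?point_of1 ?point_of_fibre //.
have [->|/H ->//] := eqVneq l j.
by rewrite !hornerE; ring.
Qed.

Lemma line_node g g' p : adjacent g g' -> (line g p).[node g g'] = (line g' p).[node g g'].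
Proof.
by move=> adj; rewrite !line_horner; apply: meval_eq => i; apply: line_point_node.
Qed.

Lemma node_sym g g' : node g g' = node g' g.
Proof.
rewrite /node /node_nat; congr (_%:R); apply: eq_big => j; first by rewrite eq_sym.
by rewrite addnC.
Qed.

(* The nodes have even abscissas. *)
Lemma line_points_distinct g g' z : g <> g' -> odd z ->
  exists j, (line_point g (fibre_var j)).[z%:R] <> (line_point g' (fibre_var j)).[z%:R].
Proof.
move=> ne oz.
have [j nej] : exists j, co g j <> co g' j.
  apply: contrapT => /forallNP H; apply: ne; apply: co_inj => j.
  by apply: contrapT; apply: H.
exists j; rewrite /line_point !point_of_fibre !hornerE => E.
have : (theta j (co g j) - theta j (co g' j)) *
    (z%:R - (theta j (co g j) + theta j (co g' j))) = 0.
  by move/eqP: E; rewrite -subr_eq0 => /eqP <-; ring.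
move/eqP; rewrite mulf_eq0 !subr_eq0 => /orP[/eqP/(theta_inj char0)//|].
rewrite /theta -natrD => /eqP/(natr_inj char0) Ez; move: oz.
by rewrite Ez /code !expnS !mul2n -doubleD odd_double.
Qed.

End LineConfiguration.

(** * Vanishing on the degenerate curve *)

Section RankedLines.

Variables (G : finType) (c : nat) (co : G -> 'I_c -> nat) (rk : G -> nat).

(* The lines of equal rank are connected, and two of them differ in any given direction. *)
Definition good_rank := forall X : 'I_c -> G -> Prop,
  (forall g g' j, adjacent co g g' -> rk g = rk g' -> co g j <> co g' j -> X j g) ->
  (forall g g' j, adjacent co g g' -> rk g = rk g' -> X j g' -> X j g) ->
  forall j g, X j g.

(** [lines_vanish] descends from the largest rank, so these are the neighbours of [g] already
    treated when the turn of [g] comes. *)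
Definition later g : {pred G} := [pred g' | adjacent co g g' && (rk g < rk g')%N].

Variables (k : fieldType) (char0 : [pchar k] =i pred0).
Hypothesis co_inj : forall g g', co g =1 co g' -> g = g'.
Hypothesis rk_good : good_rank.
Local Notation line_point := (@line_point k c G co).
Local Notation node := (@node k c G co).

Lemma factor_roots (p : {poly k}) (rs : seq k) : (size p <= (size rs).+1)%N ->
  uniq rs -> all (root p) rs -> exists w, p = w *: \prod_(r <- rs) ('X - r%:P).
Proof.
move=> sp urs ars; have [|q pE] := uniq_roots_prod_XsubC ars; first by rewrite uniq_rootsE.
exists q`_0; rewrite -mul_polyC {1}pE; congr (_ * _); apply: size1_polyC.
have [->|q0] := eqVneq q 0; first by rewrite size_poly0.
move: sp; rewrite pE size_Mmonic ?monic_prod_XsubC // size_prod_XsubC addnS /=.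
by rewrite -[X in (_ <= X)%N]add1n leq_add2r.
Qed.

Variables (a : nat) (P : G -> 'I_c.+2 -> {poly k}) (zs : G -> seq k).
Hypothesis P_size : forall g i, (size (P g i) <= a.+1)%N.
Hypothesis zs_size : forall g, (size (zs g) + #|later g| = a)%N.
Hypothesis zs_uniq : forall g, uniq (zs g).
Hypothesis zs_node : forall g g', adjacent co g g' -> node g g' \notin zs g.
Hypothesis P_root : forall g i z, z \in zs g -> root (P g i) z.
Hypothesis P_node : forall g g' i, adjacent co g g' ->
  (P g i).[node g g'] = (P g' i).[node g g'].
Hypothesis P_kernel : forall g, \sum_i P g i * line_point g i = 0.

Lemma lines_vanish g i : P g i = 0.
Proof.
pose K := (\max_g rk g)%N.
suff H : forall n g, (K - rk g < n)%N -> forall i, P g i = 0 by apply: (H (K - rk g).+1).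
elim=> [//|n IHn] {i}g; rewrite ltnS => gn.
have Kle g' : (rk g' <= K)%N by apply: leq_bigmax.
have later0 g' g'' : rk g' = rk g -> g'' \in later g' -> forall i, P g'' i = 0.
  move=> Eg' /andP[_ lt]; apply: IHn; apply: leq_trans gn; rewrite -Eg'.
  by have := Kle g''; lia.
(* The known zeros on a line: the assigned points of D and the nodes with treated lines. They are
   [a] in number, the degree bound of [P], so that a constant is left in each coordinate. *)
pose rs g' := zs g' ++ [seq node g' g'' | g'' <- enum (later g')].
pose Q g' := \prod_(r <- rs g') ('X - r%:P).
have rs_size g' : size (rs g') = a by rewrite size_cat size_map -cardE zs_size.
have rs_uniq g' : uniq (rs g').
  rewrite cat_uniq zs_uniq /= map_inj_in_uniq ?enum_uniq ?andbT; last first.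
    move=> g1 g2; rewrite !mem_enum => /andP[ad1 _] /andP[ad2 _].
    exact: (node_inj char0 co_inj ad1 ad2).
  apply/hasPn => z /mapP[g'']; rewrite mem_enum => /andP[ad _] ->.
  exact: zs_node.
have fac g' i : rk g' = rk g -> exists w, P g' i = w *: Q g'.
  move=> Eg'; apply: factor_roots; rewrite ?rs_size //.
  apply/allP => z; rewrite mem_cat => /orP[/P_root//|/mapP[g'']].
  rewrite mem_enum => lg'' ->; have /andP[ad _] := lg''.
  by rewrite /root P_node // (later0 g') // horner0.
have [W HW] : exists W : G -> 'I_c.+2 -> k, forall g' i, rk g' = rk g -> P g' i = W g' i *: Q g'.
  have /choice[W HW] : forall g', exists w : 'I_c.+2 -> k,
      forall i, rk g' = rk g -> P g' i = w i *: Q g'.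
    move=> g'; have [E|nE] := pselect (rk g' = rk g); last by exists (fun=> 0).
    by have /choice[w Hw] := fun i => fac g' i E; exists w.
  by exists W => g' i; apply: HW.
have Q_neq0 g' : Q g' != 0 by apply: monic_neq0; apply: monic_prod_XsubC.
have Wline g' : rk g' = rk g -> \sum_i W g' i *: line_point g' i = 0.
  move=> E; apply/eqP; have := P_kernel g'.
  rewrite (eq_bigr (fun i => Q g' * (W g' i *: line_point g' i))); last first.
    by move=> i _; rewrite HW // -scalerAl -scalerAr.
  by rewrite -mulr_sumr => /eqP; rewrite mulf_eq0 (negbTE (Q_neq0 g')).
(* At a node inside the stage the fixed form does not vanish, since its zeros are points of D and
   nodes with lines of other ranks. Equality of the values of [P] there makes the constant vectors
   of the two lines proportional. *)
have Qnode g' g'' : rk g' = rk g'' -> adjacent co g' g'' -> (Q g').[node g' g''] != 0.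
  move=> E ad; rewrite -[_ != 0]/(~~ root (Q g') _) root_prod_XsubC mem_cat negb_or zs_node //=.
  apply/negP => /mapP[g1]; rewrite mem_enum => /andP[ad1 lt] /(node_inj char0 co_inj ad ad1) E1.
  by rewrite -E1 E ltnn in lt.
have Wprop g' g'' : rk g' = rk g -> rk g'' = rk g -> adjacent co g' g'' ->
    exists2 l, l != 0 & forall i, W g' i = l * W g'' i.
  move=> E' E'' ad; have EE : rk g' = rk g'' by rewrite E' E''.
  have n' := Qnode _ _ EE ad.
  have n'' := Qnode _ _ (esym EE) (etrans (adjacent_sym co g'' g') ad).
  rewrite -(node_sym k) in n''.
  exists ((Q g'').[node g' g''] / (Q g').[node g' g'']).
    by rewrite mulf_neq0 ?invr_eq0.
  move=> i; have := P_node i ad; rewrite !HW // !hornerZ => H.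
  by rewrite -mulrAC [_ * W _ _]mulrC -H mulfK.
have fibre0 j g' : rk g' = rk g -> W g' (fibre_var j) = 0.
  apply: (rk_good (X := fun j g' => rk g' = rk g -> W g' (fibre_var j) = 0)).
    move=> {j}g1 g2 j ad E12 ne E1; have E2 : rk g2 = rk g by rewrite -E12.
    have [l l0 Wl] := Wprop _ _ E1 E2 ad.
    have S1 := Wline _ E1; have S2 : \sum_i W g1 i *: line_point g2 i = 0.
      rewrite (eq_bigr (fun i => l *: (W g2 i *: line_point g2 i))).
        by rewrite -scaler_sumr Wline // scaler0.
      by move=> i _; rewrite Wl scalerA.
    have /adjacentP[j' ne' H'] := ad.
    have jj' : j = j' by apply/eqP; apply: contraT => /H'.
    subst j'.
    have : \sum_i W g1 i *: (line_point g1 i - line_point g2 i) = 0.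
      under eq_bigr => i _ do rewrite scalerBr.
      by rewrite sumrB S1 S2 subrr.
    rewrite (bigD1 (fibre_var j)) //= big1 ?addr0; last first.
      move=> i; rewrite /line_point; case: (varP i) => [||j'] ij; rewrite ?point_of0 ?point_of1 ?subrr ?scaler0 //.
      rewrite !point_of_fibre H' ?subrr ?scaler0 //.
    move/eqP; rewrite scaler_eq0 => /orP[/eqP//|].
    rewrite /line_point !point_of_fibre => /eqP/(congr1 (fun q : {poly k} => q`_1)).
    rewrite coef0 !coefB !coefZ !coefX !coefC /= !mulr1 !subr0 => /eqP.
    by rewrite subr_eq0 => /eqP/(theta_inj char0)/ne.
  move=> {j}g1 g2 j ad E12 H E1; have E2 : rk g2 = rk g by rewrite -E12.
  by have [l l0 ->] := Wprop _ _ E1 E2 ad; rewrite H // mulr0.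
(* Only w_0 and w_1 are left, and the equation of the line now reads w_0 + w_1 X = 0. *)
have := Wline g (erefl _).
rewrite big_ord_recl big_ord_recl big1 ?addr0; last first.
  by move=> j _; rewrite -[lift _ _]/(fibre_var j) fibre0 // scale0r.
rewrite /line_point point_of0 point_of1 => E.
have E0 := congr1 (fun q : {poly k} => q`_0) E.
have E1 := congr1 (fun q : {poly k} => q`_1) E.
rewrite /= coefD !coefZ coef1 coefX coef0 /= mulr1 mulr0 addr0 in E0.
rewrite /= coefD !coefZ coef1 coefX coef0 /= mulr1 mulr0 add0r in E1.
move=> i; rewrite HW //.
by case: (varP i) => [||j]; rewrite ?E0 ?E1 ?fibre0 // scale0r.
Qed.

End RankedLines.

Lemma homogeneous_interpolation (k : fieldType) n (T : finType) (y : T -> 'I_n.+1 -> k) :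
  (forall s, y s ord0 = 1) -> (forall s s', s != s' -> exists i, y s i <> y s' i) ->
  exists L : T -> {mpoly k[n.+1]}, [/\ forall s, L s \is #|T|.-homog,
    forall s, (L s).@[y s] != 0 & forall s s', s != s' -> (L s).@[y s'] = 0].
Proof.
move=> y0 ysep.
have var_h i : ('X_i : {mpoly k[n.+1]}) \is 1.-homog.
  by rewrite dhomogX; apply/eqP; exact: mdeg1.
have sep s s' : exists l : {mpoly k[n.+1]}, [/\ l \is 1.-homog, l.@[y s] != 0
    & s != s' -> l.@[y s'] = 0].
  have [->|ne] := eqVneq s s'.
    (* The diagonal factor x_0 takes the value 1 at every point; it brings all the products to the
       common degree #|T|. *)
    by exists 'X_ord0; rewrite mevalXU y0 oner_eq0; split.
  have [i yi] := ysep _ _ ne; exists ('X_i - y s' i *: 'X_ord0); split.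
  - by rewrite rpredB ?rpredZ.
  - by rewrite mevalB mevalZ !mevalXU y0 mulr1 subr_eq0; apply/eqP.
  by move=> _; rewrite mevalB mevalZ !mevalXU y0 mulr1 subrr.
have /choice[l Hl] : forall ss : T * T, exists l : {mpoly k[n.+1]},
    [/\ l \is 1.-homog, l.@[y ss.1] != 0 & ss.1 != ss.2 -> l.@[y ss.2] = 0].
  by move=> [s s']; apply: sep.
exists (fun s => \prod_s' l (s, s')); split=> [s|s|s s' ne].
- rewrite -sum1_card; apply: (big_ind2 (fun (q : {mpoly k[n.+1]}) m => q \is m.-homog)).
  + exact: dhomog1.
  + by move=> q1 n1 q2 n2; apply: dhomogM.
  by move=> s' _; case: (Hl (s, s')).
- rewrite rmorph_prod; apply/prodf_neq0 => s' _.
  by case: (Hl (s, s')).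
rewrite rmorph_prod (bigD1 s') //=; have [_ _ H] := Hl (s, s').
by rewrite H // mul0r.
Qed.

(** * Test data on the degenerate curve *)

Section SpecialVanishing.

Variables (k : fieldType) (char0 : [pchar k] =i pred0).
Variables (c : nat) (d : c.-tuple nat).
Local Notation R := {mpoly k[c.+2]}.
Local Notation N := c.+2.
Local Notation x0 := ('X_ord0 : R).
Local Notation x1 := ('X_(lift ord0 ord0) : R).
Local Notation fibre_var := (@fibre_var c).
Local Notation deg := (tnth d).
Local Notation special_system := (@special_system k c d).

Variables (G : finZmodType) (co : G -> 'I_c -> nat).
Hypothesis co_lt : forall g j, (co g j < deg j)%N.
Hypothesis co_inj : forall g g', co g =1 co g' -> g = g'.
Hypothesis co_surj : forall a : 'I_c -> nat, (forall j, a j < deg j)%N ->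
  exists g, co g =1 a.
Hypothesis co_shift : forall g g' s j, (co (g + s) j == co (g' + s) j) = (co g j == co g' j).
Variable rk : G -> nat.
Hypothesis rk_good : good_rank co rk.

Lemma adjacent_shift g g' s : adjacent co (g + s) (g' + s) = adjacent co g g'.
Proof.
apply: eq_existsb => j; rewrite co_shift; congr (_ && _).
by apply: eq_forallb => j'; rewrite co_shift.
Qed.

Lemma good_rank_shift s : good_rank co (fun g => rk (g + s)).
Proof.
move=> X H1 H2 j g; rewrite -[g](addrK s) .
pose X' j g := X j (g - s); suff : X' j (g + s) by rewrite /X'.
have ne g1 g2 j' : co g1 j' <> co g2 j' -> co (g1 - s) j' <> co (g2 - s) j'.
  by move=> H; apply/eqP; rewrite co_shift; apply/eqP.
apply: rk_good => {j g}[g1 g2 j ad E n12|g1 g2 j ad E].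
  by apply: (H1 _ (g2 - s)); rewrite ?adjacent_shift ?subrK //; apply: ne.
by apply: (H2 _ (g2 - s)); rewrite ?adjacent_shift ?subrK.
Qed.

Lemma card_later_shift s g :
  #|later co (fun g => rk (g + s)) g| = #|later co rk (g + s)|.
Proof.
rewrite -!sum1_card [RHS](reindex (fun g => g + s)) /=; last first.
  by exists (fun g => g - s) => g' _; rewrite ?addrK ?subrK.
by apply: eq_bigl => g'; rewrite !inE adjacent_shift.
Qed.

Variable a : nat.
Hypothesis later_le : forall g, (#|later co rk g| <= a)%N.

Local Notation U := {g : G & 'I_(a - #|later co rk g|)}.

(** Nodes have even abscissas. Odd ones keep D away from the nodes, and over an odd abscissa the
    points of different lines are different. *)
Definition abscissa (u : U) : nat := (enum_rank u).*2.+1.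

Lemma card_tag g : #|[pred u : U | tag u == g]| = (a - #|later co rk g|)%N.
Proof.
rewrite -[RHS]card_ord -(card_image (f := fun i => (Tagged (fun g => 'I_(a - #|later co rk g|)) i : U))).
  apply: eq_card => -[g' i]; rewrite [LHS]inE /=; apply/idP/idP => [/eqP E|/mapP[i' _ /(congr1 tag) /= E]].
    by subst g'; apply: map_f; rewrite mem_enum.
  by rewrite E.
move=> i i' /eqP; rewrite -tag_eqE /tag_eq eqxx /= tagged_asE => /eqP //.
Qed.

Definition abscissas_form : R := \prod_(u : U) (x1 - (abscissa u)%:R *: x0).

Lemma card_abscissas : (\sum_g (a - #|later co rk g|) = #|{: U}|)%N.
Proof.
rewrite card_tagged sumnE big_map big_enum; apply: eq_bigr => g _.
by rewrite card_ord.
Qed.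

Lemma abscissas_form_homog :
  abscissas_form \is (\sum_g (a - #|later co rk g|))%N.-homog.
Proof.
rewrite card_abscissas -sum1_card; apply: (big_ind2 (fun (q : R) m => q \is m.-homog)).
- exact: dhomog1.
- by move=> q1 n1 q2 n2; apply: dhomogM.
by move=> u _; rewrite rpredB ?rpredZ // variable_homog.
Qed.

Lemma abscissas_form_base : base_poly abscissas_form.
Proof.
apply: (big_ind (@base_poly k c)); [exact: base_poly1 | exact: base_polyM |].
move=> u _; apply: (subspaceB (@base_poly_subspace k c)); first exact: base_poly_x1.
by apply: (subspaceZ (@base_poly_subspace k c)); apply: base_poly_x0.
Qed.

Lemma abscissas_form_kill : kill_x0 abscissas_form != 0.
Proof.
rewrite /kill_x0 rmorph_prod; apply/prodf_neq0 => u _ /=.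
rewrite rmorphB /= comp_mpolyZ -!/(kill_x0 _) !kill_x0X !mnm1E /= scaler0 subr0.
by have := @kill_x0_x1_exp k c 1; rewrite expr1 kill_x0X mnm1E.
Qed.

(** Row i of a test section is treated with the ranking translated by s = [enum_val i], for which
    line g needs a - #|later (g + s)| points. Over all s these demands add up to #|U|, the number of
    points of D on each line. *)
Theorem special_no_test_section : exists (t : 'rV[R]_#|G|) tau,
  [/\ (\sum_g (a - #|later co rk g|) <= tau)%N, forall i, t 0 i \is tau.-homog &
  forall v, homog_mx a v -> test_section special_system t abscissas_form v ->
    zero_mod special_system v].
Proof.
pose y (gu : G * U) i := (line_point k co gu.1 i).[(abscissa gu.2)%:R].
have odd_abscissa u : odd (abscissa u) by rewrite /= odd_double.
have abscissa_inj u u' : (abscissa u)%:R = (abscissa u')%:R :> k -> u = u'.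
  by move/(natr_inj char0) => [] /double_inj /val_inj /enum_rank_inj.
have y0 s : y s ord0 = 1 by rewrite /y /line_point point_of0 hornerC.
have ysep s s' : s != s' -> exists i, y s i <> y s' i.
  case: s s' => [g u] [g' u'] ne.
  have [E|/eqP neu] := eqVneq u u'; last first.
    exists (lift ord0 ord0); rewrite /y /line_point !point_of1 /= !hornerX.
    by move/abscissa_inj.
  subst u'; have neg : g <> g' by move=> E; rewrite E eqxx in ne.
  have [j Hj] := line_points_distinct char0 co_inj neg (odd_abscissa u).
  by exists (fibre_var j).
have [L [hL L0 L1]] := homogeneous_interpolation y0 ysep.
(* At the point of line g with abscissa u, the only nonzero entry of [t] is the one indexed by
   [tag u] - g. So t v = 0 at this point says that row s of v vanishes there, where [tag u] = g +
   s. *)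
pose t : 'rV[R]_#|G| := \row_i \sum_(gu : G * U | tag gu.2 - gu.1 == enum_val i) L gu.
exists t, #|{: G * U}|; split.
- rewrite card_abscissas card_prod; apply: leq_pmull.
  by apply/card_gt0P; exists (0 : G).
- by move=> i; rewrite mxE; apply: rpred_sum => gu _; apply: hL.
move=> v hv [Zv [w Zw]].
have ideal_y p gu : equation_ideal (n := c.+1) special_system p -> p.@[y gu] = 0.
  by move=> Ip; rewrite -line_horner (line_ideal co_lt) // horner0.
have ty i gu : (t 0 i).@[y gu] = if tag gu.2 - gu.1 == enum_val i then (L gu).@[y gu] else 0.
  rewrite mxE raddf_sum /= big_mkcond (bigD1 gu) //= big1 ?addr0 // => gu' ne.
  by case: ifP => // _; rewrite L1.
have vroot g u i j : tag u = g + enum_val i -> root (line co g (v i j)) (abscissa u)%:R.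
  move=> E; rewrite /root line_horner -/(y (g, u)).
  have hy : abscissas_form.@[y (g, u)] = 0.
    rewrite rmorph_prod (bigD1 u) //= mevalB mevalZ !mevalXU /y /line_point.
    by rewrite point_of0 point_of1 !hornerE subrr mul0r.
  have := ideal_y _ (g, u) (Zw 0 j); rewrite !mxE mevalB mevalM hy mul0r subr0 raddf_sum /=.
  rewrite (bigD1 i) //= big1 ?addr0; last first.
    move=> i' ne; rewrite mevalM ty /= E addrAC subrr add0r (inj_eq enum_val_inj).
    by rewrite eq_sym (negbTE ne) mul0r.
  rewrite mevalM ty /= E addrAC subrr add0r eqxx => /eqP.
  by rewrite mulf_eq0 (negbTE (L0 _)).
move=> i j; pose s := enum_val i.
apply: (lines_ideal char0 co_lt co_surj (0 : G) (hv i j)) => g.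
refine (@lines_vanish G c co (fun g => rk (g + s)) k char0 co_inj (@good_rank_shift s)
  a (fun g j => line co g (v i j))
  (fun g => [seq (abscissa u)%:R | u <- enum [pred u : U | tag u == g + s]]) _ _ _ _ _ _ _ g j).
- by move=> g' j'; apply: size_line; apply: hv.
- move=> g'; rewrite size_map -cardE card_tag card_later_shift subnK //.
- move=> g'; rewrite map_inj_uniq ?enum_uniq //.
- move=> g' g'' _; apply/mapP => -[u _ /(natr_inj char0) E].
  by have := node_nat_even co g' g''; rewrite E odd_abscissa.
- move=> g' j' z /mapP[u]; rewrite mem_enum inE => /eqP E ->; exact: vroot.
- by move=> g' g'' j' ad; apply: line_node.
move=> g'; have := line_ideal co_lt g' (Zv i 0).
rewrite mxE rmorph_sum => H; rewrite -[RHS]H; apply: eq_bigr => j' _.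
by rewrite rmorphM /= mxE lineX.
Qed.

End SpecialVanishing.

(** * Absence of test sections for general equations *)

Section GenericVanishing.

Variables (k : fieldType) (c : nat) (d : c.-tuple nat).
Local Notation R := {mpoly k[c.+2]}.
Local Notation N := c.+2.
Local Notation system := ('I_c -> R).
Local Notation deg := (tnth d).

Lemma near_self (f0 : system) P : hypersurfaces (n := c.+1) d f0 -> near d f0 P -> P f0.
Proof. by move=> hf [p [p0 Hp]]; apply: Hp. Qed.

(** The monomials that are not reduced. Their reducers form a basis of the degree m part of the
    ideal, which turns membership in the ideal into linear algebra depending polynomially on f. *)
Definition irreducible_monomial m : finType :=
  {s : normal_monomial deg 0 m | ~~ reduced deg c (monomial_of s)}.

(** In the expansion of p in all reducers, the reduced monomials contribute a normal form that
    belongs to the ideal, hence zero. *)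
Lemma ideal_reducers (f : system) m p : hypersurfaces (n := c.+1) d f ->
  has_normal_basis d f -> reducer_basis d c m f ->
  equation_ideal (n := c.+1) f p -> p \is m.-homog ->
  exists x : irreducible_monomial m -> k, p = \sum_s x s *: reducer d c f (monomial_of (val s)).
Proof.
move=> hf fb rb Ip hp; have [x pE] := reducer_span rb hf hp.
exists (fun s => x (val s)).
rewrite -(big_sub (fun s : normal_monomial deg 0 m => ~~ reduced deg c (monomial_of s))
  (fun s => x s *: reducer d c f (monomial_of s))).
pose r := \sum_(s : normal_monomial deg 0 m | reduced deg c (monomial_of s))
  x s *: reducer d c f (monomial_of s).
have pE' : p = r + \sum_(s : normal_monomial deg 0 m | ~~ reduced deg c (monomial_of s))
    x s *: reducer d c f (monomial_of s).
  by rewrite pE (bigID (fun s : normal_monomial deg 0 m => reduced deg c (monomial_of s))).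
suff r0 : r = 0 by rewrite {1}pE' r0 add0r.
apply: (normal_ideal0 fb).
  apply: (subspace_sum (normal_subspace k deg c)) => s rs.
  apply: (subspaceZ (normal_subspace k deg c)); rewrite /reducer.
  by case: violationP => [j _ _|_]; [rewrite rs | apply: normalX].
have -> : r = p - \sum_(s : normal_monomial deg 0 m | ~~ reduced deg c (monomial_of s))
    x s *: reducer d c f (monomial_of s) by rewrite pE' addrK.
apply: equation_idealB => //; apply: equation_ideal_sum => s rs.
apply: equation_idealZ; rewrite /reducer; case: violationP => [j _ _ _|rs']; last by rewrite rs' in rs.
by apply: equation_idealM; apply: equation_ideal_gen.
Qed.

Lemma sum_pair_delta (T S : finType) (x : T * S -> k) (F : T -> S -> R) s0 :
  \sum_ts x ts *: ((ts.1 == s0)%:R * F ts.1 ts.2) = \sum_s x (s0, s) *: F s0 s.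
Proof.
rewrite (eq_bigr (fun ts => x (ts.1, ts.2) *: ((ts.1 == s0)%:R * F ts.1 ts.2))); last by case.
rewrite -(pair_bigA _ (fun t s => x (t, s) *: ((t == s0)%:R * F t s))) /= (bigD1 s0) //=.
rewrite [X in _ + X]big1 ?addr0; last first.
  by move=> t /negbTE ne; rewrite big1 // => s _; rewrite ne mul0r scaler0.
by apply: eq_bigr => s _; rewrite eqxx mul1r.
Qed.

Variable f0 : system.
Hypothesis f0_hyp : hypersurfaces (n := c.+1) d f0.
Hypothesis f0_basis : near d f0 (has_normal_basis d).
Hypothesis f0_reducer : forall m, near d f0 (reducer_basis d c m).

Variables (q : nat) (t : 'rV[R]_q) (h : R) (tau e a : nat).
Hypothesis t_homog : forall j, t 0 j \is tau.-homog.
Hypothesis h_homog : h \is e.-homog.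
Hypothesis h_base : base_poly h.
Hypothesis h_kill : kill_x0 h != 0.
Hypothesis e_le : (e <= tau)%N.
Hypothesis f0_vanishing : forall v, homog_mx a v -> test_section f0 t h v -> zero_mod f0 v.

Local Notation normal_index := ('I_q * ('I_N * normal_monomial deg c a))%type.
Local Notation kernel_index := ('I_q * irreducible_monomial a.+1)%type.
Local Notation quotient_index := ('I_N * irreducible_monomial (a + tau))%type.
Local Notation multiple_index := ('I_N * normal_monomial deg c (a + tau - e))%type.
Local Notation index := (normal_index + (kernel_index + (quotient_index + multiple_index)))%type.

(** Its relations are the test sections in normal form. The four kinds of members stand for the
    coefficients of v, the ideal in degree a + 1, the ideal in degree a + tau, and the multiples of
    h; the positions are the q entries of v times the coordinates and the N entries of t v.
    Independence means that no nonzero test section exists, and it is an open condition. *)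
Definition vanishing_family (f : system) (s : index) (pos : 'I_q + 'I_N) : R :=
  match s, pos with
  | inl (j, (i, nu)), inl j' => (j == j')%:R * ('X_[monomial_of nu] * 'X_i)
  | inl (j, (i, nu)), inr i' => (i == i')%:R * (t 0 j * 'X_[monomial_of nu])
  | inr (inl (j, mu)), inl j' => (j == j')%:R * reducer d c f (monomial_of (val mu))
  | inr (inr (inl (i, mu))), inr i' => (i == i')%:R * reducer d c f (monomial_of (val mu))
  | inr (inr (inr (i, nu))), inr i' => (i == i')%:R * (h * 'X_[monomial_of nu])
  | _, _ => 0
  end.

Section Relation.

Variables (f : system) (x : index -> k).

Definition relation_matrix : 'M[R]_(q, N) :=
  \matrix_(j, i) \sum_nu x (inl (j, (i, nu))) *: 'X_[monomial_of nu].
Definition relation_kernel j : R :=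
  \sum_mu x (inr (inl (j, mu))) *: reducer d c f (monomial_of (val mu)).
Definition relation_quotient i : R :=
  \sum_mu x (inr (inr (inl (i, mu)))) *: reducer d c f (monomial_of (val mu)).
Definition relation_multiple i : R :=
  \sum_nu x (inr (inr (inr (i, nu)))) *: 'X_[monomial_of nu].

Lemma relation_inl j : \sum_s x s *: vanishing_family f s (inl j) =
  (relation_matrix *m coordinates k c) j 0 + relation_kernel j.
Proof.
rewrite big_sumType big_sumType big_sumType /=; congr (_ + _).
  rewrite (eq_bigr (fun ts => x (inl ts) *: ((ts.1 == j)%:R *
    ('X_[monomial_of ts.2.2] * 'X_ts.2.1)))); last by move=> [j' [i nu]].
  rewrite (sum_pair_delta (fun ts => x (inl ts)) (fun _ s => 'X_[monomial_of s.2] * 'X_s.1)).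
  rewrite mxE; under [RHS]eq_bigr => i _ do rewrite !mxE mulr_suml.
  rewrite pair_bigA; apply: eq_bigr => -[i nu] _ /=.
  by rewrite scalerAl.
rewrite [X in _ + (X + _)]big1; last by move=> [i mu] _; rewrite scaler0.
rewrite [X in _ + (_ + X)]big1 ?addr0; last by move=> [i nu] _; rewrite scaler0.
rewrite (eq_bigr (fun ts => x (inr (inl ts)) *: ((ts.1 == j)%:R *
  reducer d c f (monomial_of (val ts.2))))); last by move=> [j' mu].
by rewrite (sum_pair_delta (fun ts => x (inr (inl ts)))
  (fun _ s => reducer d c f (monomial_of (val s)))).
Qed.

Lemma relation_inr i : \sum_s x s *: vanishing_family f s (inr i) =
  (t *m relation_matrix) 0 i + (relation_quotient i + h * relation_multiple i).
Proof.
rewrite big_sumType big_sumType big_sumType /=; congr (_ + _).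
  rewrite (eq_bigr (fun ts => x (inl (ts.1, (ts.2.1, ts.2.2))) *: ((ts.2.1 == i)%:R *
    (t 0 ts.1 * 'X_[monomial_of ts.2.2])))); last by move=> [j' [i' nu]].
  rewrite -(pair_bigA _ (fun j s => x (inl (j, (s.1, s.2))) *: ((s.1 == i)%:R *
    (t 0 j * 'X_[monomial_of s.2])))) /= mxE.
  apply: eq_bigr => j _.
  rewrite (eq_bigr (fun ts => x (inl (j, ts)) *: ((ts.1 == i)%:R *
    (t 0 j * 'X_[monomial_of ts.2])))); last by move=> [i' nu].
  rewrite (sum_pair_delta (fun ts => x (inl (j, ts))) (fun _ s => t 0 j * 'X_[monomial_of s])).
  by rewrite mxE mulr_sumr; apply: eq_bigr => nu _; rewrite scalerAr.
rewrite big1 ?add0r; last by move=> [j mu] _; rewrite scaler0.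
congr (_ + _).
  rewrite (eq_bigr (fun ts => x (inr (inr (inl ts))) *: ((ts.1 == i)%:R *
    reducer d c f (monomial_of (val ts.2))))); last by move=> [j' mu].
  by rewrite (sum_pair_delta (fun ts => x (inr (inr (inl ts))))
    (fun _ s => reducer d c f (monomial_of (val s)))).
rewrite (eq_bigr (fun ts => x (inr (inr (inr ts))) *: ((ts.1 == i)%:R *
  (h * 'X_[monomial_of ts.2])))); last by move=> [j' nu].
rewrite (sum_pair_delta (fun ts => x (inr (inr (inr ts)))) (fun _ s => h * 'X_[monomial_of s])).
by rewrite mulr_sumr; apply: eq_bigr => nu _; rewrite scalerAr.
Qed.

End Relation.

Lemma normal_sum_eq0 m (x : normal_monomial deg c m -> k) :
  \sum_nu x nu *: 'X_[monomial_of nu] = 0 :> R -> forall nu, x nu = 0.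
Proof.
move=> E nu; have := congr1 (mcoeff (monomial_of nu)) E.
rewrite mcoeff0 raddf_sum /= (bigD1 nu) //= mcoeffZ mcoeffX eqxx mulr1 big1 ?addr0 //.
by move=> nu' ne; rewrite mcoeffZ mcoeffX (inj_eq (@monomial_of_inj _ _ _ _)) (negbTE ne) mulr0.
Qed.

Lemma normal_sum_normal m (x : normal_monomial deg c m -> k) :
  normal deg c (\sum_nu x nu *: 'X_[monomial_of nu]).
Proof.
apply: (subspace_lincomb (normal_subspace k deg c)) => nu.
by apply: normalX; apply: monomial_of_reduced.
Qed.

Lemma reducer_in_ideal (f : system) m (mu : irreducible_monomial m) :
  equation_ideal (n := c.+1) f (reducer d c f (monomial_of (val mu))).
Proof.
rewrite /reducer; case: violationP => [j _ _ _|rs]; last by have := valP mu; rewrite rs.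
by apply: equation_idealM; apply: equation_ideal_gen.
Qed.

Lemma reducer_sum_eq0 (f : system) m (x : irreducible_monomial m -> k) :
  reducer_basis d c m f ->
  \sum_mu x mu *: reducer d c f (monomial_of (val mu)) = 0 -> forall mu, x mu = 0.
Proof.
move=> rb E mu.
pose y (s : normal_monomial deg 0 m) := if insub s is Some s' then x s' else 0.
have : y (val mu) = 0; last by rewrite /y valK.
apply: rb => _; rewrite (bigID (fun s : normal_monomial deg 0 m => ~~ reduced deg c (monomial_of s))) /=.
rewrite [X in _ + X]big1 ?addr0; last first.
  by move=> s /negbTE rs; rewrite /y insubF ?scale0r.
rewrite (big_sub (fun s : normal_monomial deg 0 m => ~~ reduced deg c (monomial_of s))
  (fun s => y s *: reducer d c f (monomial_of s))) -[RHS]E.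
by apply: eq_bigr => s _; rewrite /y valK.
Qed.

Lemma f0_family_independent x :
  (forall pos, \sum_s x s *: vanishing_family f0 s pos = 0) -> forall s, x s = 0.
Proof.
move=> E; have fb := near_self f0_hyp f0_basis.
have rb m := near_self f0_hyp (f0_reducer m).
have El j := E (inl j); have Er i := E (inr i).
have IK j : equation_ideal (n := c.+1) f0 (relation_kernel f0 x j).
  by apply: equation_ideal_sum => mu _; apply: equation_idealZ; apply: reducer_in_ideal.
have IQ i : equation_ideal (n := c.+1) f0 (relation_quotient f0 x i).
  by apply: equation_ideal_sum => mu _; apply: equation_idealZ; apply: reducer_in_ideal.
have V : zero_mod f0 (relation_matrix x).
  apply: f0_vanishing.
    move=> j i; rewrite mxE; apply: rpred_sum => nu _; apply: rpredZ.
    by apply: dhomog_monomial; apply: monomial_of_mdeg.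
  split.
    move=> j i; rewrite [i]ord1; have := El j; rewrite relation_inl => /eqP.
    by rewrite addr_eq0 => /eqP->; apply: equation_idealN.
  exists (\row_i (- relation_multiple x i)) => j i; rewrite [j]ord1 !mxE.
  have := Er i; rewrite relation_inr => /eqP; rewrite addr_eq0 mxE => /eqP->.
  by rewrite opprD mulrN opprK subrK; apply: equation_idealN.
have V0 j i nu : x (inl (j, (i, nu))) = 0.
  apply: (normal_sum_eq0 (x := fun nu => x (inl (j, (i, nu))))).
  apply: (normal_ideal0 fb); first exact: normal_sum_normal.
  by have := V j i; rewrite mxE.
have VM : relation_matrix x = 0.
  by apply/matrixP => j i; rewrite !mxE big1 // => nu _; rewrite V0 scale0r.
have K0 j mu : x (inr (inl (j, mu))) = 0.
  apply: (reducer_sum_eq0 (f := f0) (x := fun mu => x (inr (inl (j, mu))))) => //.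
  by have := El j; rewrite relation_inl VM mul0mx mxE add0r.
have H0 i : relation_quotient f0 x i + h * relation_multiple x i = 0.
  by have := Er i; rewrite relation_inr VM mulmx0 mxE add0r.
have M0 i : relation_multiple x i = 0.
  apply: (normal_ideal0 fb); first exact: normal_sum_normal.
  apply: (base_poly_regular fb h_base (h_neq0 h_kill)).
  by have /eqP := H0 i; rewrite addrC addr_eq0 => /eqP->; apply: equation_idealN.
case=> [[j [i nu]]|[[j mu]|[[i mu]|[i nu]]]] //.
- apply: (reducer_sum_eq0 (f := f0) (x := fun mu => x (inr (inr (inl (i, mu)))))) => //.
  by have := H0 i; rewrite M0 mulr0 addr0.
exact: (normal_sum_eq0 (x := fun nu => x (inr (inr (inr (i, nu))))) (M0 i) nu).
Qed.

(** For f near [f0], the normal form of a test section and the expansions of its two conditions in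
    reducers give a relation of the family, whose coefficients then vanish. *)
Lemma near_no_test_section : near d f0 (fun f =>
  forall v, homog_mx a v -> test_section f t h v -> zero_mod f v).
Proof.
have ni : near d f0 (fun f => forall x : index -> k,
    (forall pos, \sum_s x s *: vanishing_family f s pos = 0) -> forall s, x s = 0).
  apply: near_independent => //; last exact: f0_family_independent.
  have cst (p : R) mu : regular_function d (fun _ : system => p@_mu) by apply: regular_cst.
  have red (b : bool) m mu : regular_function d (fun f : system => (b%:R * reducer d c f m)@_mu).
    case: b; last by exists 0 => f _; rewrite mul0r mcoeff0 meval0.
    rewrite /reducer; case: violationP => [j _ _ _|_]; last first.
      by have [p Hp] := cst 'X_[m] mu; exists p => f hf; rewrite mul1r -Hp.
    have [p Hp] := regular_coef k d j (mu - (m - U_(fibre_var j) *+ deg j))%MM.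
    case: (boolP (m - U_(fibre_var j) *+ deg j <= mu)%MM) => le.
      by exists p => f hf; rewrite mul1r mcoeff_monomialM le; apply: Hp.
    by exists 0 => f hf; rewrite mul1r mcoeff_monomialM (negbTE le) meval0.
  case=> [[j [i nu]]|[[j mu]|[[i mu]|[i nu]]]] [j'|i'] m /=;
    by [apply: cst | apply: red].
apply: near_impl (near_and ni (near_and f0_basis
  (near_and (f0_reducer a.+1) (f0_reducer (a + tau))))) => f hf [iF [fb [rb1 rb2]]] v hv [Zv [w Zw]].
have H ji : exists b, [/\ normal deg c b, b \is (a).-homog &
    equation_ideal (n := c.+1) f (v ji.1 ji.2 - b)].
  by apply: normal_form_homog => //; apply: hv.
have [b Hb] := choice H.
pose v' : 'M[R]_(q, N) := \matrix_(j, i) b (j, i).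
have Zvv : zero_mod f (v - v') by move=> j i; rewrite !mxE; have [_ _] := Hb (j, i).
have hv' : homog_mx a v' by move=> j i; rewrite mxE; have [_] := Hb (j, i).
have [Zv' [w' Zw']] : test_section f t h v'.
  apply: (@test_section_congr _ _ f _ t h v); first by split=> //; exists w.
  by have := zero_modZ (-1) Zvv; rewrite scaleN1r opprB.
have HK j : exists x : irreducible_monomial a.+1 -> k,
    (v' *m coordinates k c) j 0 = \sum_s x s *: reducer d c f (monomial_of (val s)).
  apply: (ideal_reducers hf fb rb1 (Zv' j 0)).
  rewrite mxE; apply: rpred_sum => i _; have hX : ('X_i : R) \is 1.-homog.
    by apply: dhomog_monomial; rewrite mdeg1.
  by have := dhomogM (hv' j i) hX; rewrite addn1 [coordinates k c i 0]mxE.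
have htv i : (t *m v') 0 i \is (a + tau)%N.-homog.
  by rewrite mxE addnC; apply: rpred_sum => j _; apply: dhomogM.
have HU i : exists u, [/\ normal deg c u, u \is (a + tau - e)%N.-homog &
    equation_ideal (n := c.+1) f ((t *m v') 0 i - h * u)].
  pose w1 := pihomog mdeg (a + tau - e) (w' 0 i).
  have Iw1 : equation_ideal (n := c.+1) f ((t *m v') 0 i - h * w1).
    have E : (t *m v' - h *: w') 0 i = (t *m v') 0 i - h * w' 0 i by rewrite !mxE.
    have := equation_ideal_pihomog hf (a + tau) (Zw' 0 i).
    rewrite E linearB /= (pihomog_dE (htv i)) mulrC (pihomog_mul _ _ h_homog).
    by rewrite (leq_trans e_le (leq_addl _ _)) mulrC.
  have [u [nu hu Iu]] := normal_form_homog hf fb (pihomogP mdeg (a + tau - e) (w' 0 i)).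
  exists u; split=> //; apply: equation_ideal_congr Iw1 _.
  by rewrite -mulrBr; apply: equation_idealM.
have [u Hu] := choice HU.
have HQ i : exists x : irreducible_monomial (a + tau) -> k,
    (t *m v') 0 i - h * u i = \sum_s x s *: reducer d c f (monomial_of (val s)).
  have [_ hu Iu] := Hu i; apply: ideal_reducers => //.
  have le : (e <= a + tau)%N := leq_trans e_le (leq_addl _ _).
  have hhu : h * u i \is (a + tau).-homog by rewrite -(subnKC le); apply: dhomogM h_homog hu.
  exact: rpredB (htv i) hhu.
have [xK HxK] := choice HK; have [xQ HxQ] := choice HQ.
pose x (s : index) : k := match s with
  | inl (j, (i, nu)) => (v' j i)@_(monomial_of nu)
  | inr (inl (j, mu)) => - xK j mu
  | inr (inr (inl (i, mu))) => - xQ i mu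
  | inr (inr (inr (i, nu))) => - (u i)@_(monomial_of nu)
  end.
have xM : relation_matrix x = v'.
  apply/matrixP => j i; rewrite !mxE; have [nb hb _] := Hb (j, i).
  rewrite [RHS](normal_homog_sum nb hb); apply: eq_bigr => nu _.
  by rewrite /x mxE.
have x0 : forall s, x s = 0.
  apply: iF => -[j|i].
    rewrite relation_inl xM HxK -big_split big1 // => mu _ /=.
    by rewrite scaleNr subrr.
  rewrite relation_inr xM.
  have -> : relation_multiple x i = - u i.
    have [nu' hu _] := Hu i; rewrite [X in _ = - X](normal_homog_sum nu' hu) -sumrN.
    by apply: eq_bigr => nu _; rewrite /x scaleNr.
  have -> : relation_quotient f x i = - ((t *m v') 0 i - h * u i).
    by rewrite HxQ -sumrN; apply: eq_bigr => mu _; rewrite /x scaleNr.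
  ring.
have v0 : v' = 0.
  by rewrite -xM; apply/matrixP => j i; rewrite !mxE big1 // => nu _; rewrite x0 scale0r.
by move: Zvv; rewrite v0 subr0.
Qed.

End GenericVanishing.

(** * Ranking the lines *)

(* The product type, with the finite and the additive structure joined. *)
Definition fin_prod (A B : Type) := (A * B)%type.

HB.instance Definition _ (A B : finZmodType) := GRing.Zmodule.on (fin_prod A B).
HB.instance Definition _ (A B : finZmodType) := Finite.on (fin_prod A B).

Section Cycle.

(* The lines of a degenerate complete intersection curve: H indexes the lines of a cycle
   spanning a hyperplane, and each of the r hyperplanes contains a copy of this cycle. *)
Variables (H : finZmodType) (b r' : nat) (coH : H -> 'I_b -> nat).
Local Notation r := r'.+2.

Hypothesis coH_inj : forall h h', coH h =1 coH h' -> h = h'.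
Hypothesis coH_shift : forall h h' s i, (coH (h + s) i == coH (h' + s) i) = (coH h i == coH h' i).
Hypothesis cycle : forall h, (\sum_h' (adjacent coH h h') = 2)%N.
(* Removing a line m from the cycle leaves a path having edges in all directions. *)
Hypothesis path_connected : forall (m : H) (Y : H -> Prop) h0, h0 != m -> Y h0 ->
  (forall h h', h != m -> h' != m -> adjacent coH h h' -> Y h' -> Y h) ->
  forall h, h != m -> Y h.
Hypothesis path_directions : forall (m : H) i, exists h h',
  [/\ h != m, h' != m, adjacent coH h h' & coH h i <> coH h' i].
Variables h0 h1 h2 : H.
Hypothesis h_distinct : [/\ h0 != h1, h0 != h2 & h1 != h2].

Definition line_index := fin_prod H 'I_r.
HB.instance Definition _ := FinRing.Zmodule.on line_index.

Definition line_coord (g : line_index) (i : 'I_b.+1) : nat :=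
  if unlift ord_max i is Some i' then coH g.1 i' else g.2.

(* This line of the j-th copy of the cycle is treated together with the preceding copy. *)
Definition missing (j : 'I_r) : H :=
  if j == ord_max then h2 else if odd j then h1 else h0.

(** The subtraction is in Z/r, so the copies are arranged cyclically. The line moved from copy j
    hangs on chain j - 1 through its node with the corresponding line of copy j - 1, and this node
    supplies the direction of the last coordinate. *)
Definition chain (g : line_index) : 'I_r := if g.1 == missing g.2 then g.2 - 1 else g.2.
Definition chain_rank (g : line_index) : nat := chain g.

Lemma line_coord_last g : line_coord g ord_max = g.2.
Proof. by rewrite /line_coord unlift_none. Qed.

Lemma line_coord_lift g i : line_coord g (lift ord_max i) = coH g.1 i.
Proof. by rewrite /line_coord liftK. Qed.

Lemma line_coord_inj g g' : line_coord g =1 line_coord g' -> g = g'.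
Proof.
case: g g' => [h j] [h' j'] E; congr (_, _).
  by apply: coH_inj => i; have := E (lift ord_max i); rewrite !line_coord_lift.
by apply: val_inj; have := E ord_max; rewrite !line_coord_last.
Qed.

Lemma line_coord_shift g g' s i :
  (line_coord (g + s) i == line_coord (g' + s) i) = (line_coord g i == line_coord g' i).
Proof.
case: (unliftP ord_max i) => [i' ->|->]; rewrite ?line_coord_lift ?line_coord_last.
  exact: coH_shift.
by rewrite !(inj_eq val_inj) (inj_eq (addIr s.2)).
Qed.

Lemma adjacentE (g g' : line_index) : adjacent line_coord g g' =
  (adjacent coH g.1 g'.1 && (g.2 == g'.2)) || ((g.1 == g'.1) && (g.2 != g'.2)).
Proof.
apply/adjacentP/idP => [[i]|].
  case: (unliftP ord_max i) => [i' ->|->]; rewrite ?line_coord_lift ?line_coord_last => ne E.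
    apply/orP; left; apply/andP; split.
      apply/adjacentP; exists i' => // i2 ne2; have := E (lift ord_max i2).
      by rewrite !line_coord_lift; apply; rewrite (inj_eq lift_inj).
    by have := E ord_max (neq_lift _ _); rewrite !line_coord_last => /val_inj->.
  apply/orP; right; apply/andP; split; last by apply/eqP => E'; apply: ne; rewrite E'.
  apply/eqP/coH_inj => i'; have := E (lift ord_max i'); rewrite !line_coord_lift; apply.
  by rewrite eq_sym neq_lift.
case/orP => [/andP[/adjacentP[i ne E] /eqP Ej]|/andP[/eqP Eh ne]].
  exists (lift ord_max i); first by rewrite !line_coord_lift.
  move=> i2; case: (unliftP ord_max i2) => [i' ->|->]; rewrite ?line_coord_lift ?line_coord_last.
    by rewrite (inj_eq lift_inj) => /E.
  by rewrite Ej.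
exists ord_max; first by rewrite !line_coord_last => /val_inj E; rewrite E eqxx in ne.
by move=> i2; case: (unliftP ord_max i2) => [i' ->|->]; rewrite ?eqxx // !line_coord_lift Eh.
Qed.

Lemma ordS_neq (j : 'I_r) : j + 1 != j.
Proof. by rewrite -subr_eq0 addrAC subrr add0r oner_eq0. Qed.

Lemma ord_pred_neq (j : 'I_r) : j - 1 != j.
Proof. by rewrite eq_sym -subr_eq0 opprB addrC subrK oner_eq0. Qed.

(** Alternating [h0] and [h1] would repeat a value where the cycle of copies closes, if r is odd;
    the last copy therefore uses [h2]. The values have to differ so that the line to which
    [missing (j + 1)] is attached stays in chain j. *)
Lemma missing_succ (j : 'I_r) : missing (j + 1) != missing j.
Proof.
have [n01 n02 n12] := h_distinct.
have vS : nat_of_ord (j + 1) = (j.+1 %% r)%N by rewrite /= [(1 %% r)%N]modn_small // addn1.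
have E1 : (j + 1 == ord_max) = (j.+1 %% r == r'.+1)%N.
  by rewrite -(inj_eq val_inj) [X in X == _]vS.
have E2 : (j == ord_max) = (nat_of_ord j == r'.+1) by rewrite -(inj_eq val_inj).
rewrite /missing vS E1 E2; have jr := ltn_ord j; have [E|ne] := eqVneq (nat_of_ord j) r'.+1.
  by rewrite E modnn n02.
rewrite modn_small; last by move/eqP: ne; lia.
case: (j.+1 == r'.+1); first by case: (odd j); rewrite eq_sym.
by rewrite /=; case: (odd j) => //=; rewrite eq_sym.
Qed.

Lemma chain_regular h j : h != missing j -> chain (h, j) = j.
Proof. by rewrite /chain /= => /negbTE->. Qed.

Lemma chain_missing j : chain (missing j, j) = j - 1.
Proof. by rewrite /chain eqxx. Qed.

(** Chain j is the path left in copy j, whose edges show all directions of H, with one line of copy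
    j + 1 attached by an edge in the last direction. *)
Lemma chain_good : good_rank line_coord chain_rank.
Proof.
move=> X H1 H2.
have rkE g g' : chain g = chain g' -> chain_rank g = chain_rank g' by rewrite /chain_rank => ->.
have hor (j : 'I_r) h h' : adjacent coH h h' -> adjacent line_coord (h, j) (h', j).
  by rewrite adjacentE /= => ->; rewrite eqxx.
have column (j : 'I_r) (i : 'I_b.+1) h' : h' != missing j -> X i (h', j) ->
    forall h, h != missing j -> X i (h, j).
  move=> ne' Xh'; apply: (path_connected ne' Xh') => h h2' ne ne2 ad X2.
  by apply: (H2 _ (h2', j)) => //; [apply: hor | apply: rkE; rewrite !chain_regular].
have vert (j : 'I_r) : adjacent line_coord (missing (j + 1), j) (missing (j + 1), j + 1).
  by rewrite adjacentE /= eqxx eq_sym ordS_neq orbT.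
have vert_rk (j : 'I_r) : chain (missing (j + 1), j) = chain (missing (j + 1), j + 1).
  by rewrite chain_missing chain_regular ?missing_succ // addrK.
have regular (j : 'I_r) i h : h != missing j -> X i (h, j).
  case: (unliftP ord_max i) => [i' ->|->] neh.
    have [g [g' [ng ng' ad ne]]] := path_directions (missing j) i'.
    apply: (column j _ g) => //; apply: (H1 _ (g', j)).
    - exact: hor.
    - by apply: rkE; rewrite !chain_regular.
    by rewrite !line_coord_lift.
  apply: (column j _ (missing (j + 1))) => //; first exact: missing_succ.
  apply: (H1 _ (missing (j + 1), j + 1)); [exact: vert | exact/rkE/vert_rk |].
  rewrite !line_coord_last => /val_inj E; have /eqP : j + 1 = j := esym E.
  by rewrite (negbTE (ordS_neq j)).
move=> i [h j]; have [->|ne] := eqVneq h (missing j); last exact: regular.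
rewrite -[j](subrK 1); apply: (H2 _ (missing (j - 1 + 1), j - 1)).
- by rewrite adjacent_sym; apply: vert.
- by apply/esym/rkE/vert_rk.
by apply: regular; apply: missing_succ.
Qed.

Lemma sum_bool_eq (T : finType) (s0 : T) (F : T -> nat) : (\sum_s (s == s0) * F s = F s0)%N.
Proof.
rewrite (bigD1 s0) //= eqxx mul1n big1 ?addn0 // => s /negbTE->.
by rewrite mul0n.
Qed.

(** A line meets two lines of its own cycle and one line in each of the r - 1 other copies. *)
Lemma sum_adjacent (g : line_index) :
  (\sum_g' (adjacent line_coord g g') = r.+1)%N.
Proof.
case: g => h j.
rewrite (eq_bigr (fun g' : H * 'I_r => (adjacent coH h g'.1) * (g'.2 == j) + (g'.1 == h) * (g'.2 != j)))%N.
  rewrite -(pair_bigA _ (fun h' j' => (adjacent coH h h') * (j' == j) + (h' == h) * (j' != j)))%N /=.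
  under eq_bigr => h' _ do rewrite big_split -!big_distrr /=.
  rewrite big_split /= -big_distrl /= cycle.
  rewrite (sum_bool_eq h (fun=> \sum_j' (j' != j)))%N.
  have -> : (\sum_(j' < r) (j' == j) = 1)%N.
    by have := sum_bool_eq j (fun=> 1%N); under eq_bigr => j' _ do rewrite muln1.
  have : (\sum_(j' < r) ((j' == j) + (j' != j)) = r)%N.
    by under eq_bigr => j' _ do (have -> : ((j' == j) + (j' != j) = 1)%N by case: eqP); rewrite sum1_card card_ord.
  rewrite big_split /=; have -> : (\sum_(j' < r) (j' == j) = 1)%N.
    by have := sum_bool_eq j (fun=> 1%N); under eq_bigr => j' _ do rewrite muln1.
  by move=> E; rewrite muln1 -[RHS](congr1 S E).
move=> [h' j'] _; rewrite adjacentE /= [h' == h]eq_sym [j' == j]eq_sym.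
have [<-|_] := eqVneq h h'; have [_|_] := eqVneq j j'; rewrite ?andbT ?andbF ?orbF ?muln1 ?muln0 ?addn0 ?mul1n //=.
all: try by case: adjacent.
Qed.

Lemma card_laterE g : #|later line_coord chain_rank g| =
  (\sum_g' (adjacent line_coord g g' && (chain_rank g < chain_rank g')))%N.
Proof. by rewrite -sum1_card big_mkcond; apply: eq_bigr => g' _; rewrite inE /=; case: (adjacent _ _ _ && _). Qed.

(** Of two adjacent lines of different ranks exactly one is later than the other, so twice the sum
    counts the ordered pairs of this kind; the right-hand side counts all ordered pairs of adjacent
    lines. *)
Lemma sum_later : (2 * \sum_g #|later line_coord chain_rank g| +
  \sum_g \sum_g' (adjacent line_coord g g' && (chain_rank g == chain_rank g')) =
  #|H| * r * r.+1)%N.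
Proof.
rewrite (_ : (#|H| * r * r.+1 = \sum_(g : line_index) r.+1)%N); last first.
  by rewrite sum_nat_const card_prod card_ord.
rewrite -[RHS](eq_bigr _ (fun g _ => sum_adjacent g)) mul2n -addnn.
rewrite {2}(eq_bigr _ (fun g _ => card_laterE g)) exchange_big /=.
rewrite -!big_split /=; apply: eq_bigr => g _; rewrite card_laterE -!big_split /=.
apply: eq_bigr => g' _; rewrite [adjacent _ g' g]adjacent_sym.
by case: adjacent => //=; case: ltngtP.
Qed.

(** The 4 counts the two edges at m, each in both orders. *)
Lemma sum_path (m : H) :
  (\sum_h \sum_h' [&& adjacent coH h h', h != m & h' != m] + 4 = 2 * #|H|)%N.
Proof.
have tot : (\sum_h \sum_h' (adjacent coH h h') = 2 * #|H|)%N.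
  by rewrite (eq_bigr _ (fun h _ => cycle h)) sum_nat_const mulnC.
rewrite -tot; have -> : 4%N = (\sum_h \sum_h' (h == m) * (adjacent coH h h') +
    \sum_h \sum_h' (h' == m) * (adjacent coH h h'))%N.
  rewrite [X in (_ + X)%N]exchange_big /=.
  under eq_bigr => h _ do rewrite -big_distrr /= cycle.
  under [X in (_ + X)%N]eq_bigr => h' _ do rewrite -big_distrr /=.
  rewrite (sum_bool_eq m (fun=> 2)) (sum_bool_eq m (fun h' => \sum_h adjacent coH h h')%N).
  by under eq_bigr => h _ do rewrite adjacent_sym; rewrite cycle.
rewrite -!big_split /=; apply: eq_bigr => h _; rewrite -!big_split /=.
apply: eq_bigr => h' _; have [->|_] := eqVneq h m; have [->|_] := eqVneq h' m.
- have -> : adjacent coH m m = false by apply/negbTE/negP => /adjacentP[i].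
  by [].
all: by case: adjacent.
Qed.

Lemma sum_line_index (F : line_index -> nat) :
  (\sum_g F g = \sum_(h : H) \sum_(j < r) F (h, j))%N.
Proof. by rewrite pair_bigA /=; apply: eq_bigr => -[]. Qed.

(** Chains are trees with #|H| lines: #|H| - 2 edges of the path and one edge to the attached line,
    each counted in both orders. *)
Lemma sum_same_chain :
  (\sum_g \sum_g' (adjacent line_coord g g' && (chain_rank g == chain_rank g')) + 2 * r
   <= 2 * r * #|H|)%N.
Proof.
(* Neighbours of (h, j) in its chain: those in the path of copy j, then (h, j - 1) if h is missing
   from copy j, and (h, j + 1) if h is missing from copy j + 1. *)
have le (h : H) (j : 'I_r) :
    (\sum_g' (adjacent line_coord (h, j) g' && (chain_rank (h, j) == chain_rank g')) <=
     \sum_h' [&& adjacent coH h h', h != missing j & h' != missing j] +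
     ((h == missing j) + (h == missing (j + 1)%R)))%N.
  apply: (@leq_trans (\sum_(h' : H) \sum_(j' < r)
    ((j' == j) * [&& adjacent coH h h', h != missing j & h' != missing j] +
     (h' == h) * ((j' == (j - 1)%R) * (h == missing j) + (j' == (j + 1)%R) * (h == missing (j + 1)%R))))%N).
    rewrite sum_line_index.
    apply: leq_sum => h' _; apply: leq_sum => j' _.
    rewrite adjacentE /chain_rank (inj_eq val_inj) /chain /=.
    have [<-|nj] := eqVneq j j'.
      rewrite andbF orbF andbT mul1n; case ad: (adjacent coH h h') => //=.
      have [Eh|nh] := eqVneq h (missing j); have [Eh'|nh'] := eqVneq h' (missing j) => //=.
      + move: ad; rewrite Eh Eh' => /adjacentP[i]; by [].
      + by rewrite (negbTE (ord_pred_neq j)).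
      + by rewrite eq_sym (negbTE (ord_pred_neq j)).
      by rewrite eqxx.
    rewrite andbF andbT /=; have [<-|//] := eqVneq h h'; rewrite mul0n add0n mul1n /=.
    have [Eh|nh] := eqVneq h (missing j); have [Eh'|nh'] := eqVneq h (missing j').
    + rewrite (inj_eq (addIr (- (1 : 'I_r)))) (negbTE nj) //.
    + by rewrite [j' == _]eq_sym muln1; case: eqP => // _; rewrite addSn.
    + case: eqP => // Ej; have Ej' : j' = (j + 1)%R by rewrite Ej subrK.
      by rewrite -Ej' -Eh' !eqxx muln0.
    by rewrite (negbTE nj).
  have one (j0 : 'I_r) : (\sum_(j' < r) (j' == j0) = 1)%N.
    by have := sum_bool_eq j0 (fun=> 1%N); under eq_bigr => j' _ do rewrite muln1.
  rewrite [leqLHS](eq_bigr (fun h' => [&& adjacent coH h h', h != missing j & h' != missing j] +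
     (h' == h) * ((h == missing j) + (h == missing (j + 1)%R))))%N.
    by rewrite big_split /= (sum_bool_eq h (fun=> _)).
  by move=> h' _; rewrite big_split -big_distrl -big_distrr /= big_split -!big_distrl /= !one !mul1n.
rewrite sum_line_index exchange_big /=.
have col (j : 'I_r) : (\sum_h \sum_g' (adjacent line_coord (h, j) g' &&
   (chain_rank (h, j) == chain_rank g')) + 2 <= 2 * #|H|)%N.
  rewrite -(sum_path (missing j)) (_ : 4%N = 2 + 2)%N // addnA leq_add2r.
  apply: leq_trans (leq_sum _ (fun h _ => le h j)) _.
  rewrite big_split big_split /= leq_add2l.
  have one (m : H) : (\sum_h (h == m) = 1)%N.
    by have := sum_bool_eq m (fun=> 1%N); under eq_bigr => h _ do rewrite muln1.
  by rewrite !one.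
have -> : (2 * r * #|H| = \sum_(j < r) 2 * #|H|)%N by rewrite sum_nat_const card_ord mulnCA mulnA.
have -> : (2 * r = \sum_(j < r) 2)%N by rewrite sum_nat_const card_ord mulnC.
by rewrite -big_split /=; apply: leq_sum => j _; apply: col.
Qed.

End Cycle.

(** * Hilbert polynomials *)

Section Reindexing.

Variables (K : fieldType) (V : lmodType K) (Z : V -> Prop) (S T : finType).
Variables (h : S -> T) (h_bij : bijective h) (b : T -> V).

Lemma independent_reindex : independent Z b -> independent Z (fun s => b (h s)).
Proof.
case: h_bij => g hK gK ib x Zx s; rewrite -(hK s); apply: (ib (fun t => x (g t))).
rewrite (reindex h) /=; last exact: onW_bij.
by under eq_bigr => t _ do rewrite hK.
Qed.

Lemma spanned_reindex v : spanned Z b v -> spanned Z (fun s => b (h s)) v.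
Proof.
move=> [x Zx]; exists (fun s => x (h s)).
by move: Zx; rewrite (reindex h) //=; apply: onW_bij.
Qed.

End Reindexing.

(** * Hilbert functions of free sheaves and of the kernel bundle *)

Section GradedDimensions.

Variables (k : fieldType) (c : nat) (d : c.-tuple nat).
Local Notation R := {mpoly k[c.+2]}.
Local Notation N := c.+2.
Local Notation deg := (tnth d).
Variable f : 'I_c -> R.
Hypothesis f_hyp : hypersurfaces d f.
Hypothesis f_basis : has_normal_basis d f.
Local Notation I := (equation_ideal (n := c.+1) f).
Local Notation zmod p := (@zero_mod k c f 1 p : kmatrix k N 1 p -> Prop).
Local Notation nmon := (normal_monomial deg c).

Lemma normal_monomials_independent m :
  independent I (fun t : nmon m => 'X_[monomial_of t] : R).
Proof.
move=> x Ix t; have /eqP : \sum_t x t *: ('X_[monomial_of t] : R) = 0.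
  apply: (normal_ideal0 f_basis) => //; apply: (subspace_lincomb (normal_subspace k deg c)) => t'.
  by apply: normalX; apply: monomial_of_reduced.
move/eqP/(congr1 (mcoeff (monomial_of t))); rewrite mcoeff0 raddf_sum /= (bigD1 t) //=.
rewrite mcoeffZ mcoeffX eqxx mulr1 big1 ?addr0 // => t' tt'.
by rewrite mcoeffZ mcoeffX (inj_eq (@monomial_of_inj _ _ _ _)) (negbTE tt') mulr0.
Qed.

Lemma normal_monomials_span m (p : R) : p \is m.-homog ->
  spanned I (fun t : nmon m => 'X_[monomial_of t] : R) p.
Proof.
move=> /(normal_form_homog f_hyp f_basis)[b [nb hb Ib]].
by exists (fun t => b@_(monomial_of t)); rewrite -normal_homog_sum.
Qed.

Section FreeSheaf.
Variables p m : nat.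

Definition free_basis (it : 'I_p * nmon m) : kmatrix k N 1 p :=
  ('X_[monomial_of it.2] : R) *: (delta_mx 0 it.1 : 'rV[R]_p).

Lemma free_basisE (x : 'I_p * nmon m -> k) j :
  (\sum_it x it *: free_basis it) 0 j = \sum_t x (j, t) *: 'X_[monomial_of t].
Proof.
rewrite (summxE _ _ _ 0 j) (_ : \sum_it _ = \sum_i \sum_t (x (i, t) *: free_basis (i, t)) 0 j).
rewrite (bigD1 j) //= [X in _ + X]big1 ?addr0.
  by apply: eq_bigr => t _; rewrite kmatrix_mxE !mxE !eqxx mulr1.
move=> i ij; apply: big1 => t _.
by rewrite kmatrix_mxE !mxE eq_sym (negbTE ij) andbF mulr0 scaler0.
all: by rewrite pair_bigA; apply: eq_bigr => -[].
Qed.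

Lemma free_basis_independent : independent (zmod p) free_basis.
Proof.
move=> x Zx [j t]; have := Zx 0 j; rewrite free_basisE.
by move/normal_monomials_independent; apply.
Qed.

Lemma free_basis_homog it j : free_basis it 0 j \is m.-homog.
Proof.
rewrite !mxE; case: (_ && _); rewrite ?mulr1 ?mulr0 ?dhomog0 //.
by apply: dhomog_monomial; apply: monomial_of_mdeg.
Qed.

Lemma free_basis_span (v : 'rV[R]_p) : (forall j, v 0 j \is m.-homog) ->
  spanned (zmod p) free_basis v.
Proof.
move=> hv; have [x Hx] := choice (fun j => normal_monomials_span (hv j)).
exists (fun it => x it.1 it.2) => i j; rewrite [i]ord1 mxE [X in _ + X]mxE free_basisE.
exact: Hx.
Qed.

Lemma free_sheaf_dim : graded_dim (n := c.+1) f (@free_sheaf k c.+1 p) m (p * #|nmon m|).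
Proof.
apply/graded_dimP.
have E : #|{: 'I_p * nmon m}| = (p * #|nmon m|)%N by rewrite card_prod card_ord.
pose h i := enum_val (cast_ord (esym E) i).
have hbij : bijective h.
  by exists (fun it => cast_ord E (enum_rank it)) => i; rewrite /h ?enum_valK ?cast_ordKV ?cast_ordK ?enum_rankK.
exists (fun i => free_basis (h i)); split.
- by move=> i; split=> // j; apply: free_basis_homog.
- exact: (independent_reindex hbij free_basis_independent).
by move=> v [_ hv]; apply: (spanned_reindex hbij); apply: free_basis_span.
Qed.

End FreeSheaf.

Lemma graded_dim_le p (A : set 'rV[R]_p) m D :
  graded_dim (n := c.+1) f A m D -> (D <= p * #|nmon m|)%N.
Proof.
move=> /graded_dimP[b [Ab ib _]].
rewrite -[D]card_ord -[p in (p * _)%N]card_ord -card_prod.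
apply: (independent_card (b' := @free_basis p m) (zero_mod_subspace f 1 p) ib) => i.
by apply: free_basis_span => j; case: (Ab i).
Qed.

Lemma graded_dim_unique p (A : set 'rV[R]_p) m D D' :
  graded_dim (n := c.+1) f A m D -> graded_dim (n := c.+1) f A m D' -> D = D'.
Proof.
move=> /graded_dimP[b [Ab ib sb]] /graded_dimP[b' [Ab' ib' sb']].
apply/eqP; rewrite eqn_leq -[D]card_ord -[D']card_ord.
have sZ := zero_mod_subspace f 1 p.
apply/andP; split.
  by apply: (independent_card sZ ib) => i; apply: sb'.
by apply: (independent_card sZ ib') => i; apply: sb.
Qed.

Lemma graded_dim_bounds p (A : set 'rV[R]_p) m D :
  bounded_dim (zmod p) (graded_part (n := c.+1) A m) D ->
  (exists b : 'I_D -> kmatrix k N 1 p,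
     independent (zmod p) b /\ forall i, graded_part (n := c.+1) A m (b i)) ->
  graded_dim (n := c.+1) f A m D.
Proof.
have sZ := zero_mod_subspace f 1 p.
move=> bD [b [ib Ab]]; have [s [b' [sD Ab' ib' sb']]] := spanning_family sZ bD.
have E : s = D.
  apply/eqP; rewrite eqn_leq sD -[s]card_ord -[D]card_ord.
  by apply: (independent_card sZ ib) => i; apply: sb'.
by move: b' Ab' ib' sb'; rewrite E => b' Ab' ib' sb'; apply/graded_dimP; exists b'.
Qed.

Local Notation ev := (@evaluation k c.+1).
Local Notation V := (kmatrix k N 1 N).

Lemma evaluation_sum (T : finType) (x : T -> k) (b : T -> V) :
  ev (\sum_t x t *: b t) = \sum_t x t *: ev (b t).
Proof.
rewrite /evaluation; under [RHS]eq_bigr => t _ do rewrite scaler_sumr.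
rewrite exchange_big /=; apply: eq_bigr => i _.
rewrite (summxE _ _ _ 0 i) mulr_suml; apply: eq_bigr => t _.
by rewrite kmatrix_mxE scalerAl.
Qed.

Lemma evaluation_linear (g : R) (u v : 'rV[R]_N) : ev (g *: u + v) = g * ev u + ev v.
Proof.
rewrite /evaluation mulr_sumr -big_split; apply: eq_bigr => i _.
by rewrite !mxE mulrDl mulrA.
Qed.

Lemma evaluation_unit (g : R) i : ev (g *: delta_mx 0 i) = g * 'X_i.
Proof.
rewrite /evaluation (bigD1 i) //= !mxE !eqxx mulr1 big1 ?addr0 // => j ji.
by rewrite !mxE (negbTE ji) andbF mulr0 mul0r.
Qed.

Lemma evaluation_homog m (v : 'rV[R]_N) : (forall j, v 0 j \is m.-homog) -> ev v \is m.+1.-homog.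
Proof.
move=> hv; apply: rpred_sum => i _.
by have := dhomogM (hv i) (variable_homog k i); rewrite addn1.
Qed.

(** Evaluation is onto S_(m+1), since S is generated in degree one. The lower bound is rank and
    nullity; the upper bound uses one preimage of each normal monomial. *)
Lemma kernel_dim m : graded_dim (n := c.+1) f (@kernel_bundle k c.+1 c f) m
  (N * #|nmon m| - #|nmon m.+1|).
Proof.
have sI := equation_ideal_subspace (n := c.+1) f.
have cardE : #|{: 'I_N * nmon m}| = (N * #|nmon m|)%N by rewrite card_prod card_ord.
apply: graded_dim_bounds; last first.
  have [|X [iX ZX]] := @kernel_family k V R (zmod N) I _ _ (@free_basis N m)
    (fun it => ev (free_basis it)) (fun t : nmon m.+1 => 'X_[monomial_of t] : R)
    sI (@free_basis_independent N m).
    by move=> it; apply: normal_monomials_span; apply: evaluation_homog => j; apply: free_basis_homog.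
  move: X iX ZX; rewrite cardE => X iX ZX.
  exists (fun i => \sum_t X i t *: free_basis t); split=> // i; split=> [|j].
    by rewrite /kernel_bundle /= evaluation_sum; apply: ZX.
  rewrite free_basisE; apply: rpred_sum => t _; apply: rpredZ.
  by apply: dhomog_monomial; apply: monomial_of_mdeg.
move=> T b Ab ib.
(* Z' is the kernel of evaluation into S. A family in the kernel with #|T| members leaves room for
   at most N hS(m) - #|T| vectors independent modulo Z', and the preimages of the normal monomials
   of degree m + 1 are such vectors. *)
pose Z' (v : V) := I (ev v).
have sZ' : subspace Z'.
  split; first by rewrite /Z' /evaluation big1 => [|i _]; [case: sI | rewrite mxE mul0r].
  by move=> e u v Zu Zv; rewrite /Z' evaluation_linear mul_mpolyC; case: sI => _; apply.
have leT : (#|T| <= N * #|nmon m|)%N.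
  rewrite -cardE; apply: (independent_card (zero_mod_subspace f 1 N) ib) => t.
  by apply: free_basis_span => j; case: (Ab t).
pose U (v : V) := forall j, v 0 j \is m.-homog.
have bd : bounded_dim Z' U (#|{: 'I_N * nmon m}| - #|T|).
  apply: (bounded_dim_quotient (Z := zmod N) (b := @free_basis N m) (b' := b)) => //.
  - exact: zero_mod_subspace.
  - move=> v Zv; apply: equation_ideal_sum => i _; rewrite mulrC; apply: equation_idealM; exact: Zv.
  - by move=> u hu; apply: free_basis_span.
  - by move=> t; case: (Ab t).
  by move=> t; case: (Ab t).
have pick_var (t : nmon m.+1) : exists i, monomial_of t i != 0%N.
  apply: contrapT => H; have := monomial_of_mdeg t; rewrite mdegE big1 // => i _.
  by apply/eqP; apply: contrapT => /negP ?; apply: H; exists i.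
have [i Hi] := choice pick_var.
have mE t : (monomial_of t - U_(i t) + U_(i t))%MM = monomial_of t by rewrite submK // lep1mP.
have := bd (nmon m.+1) (fun t => ('X_[monomial_of t - U_(i t)] : R) *: (delta_mx 0 (i t) : 'rV[R]_N)).
have U1 t : U (('X_[monomial_of t - U_(i t)] : R) *: (delta_mx 0 (i t) : 'rV[R]_N)).
  move=> j; rewrite !mxE; case: (_ && _); rewrite ?mulr1 ?mulr0 ?dhomog0 //.
  apply: dhomog_monomial; have := monomial_of_mdeg t.
  by rewrite -{1}mE mdegD mdeg1 addn1 => -[].
move=> /(_ U1); have iZ : independent Z' (fun t : nmon m.+1 =>
    ('X_[monomial_of t - U_(i t)] : R) *: (delta_mx 0 (i t) : 'rV[R]_N) : V).
  move=> x; rewrite /Z' evaluation_sum => Zx; apply: normal_monomials_independent.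
  rewrite (eq_bigr (fun t => x t *: ev (('X_[monomial_of t - U_(i t)] : R) *: (delta_mx 0 (i t) : 'rV[R]_N)))) //.
  by move=> t _; rewrite evaluation_unit -mpolyXD mE.
by move=> /(_ iZ); rewrite cardE; lia.
Qed.

End GradedDimensions.

(** * The Hilbert function of the coordinate ring *)

Section CountNormalMonomials.

Variables (c : nat) (d : 'I_c -> nat) (G : finType) (co : G -> 'I_c -> nat).
Hypothesis co_lt : forall g j, (co g j < d j)%N.
Hypothesis co_inj : forall g g', co g =1 co g' -> g = g'.
Hypothesis co_surj : forall a : 'I_c -> nat, (forall j, a j < d j)%N ->
  exists g, co g =1 a.

Definition fibre_degree g := (\sum_j co g j)%N.

Lemma fibre_degree_le g : (fibre_degree g <= degree_bound d)%N.
Proof. by apply: leq_sum => j _; apply: ltnW. Qed.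

(** G also enumerates the exponents of the fibre variables, a basis of S over k[x_0, x_1]; what
    remains of the degree m is divided between x_0 and x_1. So the degree of the curve is #|G|. *)
Definition box_monomial m (u : {g : G & 'I_(m - fibre_degree g).+1}) : 'X_{1..c.+2} :=
  [multinom if unlift ord0 i is Some i' then
     if unlift ord0 i' is Some j then co (tag u) j else (m - fibre_degree (tag u) - tagged u)%N
   else tagged u | i < c.+2].

Lemma card_normal_monomial m : (degree_bound d <= m)%N ->
  #|normal_monomial d c m| = (\sum_g (m - fibre_degree g).+1)%N.
Proof.
move=> dm; transitivity #|{: {g : G & 'I_(m - fibre_degree g).+1}}|; last first.
  by rewrite card_tagged sumnE big_map big_enum /=; apply: eq_bigr => g _; rewrite card_ord.
have B0 u : @box_monomial m u ord0 = tagged u by rewrite mnmE unlift_none.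
have B1 u : @box_monomial m u (lift ord0 ord0) = (m - fibre_degree (tag u) - tagged u)%N.
  by rewrite mnmE liftK unlift_none.
have B2 u j : @box_monomial m u (fibre_var j) = co (tag u) j.
  by rewrite mnmE !liftK.
have toN u : exists t : normal_monomial d c m, monomial_of t = @box_monomial m u.
  apply: monomial_of_exists; last by apply/reducedP => j _; rewrite B2.
  rewrite mdeg_fibre_var B0 B1; under eq_bigr => j _ do rewrite B2.
  rewrite -/(fibre_degree (tag u)).
  by have := fibre_degree_le (tag u); case: u => g [l /= lt] H; lia.
have ofN (t : normal_monomial d c m) : exists u, @box_monomial m u = monomial_of t.
  have [|g Hg] := @co_surj (fun j => monomial_of t (fibre_var j)).
    by move=> j; apply/reducedP: (ltn_ord j); apply: monomial_of_reduced.
  have E : fibre_degree g = (\sum_j monomial_of t (fibre_var j))%N.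
    by apply: eq_bigr => j _; rewrite Hg.
  have := monomial_of_mdeg t; rewrite mdeg_fibre_var -E => Em.
  have lt : (monomial_of t ord0 < (m - fibre_degree g).+1)%N by lia.
  exists (Tagged (fun g => 'I_(m - fibre_degree g).+1) (Ordinal lt)); apply/mnmP => i.
  case: (unliftP ord0 i) => [i' ->|->]; last by rewrite B0.
  case: (unliftP ord0 i') => [j ->|->]; first by rewrite (B2 _ j) Hg.
  by rewrite B1 /=; lia.
have [F HF] := choice toN; have [F' HF'] := choice ofN.
apply/eqP; rewrite eqn_leq; apply/andP; split.
  by apply: (@leq_card _ _ F') => t t' E; apply: monomial_of_inj; rewrite -!HF' E.
apply: (@leq_card _ _ F) => u u' E.
have {E} E : @box_monomial m u = @box_monomial m u' by rewrite -!HF E.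
have Eg : tag u = tag u'.
  by apply: co_inj => j; have := congr1 (fun mu : 'X_{1..c.+2} => mu (fibre_var j)) E; rewrite !B2.
have := congr1 (fun mu : 'X_{1..c.+2} => mu ord0) E; rewrite !B0.
case: u u' Eg {E} => g l [g' l'] /= Eg; move: l'; case: _ / Eg => l' /val_inj->.
by [].
Qed.

End CountNormalMonomials.

(** * Polynomials of bounded growth *)

Section PolynomialGrowth.

Local Notation nat_eval p m := (p : {poly rat}).[m%:R].

Lemma poly_eq_nat (p q : {poly rat}) m0 :
  (forall m, (m0 <= m)%N -> nat_eval p m = nat_eval q m) -> p = q.
Proof.
move=> E; apply/eqP; rewrite -subr_eq0; apply: contraT => nz.
have := @max_poly_roots _ (p - q) [seq (m0 + i)%:R | i <- iota 0 (size (p - q))] nz.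
rewrite size_map size_iota ltnn; apply.
  apply/allP => _ /mapP[i _ ->]; rewrite /root !hornerE E ?subrr //; exact: leq_addr.
rewrite map_inj_uniq ?iota_uniq // => i j /eqP; rewrite eqr_nat eqn_add2l; exact: eqP.
Qed.

Lemma poly_vanishing_growth (p : {poly rat}) (K : rat) m0 :
  (forall m, (m0 <= m)%N -> `|m%:R * nat_eval p m| <= K) -> p = 0.
Proof.
elim/poly_ind: p K m0 => [//|p e IHp] K m0 H.
have p0 : p = 0.
  apply: (IHp (K + `|e|) m0.+1) => m mm.
  have m1 : (1 : rat) <= m%:R by rewrite ler1n; lia.
  have := H m (ltnW mm); rewrite hornerMXaddC normrM ger0_norm ?ler0n // => Hm.
  have Hm' : `|nat_eval p m * m%:R + e| <= K.
    by apply: le_trans Hm; rewrite ler_peMl.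
  rewrite mulrC -[X in `|X|](addrK e); apply: le_trans (ler_normB _ _) _.
  exact: lerD.
rewrite p0 mul0r add0r; have [->//|e0] := eqVneq e 0.
pose m := (m0 + (Num.truncn (K / `|e|)).+1)%N.
have := H m (leq_addr _ _); rewrite p0 mul0r add0r hornerC normrM ger0_norm ?ler0n //.
rewrite -ler_pdivlMr ?normr_gt0 // leNgt => /negP[].
apply: lt_le_trans (truncnS_gt _) _; by rewrite ler_nat leq_addl.
Qed.

(** It bounds the degree of the Hilbert polynomial of a subsheaf by comparison with the free sheaf.
    After removal of the first two coefficients, the quotient Q by X^2 has m Q(m) bounded, hence is
    zero. *)
Lemma poly_linear_growth (p : {poly rat}) (K : rat) m0 :
  (forall m, (m0 <= m)%N -> `|nat_eval p m| <= K * m%:R) -> (size p <= 2)%N.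
Proof.
move=> H; suff p0 : drop_poly 2 p = 0.
  by rewrite -(poly_take_drop 2 p) p0 mul0r addr0 size_take_poly.
pose K' := K + (`|p`_0| + `|p`_1|).
apply: (@poly_vanishing_growth _ K' m0.+1) => m mm.
have m1 : (1 : rat) <= m%:R by rewrite ler1n; lia.
have m0' : (0 : rat) < m%:R by rewrite ltr0n; lia.
have E : p = (drop_poly 2 p * 'X + (p`_1)%:P) * 'X + (p`_0)%:P.
  rewrite -{1}(poly_take_drop 2 p) mulrDl -mulrA -expr2 -addrA addrC; congr (_ + _).
  apply/polyP => i; rewrite coef_take_poly coefD coefMX !coefC.
  by case: i => [|[|i]] //=; rewrite ?add0r ?addr0.
have := H m (ltnW mm); rewrite {1}E !(hornerMXaddC, hornerD, hornerC, hornerMX) => Hm.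
rewrite -(ler_pM2r m0') -[X in _ * X](ger0_norm (ltW m0')) -normrM.
set y := nat_eval _ _ in Hm *.
have -> : m%:R * y * m%:R = ((y * m%:R + p`_1) * m%:R + p`_0) - (p`_1 * m%:R + p`_0) by ring.
apply: le_trans (ler_normB _ _) _; rewrite /K' [(K + _) * _]mulrDl; apply: lerD => //.
apply: le_trans (ler_normD _ _) _; rewrite normrM (ger0_norm (ltW m0')) mulrDl addrC lerD2r.
by rewrite ler_peMr.
Qed.

End PolynomialGrowth.

(** * Semistability *)

Section KernelBundle.

Variables (k : fieldType) (c : nat) (d : c.-tuple nat).
Local Notation R := {mpoly k[c.+2]}.
Local Notation N := c.+2.
Variable f : 'I_c -> R.
Hypothesis f_hyp : hypersurfaces d f.
Local Notation M := (@kernel_bundle k c.+1 c f).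
Local Notation ev := (@evaluation k c.+1).

Lemma evaluation_pihomog m (v : 'rV[R]_N) :
  ev (map_mx (pihomog mdeg m) v) = pihomog mdeg m.+1 (ev v).
Proof.
rewrite /evaluation linear_sum; apply: eq_bigr => i _; rewrite mxE.
by rewrite /= (pihomog_mul _ _ (variable_homog k i)) subn1.
Qed.

Lemma kernel_bundle_coherent : coherent_sheaf (n := c.+1) f M.
Proof.
split=> [v Zv|p u v Mu Mv|m v Mv]; rewrite /kernel_bundle /=.
- by apply: equation_ideal_sum => i _; rewrite mulrC; apply: equation_idealM.
- by rewrite evaluation_linear; apply: equation_idealD => //; apply: equation_idealM.
rewrite evaluation_pihomog; exact: (equation_ideal_pihomog f_hyp).
Qed.

(** The Koszul relations x_i e_l - x_l e_i for fixed i, which form a basis of the kernel bundle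
    where x_i is invertible. *)
Definition koszul_section (i : 'I_N) (j : 'I_c.+1) : 'rV[R]_N :=
  ('X_i : R) *: delta_mx 0 (lift i j) - ('X_(lift i j) : R) *: delta_mx 0 i.

Lemma koszul_section_lift i j l : koszul_section i j 0 (lift i l) = (j == l)%:R * 'X_i.
Proof.
rewrite /koszul_section mxE [X in X + _]mxE [X in _ + X]mxE [X in _ - X]mxE.
rewrite [X in _ * X - _]mxE [X in _ - _ * X]mxE (inj_eq lift_inj) [lift i l == i]eq_sym.
by rewrite (negbTE (neq_lift _ _)) mulr0 subr0 mulrC eq_sym.
Qed.

Lemma koszul_section_pivot i j : koszul_section i j 0 i = - 'X_(lift i j).
Proof.
rewrite /koszul_section mxE [X in X + _]mxE [X in _ + X]mxE [X in _ - X]mxE.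
by rewrite [X in _ * X - _]mxE [X in _ - _ * X]mxE (negbTE (neq_lift _ _)) mulr0 !eqxx /= mulr1 sub0r.
Qed.

Lemma koszul_combination_lift i (a : 'I_c.+1 -> R) l :
  (\sum_j a j *: koszul_section i j) 0 (lift i l) = a l * 'X_i.
Proof.
transitivity (\sum_j a j * ((j == l)%:R * 'X_i)).
  by rewrite summxE; apply: eq_bigr => j _; rewrite mxE koszul_section_lift.
rewrite (bigD1 l) //= eqxx mul1r big1 ?addr0 // => j ne.
by rewrite (negbTE ne) mul0r mulr0.
Qed.

Lemma koszul_combination i (a : 'I_c.+1 -> R) :
  (\sum_j a j *: koszul_section i j) 0 i = - \sum_j a j * 'X_(lift i j).
Proof.
rewrite summxE -sumrN; apply: eq_bigr => j _.
by rewrite mxE koszul_section_pivot mulrN.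
Qed.

Lemma kernel_bundle_locally_free : locally_free (n := c.+1) f M c.+1.
Proof.
move=> x [[i xi] _]; exists 1%N, ('X_i : R), (fun=> 1%N), (koszul_section i); split.
- by split; [apply: variable_homog | rewrite mevalXU].
- move=> j; split=> [|l].
    rewrite /kernel_bundle /= /koszul_section -scaleN1r addrC evaluation_linear.
    rewrite !evaluation_unit mulN1r mulrC addNr; exact: equation_ideal0.
  case: (unliftP i l) => [l' ->|->].
    by rewrite koszul_section_lift; case: eqP => _; rewrite ?mul1r ?mul0r ?dhomog0 ?variable_homog.
  by rewrite koszul_section_pivot; apply: rpredNr; apply: variable_homog.
- move=> v Mv; exists 1%N, (fun j => v 0 (lift i j)) => l; rewrite expr1 mxE [X in _ + X]mxE.
  rewrite [X in X + _]mxE; case: (unliftP i l) => [j ->|->].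
    by rewrite koszul_combination_lift mulrC subrr; apply: equation_ideal0.
  rewrite koszul_combination opprK; move: Mv; rewrite /kernel_bundle /= /evaluation.
  by rewrite (bigD1_ord i) //= mulrC.
move=> a Za; exists 1%N => j; rewrite expr1; have := Za (lift i j).
by rewrite koszul_combination_lift mulrC.
Qed.

Lemma kernel_bundle_vector_bundle : vector_bundle (n := c.+1) f M.
Proof. by split; [apply: kernel_bundle_coherent | exists c.+1; apply: kernel_bundle_locally_free]. Qed.

Hypothesis f_basis : has_normal_basis d f.

Lemma hilbert_polyE p (A : set 'rV[R]_p) (P : {poly rat}) m0 (D : nat -> nat) :
  (forall m, (m0 <= m)%N -> graded_dim (n := c.+1) f A m (D m) /\ P.[m%:R] = (D m)%:R) ->
  hilbert_poly (n := c.+1) f A = P.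
Proof.
move=> H; apply: xget_unique.
  by exists m0 => m mm; exists (D m); case: (H m mm).
move=> Q [m1 HQ]; apply: (@poly_eq_nat _ _ (m0 + m1)) => m mm.
have [|D' gD' ->] := HQ m; first lia.
have [|gD ->] := H m; first lia.
by rewrite (graded_dim_unique gD gD').
Qed.

Variables (G : finType) (co : G -> 'I_c -> nat).
Hypothesis co_lt : forall g j, (co g j < tnth d j)%N.
Hypothesis co_inj : forall g g', co g =1 co g' -> g = g'.
Hypothesis co_surj : forall a : 'I_c -> nat, (forall j, a j < tnth d j)%N ->
  exists g, co g =1 a.
Hypothesis G_gt0 : (0 < #|G|)%N.

Local Notation hS m := #|normal_monomial (tnth d) c m|.
Local Notation E := (\sum_g fibre_degree co g)%N.
Local Notation chi := (#|G|%:R - E%:R : rat).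

Lemma structure_sheaf_dim m : (degree_bound (tnth d) <= m)%N ->
  (hS m + E = #|G| * m + #|G|)%N.
Proof.
move=> dm; rewrite (card_normal_monomial co_lt co_inj co_surj dm) -big_split /=.
rewrite -mulnSr -sum_nat_const; apply: eq_bigr => g _.
by have := fibre_degree_le co_lt g; lia.
Qed.

Lemma hilbert_poly_structure_sheaf :
  hilbert_poly (n := c.+1) f (@free_sheaf k c.+1 1) = #|G|%:R *: 'X + chi%:P.
Proof.
apply: (@hilbert_polyE _ _ _ (degree_bound (tnth d)) (fun m => 1 * hS m)%N) => m dm; split.
  exact: free_sheaf_dim.
rewrite mul1n hornerD hornerZ hornerX hornerC.
have /(congr1 (fun n => n%:R : rat)) := structure_sheaf_dim dm.
by rewrite !natrD natrM => E'; rewrite addrA -E' addrK.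
Qed.

Lemma hilbert_poly_kernel : hilbert_poly (n := c.+1) f M =
  (c.+1%:R * #|G|%:R) *: 'X + (c.+1%:R * chi - #|G|%:R)%:P.
Proof.
apply: (@hilbert_polyE _ _ _ (degree_bound (tnth d) + E + 1) (fun m => N * hS m - hS m.+1)%N) => m dm.
split; first exact: kernel_dim.
rewrite hornerD hornerZ hornerX hornerC.
have E1 : (hS m + E = #|G| * m + #|G|)%N by apply: structure_sheaf_dim; lia.
have E2 : (hS m.+1 + E = #|G| * m.+1 + #|G|)%N by apply: structure_sheaf_dim; lia.
have le : (hS m.+1 <= N * hS m)%N by nia.
rewrite natrB // natrM.
have := congr1 (fun n => n%:R : rat) E1; have := congr1 (fun n => n%:R : rat) E2.
rewrite !(natrD, natrM) !mulrSr => E2' E1'.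
have -> : (hS m)%:R = #|G|%:R * m%:R + #|G|%:R - E%:R :> rat by rewrite -E1' addrK.
have -> : (hS m.+1)%:R = #|G|%:R * (m%:R + 1) + #|G|%:R - E%:R :> rat by rewrite -E2' addrK.
by ring.
Qed.

Lemma linear_coef (p0 p1 : rat) : ((p1 *: 'X + p0%:P)`_1 = p1) * ((p1 *: 'X + p0%:P)`_0 = p0).
Proof. by rewrite !coefD !coefZ !coefX !coefC /= mulr1 mulr0 add0r addr0. Qed.

Lemma size_linear (p0 p1 : rat) : p1 != 0 -> size (p1 *: 'X + p0%:P) = 2.
Proof. by move=> nz; rewrite -mul_polyC size_MXaddC polyC_eq0 (negbTE nz) size_polyC nz. Qed.

Lemma G_neq0 : #|G|%:R != 0 :> rat.
Proof. by rewrite pnatr_eq0 -lt0n. Qed.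

Lemma complete_intersection : complete_intersection_curve (n := c.+1) f.
Proof. by split=> //; rewrite hilbert_poly_structure_sheaf size_linear // G_neq0. Qed.

Lemma slope_kernel : slope (n := c.+1) f M = - (#|G|%:R / c.+1%:R).
Proof.
rewrite /slope /sheaf_degree /sheaf_rank hilbert_poly_kernel hilbert_poly_structure_sheaf.
rewrite !linear_coef; have := G_neq0; have : c.+1%:R != 0 :> rat by rewrite pnatr_eq0.
by move: (c.+1%:R : rat) (#|G|%:R : rat) => x y x0 y0; field; rewrite x0 y0.
Qed.

Variables (t : 'rV[R]_#|G|) (h : R) (tau e a b : nat).
Hypothesis t_homog : forall j, t 0 j \is tau.-homog.
Hypothesis h_homog : h \is e.-homog.
Hypothesis h_base : base_poly h.
Hypothesis h_kill : kill_x0 h != 0.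
Hypothesis no_test_section : forall v, homog_mx a v -> test_section f t h v -> zero_mod f v.
Hypothesis e_le : (e + b <= #|G| * a)%N.
Hypothesis E_le : (c.+1 * E + #|G| <= c.+1 * (b + #|G|))%N.

(** Positive rank excludes the default value 0 of [hilbert_poly], so the polynomial really computes
    the dimensions. *)
Lemma subsheaf_hilbert_poly (B : set 'rV[R]_N) : 0 < sheaf_rank (n := c.+1) f B ->
  exists m0 (D : nat -> nat), forall m, (m0 <= m)%N ->
   graded_dim (n := c.+1) f B m (D m) /\ (hilbert_poly (n := c.+1) f B).[m%:R] = (D m)%:R.
Proof.
rewrite /sheaf_rank {1}/hilbert_poly; case: xgetP => [P EP [m0 HP] _|_]; last by rewrite coef0 mul0r ltxx.
have H m : exists D, (m0 <= m)%N -> graded_dim (n := c.+1) f B m D /\ P.[m%:R] = D%:R.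
  case: (leqP m0 m) => [mm|_]; last by exists 0%N.
  by have [D H1 H2] := HP m mm; exists D.
have [D HD] := choice H.
by exists m0, D => m mm; rewrite (hilbert_polyE HD); apply: HD.
Qed.

Lemma subsheaf_slope (B : set 'rV[R]_N) : coherent_sheaf (n := c.+1) f B ->
  (forall v, B v -> M v) -> 0 < sheaf_rank (n := c.+1) f B ->
  slope (n := c.+1) f B <= slope (n := c.+1) f M.
Proof.
move=> cB BM rB; have [m0 [D HD]] := subsheaf_hilbert_poly rB.
rewrite slope_kernel /slope /sheaf_degree; move: rB; rewrite /sheaf_rank.
rewrite hilbert_poly_structure_sheaf !linear_coef.
set P := hilbert_poly _ _ in HD *.
have q0 : (0 : rat) < #|G|%:R by rewrite ltr0n.
rewrite pmulr_lgt0 ?invr_gt0 // => P1.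
have sP : (size P <= 2)%N.
  apply: (@poly_linear_growth P (2 * N * #|G|)%:R (m0 + degree_bound (tnth d) + 1)) => m mm.
  have [|gD ->] := HD m; first lia.
  rewrite normr_nat -natrM ler_nat; apply: leq_trans (graded_dim_le f_hyp f_basis gD) _.
  have : (hS m + E = #|G| * m + #|G|)%N by apply: structure_sheaf_dim; lia.
  by nia.
have PE m : P.[m%:R] = P`_0 + P`_1 * m%:R.
  rewrite (horner_coef_wide _ sP) !big_ord_recl big_ord0 /= addr0 expr0 mulr1.
  by rewrite expr1.
have [_ D0] := HD m0 (leqnn _); have [_ D1] := HD m0.+1 (leqnSn _).
have [beta PB] : exists beta, P`_1 = beta%:R.
  exists (D m0.+1 - D m0)%N.
  have E1 : (D m0.+1)%:R - (D m0)%:R = P`_1 by rewrite -D0 -D1 !PE mulrSr; ring.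
  by rewrite natrB // -(ler_nat rat) -subr_ge0 E1 ltW.
have DE m : (m0 <= m)%N -> (D m = D m0 + beta * (m - m0))%N.
  move=> mm; apply/eqP; rewrite -(eqr_nat rat) natrD natrM natrB // -PB.
  have [_ <-] := HD m mm; rewrite -D0 !PE; apply/eqP; ring.
have [m1 Hm1] := subsheaf_bound f_hyp f_basis t_homog h_homog h_base h_kill no_test_section cB BM
  (fun m mm => conj (HD m mm).1 (DE m mm)).
have [m [m0m m1m am]] : exists m, [/\ (m0 <= m)%N, (m1 <= m)%N & (a <= m)%N].
  by exists (m0 + m1 + a)%N; split; lia.
have [_ Dm] := HD m m0m.
have := Hm1 m m1m; rewrite -(ler_nat rat) !(natrD, natrM) natrB // -Dm PE -PB => bound.
have e_le' : e%:R + b%:R <= #|G|%:R * a%:R :> rat by rewrite -natrD -natrM ler_nat.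
have E_le' : c.+1%:R * E%:R + #|G|%:R <= c.+1%:R * (b%:R + #|G|%:R) :> rat.
  by rewrite -natrD -!natrM -natrD ler_nat.
have n0 : 0 < c.+1%:R :> rat by rewrite ltr0n.
move: bound e_le' E_le' n0 q0 P1; clear.
move: (c.+1%:R : rat) (#|G|%:R : rat) (P`_0) (P`_1) (m%:R : rat) (a%:R : rat) (b%:R : rat) (e%:R : rat) (E%:R : rat).
move=> n q p0 p1 x a' b' e' E' bound e_le' E_le' n0 q0 p10.
have -> : (p0 - p1 / q * (q - E')) / (p1 / q) = q * p0 / p1 - (q - E').
  by field; rewrite !gt_eqF.
(* In these letters [subsheaf_bound] says q p0 + q p1 a <= p1 e, and e - q a <= - b by the choice of
   deg h. *)
have H1 : q * p0 / p1 <= - b'.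
  rewrite ler_pdivrMr //; nra.
have H2 : q / n <= b' + q - E'.
  by rewrite ler_pdivrMr //; nra.
lra.
Qed.

Theorem kernel_bundle_semistable : semistable_vector_bundle (n := c.+1) f M.
Proof. by split; [apply: kernel_bundle_vector_bundle | move=> B cB BM; apply: subsheaf_slope]. Qed.

End KernelBundle.

(** * From a cycle of lines to the general complete intersection *)

Section GeneralCompleteIntersection.

Variables (k : fieldType) (char0 : [pchar k] =i pred0).
Variables (H : finZmodType) (b r' : nat) (coH : H -> 'I_b -> nat) (d : b.+1.-tuple nat).
Local Notation r := r'.+2.

Hypothesis d_last : tnth d ord_max = r.
Hypothesis coH_lt : forall h i, (coH h i < tnth d (lift ord_max i))%N.
Hypothesis coH_surj : forall a : 'I_b -> nat, (forall i, (a i < tnth d (lift ord_max i))%N) ->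
  exists h, coH h =1 a.
Hypothesis coH_inj : forall h h', coH h =1 coH h' -> h = h'.
Hypothesis coH_shift : forall h h' s i, (coH (h + s) i == coH (h' + s) i) = (coH h i == coH h' i).
Hypothesis cycle : forall h, (\sum_h' (adjacent coH h h') = 2)%N.
Hypothesis path_connected : forall (m : H) (Y : H -> Prop) h0, h0 != m -> Y h0 ->
  (forall h h', h != m -> h' != m -> adjacent coH h h' -> Y h' -> Y h) ->
  forall h, h != m -> Y h.
Hypothesis path_directions : forall (m : H) i, exists h h',
  [/\ h != m, h' != m, adjacent coH h h' & coH h i <> coH h' i].
Variables h0 h1 h2 : H.
Hypothesis h_distinct : [/\ h0 != h1, h0 != h2 & h1 != h2].
Hypothesis card_H : #|H| = b.+2.
Hypothesis sum_H : (\sum_h \sum_i coH h i = b.+2)%N.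

Local Notation G := (line_index H r').
Local Notation co := (@line_coord H b r' coH).
Local Notation rk := (@chain_rank H r' h0 h1 h2).

Lemma line_coord_lt g i : (co g i < tnth d i)%N.
Proof.
case: (unliftP ord_max i) => [j ->|->]; first by rewrite line_coord_lift.
by rewrite line_coord_last d_last.
Qed.

Lemma line_coord_surj (a : 'I_b.+1 -> nat) : (forall i, (a i < tnth d i)%N) -> exists g, co g =1 a.
Proof.
move=> a_lt; have [h Hh] := @coH_surj (fun i => a (lift ord_max i)) (fun i => a_lt _).
have lt : (a ord_max < r)%N by have := a_lt ord_max; rewrite d_last.
exists ((h, Ordinal lt) : G) => i.
case: (unliftP ord_max i) => [j ->|->]; first by rewrite line_coord_lift Hh.
by rewrite line_coord_last.
Qed.

Lemma card_line_index : #|{: G}| = (b.+2 * r)%N.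
Proof. by rewrite card_prod card_ord card_H. Qed.

(** Since r' + 1 = r - 1, the right-hand side is (b + 2) r (r + 1), the number of ordered adjacent
    pairs. So the sum E is the number of nodes, and #|G| - E is the Euler characteristic of the
    union of lines. *)
Lemma sum_fibre_degree : (2 * \sum_g fibre_degree co g = 2 * b.+2 * r + b.+2 * r * r'.+1)%N.
Proof.
have E (h : H) (j : 'I_r) : fibre_degree co ((h, j) : G) = (j + \sum_i coH h i)%N.
  rewrite /fibre_degree (bigD1_ord ord_max) //= line_coord_last; congr (_ + _)%N.
  by apply: eq_bigr => i _; rewrite line_coord_lift.
rewrite sum_line_index; under eq_bigr => h _.
  under eq_bigr => j _ do rewrite E.
  rewrite big_split /= [X in (_ + X)%N]sum_nat_const card_ord; over.
rewrite big_split /= -big_distrr /= sum_H sum_nat_const card_H mulnDr addnC.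
have -> : (\sum_(j < r) j = 'C(r, 2))%N by rewrite -triangular_sum big_mkord.
have : (2 * 'C(r, 2) = r * r'.+1)%N by have := bin_ffact r 2; rewrite ffactnSr ffactn1 mulnC.
by nia.
Qed.

(** E minus the sum of the #|later| is the number of nodes inside chains, at most r (b + 1); adding
    r gives #|G| = (b + 2) r. This is the numerical condition [E_le] with n = b + 2. *)
Lemma sum_later_bound :
  (b.+2 * \sum_g fibre_degree co g + b.+2 * r <= b.+2 * (\sum_g #|later co rk g| + b.+2 * r))%N.
Proof.
have := sum_later r' coH_inj cycle h0 h1 h2; have := sum_same_chain r' coH_inj cycle h0 h1 h2.
have := sum_fibre_degree; rewrite card_H.
set E := (\sum_g fibre_degree _ _)%N; set D := (\sum_g #|_|)%N; set S := (\sum_g _)%N.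
by move: E D S => E D S *; nia.
Qed.

Theorem general_kernel_bundle_semistable :
  for_general_hypersurfaces (k := k) (n := b.+2) d (fun f =>
    complete_intersection_curve f /\
    semistable_vector_bundle f (@kernel_bundle k b.+2 b.+1 f)).
Proof.
pose f0 := special_system k d.
have f0_hyp := special_system_hyp k d; have f0_lead := @special_system_lead k _ d.
have f0_tail := @special_system_tail k _ d.
have nb := near_has_normal_basis f0_hyp f0_lead f0_tail.
have cs := @line_coord_shift H b r' coH coH_shift.
have rk_good : good_rank co rk by apply: chain_good.
have [t [tau [e_le th nt]]] := special_no_test_section char0 line_coord_lt
  (line_coord_inj coH_inj) line_coord_surj cs rk_good (fun g => max_card _).
(* Any [a] that dominates the number of later neighbours of each line would do; the number of all
   lines is the simplest choice. *)
pose a := #|{: G}|.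
have hh := @abscissas_form_homog k b.+1 G co rk a.
have hb := @abscissas_form_base k b.+1 G co rk a.
have hk := @abscissas_form_kill k b.+1 G co rk a.
have nv := near_no_test_section f0_hyp nb
  (near_reducer_basis f0_hyp f0_lead f0_tail b.+1) th
  hh hb hk e_le nt.
have [Phi [Phi0 HPhi]] := near_and nb nv.
exists Phi; split; first by exists f0.
move=> f hf /(HPhi f hf)[bf vf].
have G0 : (0 < #|{: G}|)%N by rewrite card_line_index.
split.
  exact: (complete_intersection hf bf line_coord_lt (line_coord_inj coH_inj) line_coord_surj G0).
apply: (kernel_bundle_semistable hf bf line_coord_lt (line_coord_inj coH_inj) line_coord_surj G0
  th hh hb hk vf
  (b := (\sum_g #|later co rk g|)%N)).
  rewrite -big_split /= -sum_nat_const; apply: leq_sum => g _.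
  by rewrite subnK // max_card.
by have := sum_later_bound; rewrite card_line_index.
Qed.

End GeneralCompleteIntersection.

(** * The two cycles: triangle and quadrilateral *)

Section Triangle.

Definition triangle_coord (h : 'I_3) (i : 'I_1) : nat := h.

(** With a single coordinate, distinct lines differ in exactly one: the three lines are coplanar and
    meet pairwise. *)
Lemma triangle_adjacent h h' : adjacent triangle_coord h h' = (h != h').
Proof.
apply/adjacentP/idP => [[i ne _]|ne]; first by apply: contra_notN ne => /eqP->.
exists ord0 => [E|i]; last by rewrite [i]ord1 eqxx.
by rewrite (val_inj E) eqxx in ne.
Qed.

Theorem plane_section_triangle (k : fieldType) (char0 : [pchar k] =i pred0) r' :
  for_general_hypersurfaces (k := k) (n := 3) [tuple 3%N; r'.+2] (fun f =>
    complete_intersection_curve f /\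
    semistable_vector_bundle f (@kernel_bundle k 3 2 f)).
Proof.
have third (m : 'I_3) : [/\ m + 1 != m, m - 1 != m & m + 1 != m - 1].
  by case: m => [[|[|[|]]] ?].
apply: (@general_kernel_bundle_semistable k char0 'I_3 1 r' triangle_coord _ _ _ _ _ _ _ _ _ 0 1 (-1)).
- by rewrite (tnth_nth 0%N).
- by move=> h i; rewrite [i]ord1 (tnth_nth 0%N) /=; apply: ltn_ord h.
- move=> a /(_ ord0); rewrite (tnth_nth 0%N) /= => lt.
  by exists (Ordinal lt) => i; rewrite [i]ord1.
- by move=> h h' E; apply: val_inj; apply: (E ord0).
- by move=> h h' s i; rewrite /triangle_coord !(inj_eq val_inj) (inj_eq (addIr s)).
- move=> h; under eq_bigr => h' _ do rewrite triangle_adjacent.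
  have := cardC1 h; rewrite card_ord -sum1_card big_mkcond /=; apply: etrans.
  by apply: eq_bigr => h' _; rewrite inE eq_sym; case: eqP.
- move=> m Y h0 h0m Yh0 step h hm; have [->//|ne] := eqVneq h h0.
  by apply: (step h h0) => //; rewrite triangle_adjacent.
- move=> m i; have [n1 n2 n12] := third m; exists (m + 1), (m - 1).
  split; rewrite ?triangle_adjacent // => /val_inj E.
  by rewrite E eqxx in n12.
- by [].
- by rewrite card_ord.
by rewrite !big_ord_recl !big_ord0.
Qed.

End Triangle.

Section Square.

Local Notation H := (fin_prod 'I_2 'I_2).
HB.instance Definition _ := FinRing.Zmodule.on H.

Definition square_coord (h : H) (i : 'I_2) : nat := if i == ord0 then h.1 else h.2.

Lemma square_adjacent h h' :
  adjacent square_coord h h' = ((h.1 == h'.1) != (h.2 == h'.2)).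
Proof.
apply/adjacentP/idP => [[i ne E]|].
  have := E (i + 1); move: ne {E}; rewrite /square_coord.
  case: i => [[|[|//]] ?] /=.
    by move=> /eqP; rewrite (inj_eq val_inj) => /negbTE-> /(_ isT) /eqP; rewrite (inj_eq val_inj) => ->.
  by move=> /eqP; rewrite (inj_eq val_inj) => /negbTE-> /(_ isT) /eqP; rewrite (inj_eq val_inj) => ->.
have [E1|n1] := eqVneq h.1 h'.1; have [E2|n2] := eqVneq h.2 h'.2 => // _.
  exists ord_max => [/val_inj E|i]; first by rewrite E eqxx in n2.
  by case: i => [[|[|//]] ?]; rewrite /square_coord /= ?E1.
exists ord0 => [/val_inj E|i]; first by rewrite E eqxx in n1.
by case: i => [[|[|//]] ?]; rewrite /square_coord /= ?E2.
Qed.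

Theorem quadrics_section_square (k : fieldType) (char0 : [pchar k] =i pred0) r' :
  for_general_hypersurfaces (k := k) (n := 4) [tuple 2%N; 2%N; r'.+2] (fun f =>
    complete_intersection_curve f /\
    semistable_vector_bundle f (@kernel_bundle k 4 3 f)).
Proof.
have ord2 (x : 'I_2) : x = 0 \/ x = 1.
  by case: x => [[|[|//]] ?]; [left | right]; apply: val_inj.
have sumH (F : H -> nat) : (\sum_h F h = F (0%R, 0%R) + F (0%R, 1%R) + (F (1%R, 0%R) + F (1%R, 1%R)))%N.
  rewrite (_ : \sum_h F h = \sum_(x : 'I_2) \sum_(y : 'I_2) F (x, y))%N.
    rewrite !big_ord_recl !big_ord0 !addn0; congr (_ + _ + (_ + _))%N; congr (F (_, _)); exact: val_inj.
  by rewrite pair_bigA; apply: eq_bigr => -[].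
(* Without m the quadrilateral is a path of three lines; its middle one is opposite to m, with both
   coordinates changed. *)
have opposite (m h : H) : h != m -> h != (m.1 + 1, m.2 + 1) -> adjacent square_coord h (m.1 + 1, m.2 + 1).
  case: m h => [m1 m2] [a1 a2]; rewrite square_adjacent /=.
  by case: (ord2 m1) => ->; case: (ord2 m2) => ->; case: (ord2 a1) => ->; case: (ord2 a2) => ->.
have opposite_neq (m : H) : (m.1 + 1, m.2 + 1) != m.
  by case: m => m1 m2; case: (ord2 m1) => ->; case: (ord2 m2) => ->.
apply: (@general_kernel_bundle_semistable k char0 H 2 r' square_coord _ _ _ _ _ _ _ _ _
  (0, 0) (0, 1) (1, 0)).
- by rewrite (tnth_nth 0%N).
- by move=> [x y] [[|[|//]] ?]; rewrite (tnth_nth 0%N) /square_coord /=; apply: ltn_ord.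
- move=> a Ha; have := Ha ord0; have := Ha ord_max; rewrite !(tnth_nth 0%N) /= => lt2 lt1.
  exists (Ordinal lt1, Ordinal lt2) => -[[|[|//]] ?] /=; congr (a _); exact: val_inj.
- move=> [x y] [x' y'] E; congr (_, _); apply: val_inj; [exact: (E ord0) | exact: (E ord_max)].
- by move=> h h' s i; rewrite /square_coord; case: ifP => _; rewrite !(inj_eq val_inj) (inj_eq (addIr _)).
- move=> [x y]; rewrite sumH !square_adjacent /=.
  by case: (ord2 x) => ->; case: (ord2 y) => ->.
- move=> m Y h0 h0m Yh0 step.
  have Yo : Y (m.1 + 1, m.2 + 1).
    have [<-//|ne] := eqVneq h0 (m.1 + 1, m.2 + 1).
    by apply: (step _ h0) => //; rewrite adjacent_sym; apply: opposite.
  move=> h hm; have [->//|ne] := eqVneq h (m.1 + 1, m.2 + 1).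
  by apply: (step _ _ hm _ _ Yo) => //; apply: opposite.
- move=> [x y] i; have [-> | ->] := ord2 i; [exists (x, y + 1), (x + 1, y + 1) | exists (x + 1, y), (x + 1, y + 1)];
  rewrite square_adjacent; by case: (ord2 x) => ->; case: (ord2 y) => ->.
- by [].
- by rewrite card_prod card_ord.
by rewrite sumH /square_coord !big_ord_recl !big_ord0.
Qed.

End Square.

Theorem mainTheorem3 (k : closedFieldType) (char0 : [pchar k] =i pred0)
    (r : nat) (hr : (2 <= r)%N) :
  for_general_hypersurfaces (n := 3) [tuple 3%N; r]
    (fun f : 'I_2 -> {mpoly k[4]} =>
       complete_intersection_curve f /\
       semistable_vector_bundle f (@kernel_bundle k 3 2 f))
  /\
  for_general_hypersurfaces (n := 4) [tuple 2%N; 2%N; r]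
    (fun f : 'I_3 -> {mpoly k[5]} =>
       complete_intersection_curve f /\
       semistable_vector_bundle f (@kernel_bundle k 4 3 f)).
Proof.
case: r hr => [|[|r']] // _.
by split; [apply: plane_section_triangle | apply: quadrics_section_square].
Qed.
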